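(* Let $k\ge1$ be an integer, let $(Y(t))_{t\ge0}$ be the continuous-time interacting particle process with $k$ rows, started from $Y(0)=0$, described in the context, and let $Y^k(t)$ be its $k$-th row. Let $(e_1,\dots,e_{[\frac{k+1}{2}]})$ be the canonical basis of $\mathbb R^{[\frac{k+1}{2}]}$. Then $(Y^k(t),t\ge0)$ is a Markov process on $\mathcal W^+_{k+1}$ with infinitesimal generator $A_k$ given by $$A_k(\lambda,\beta)=\begin{cases} 2\,\dfrac{s_k(\beta)}{s_k(\lambda)}\,1_{\beta\in\mathcal W^+_{k+1}} & \text{if } k \text{ is odd, } \lambda_{\frac{k+1}{2}}=0 \text{ and } \beta_{\frac{k+1}{2}}=1,\\[2mm] \dfrac{s_k(\beta)}{s_k(\lambda)}\,1_{\beta\in\mathcal W^+_{k+1}} & \text{otherwise,}\end{cases}$$ for $\lambda\in\mathcal W^+_{k+1}$ and $\beta\in\{\lambda+e_1,\dots,\lambda+e_{[\frac{k+1}{2}]},\lambda-e_1,\dots,\lambda-e_{[\frac{k+1}{2}]}\}$.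
   Context: **Notation.** $\mathbb N=\{0,1,2,\dots\}$, $[a]$ is the integer part. For $x,y\in\mathbb R^n$ with weakly decreasing coordinates, $x\preceq y$ means $x_n\le y_n\le x_{n-1}\le\cdots\le x_1\le y_1$; for $x\in\mathbb R^n$, $y\in\mathbb R^{n+1}$, $x\preceq y$ means $y_{n+1}\le x_n\le y_n\le\cdots\le x_1\le y_1$. $|x|$ is the vector of absolute values of the coordinates of $x$. **Gelfand-Tsetlin patterns.** $GT_k$ is the set of $(x^1,\dots,x^k)$ with $x^{i}\in\mathbb N^{j-1}\times\mathbb Z$ if $i=2j-1$, $x^i\in\mathbb N^j$ if $i=2j$, and $|x^{i-1}|\preceq|x^i|$ for all $2\le i\le k$ (each $|x^i|$ having weakly decreasing coordinates). For $\lambda\in\mathbb Z^{[\frac{k+1}{2}]}$, $s_k(\lambda)$ is the number of elements of $GT_k$ whose $k$-th row equals $\lambda$. $\mathcal W^+_{k+1}$ is the set of $\lambda\in\mathbb N^{[\frac{k+1}{2}]}$ with $\lambda_1\ge\lambda_2\ge\cdots$. **Generator convention.** For $\lambda\neq\beta$, $A_k(\lambda,\beta)$ is the jump rate from $\lambda$ to $\beta$; off-diagonal entries not listed are $0$ and the diagonal is determined by zero row sums. **Process $Y$.** $(Y(t))_{t\ge0}$ takes values in the elements of $GT_k$ with non-negative entries; $Y^i_j(t)$ is the position of the particle labeled $(i,j)$, $1\le i\le k$, $1\le j\le[\frac{i+1}{2}]$, and $Y(0)=0$. Every particle tries to jump to the left by one and to the right by one after independent exponentially distributed waiting times with mean $1$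 (all clocks, for all particles and both directions, are independent and renewed). When particle $(i,j)$ wants to jump to the right at time $t$: (R1) if $i,j\ge2$ and $Y^i_j(t^-)=Y^{i-1}_{j-1}(t^-)$, nothing moves; (R2) otherwise particles $(i,j),(i+1,j),\dots,(i+l,j)$ all jump to the right by one, where $l$ is the largest integer (with $i+l\le k$) such that $Y^{i+l}_j(t^-)=Y^i_j(t^-)$. When particle $(i,j)$ wants to jump to the left at time $t$: (L1) if $i$ is odd, $j=(i+1)/2$ and $Y^i_j(t^-)=0$, then the particle is reflected and everything happens as if it were trying to jump to the right by one (rules R1, R2); (L2) if $i$ is odd, $j=(i+1)/2$ and $Y^i_j(t^-)\ge1$, then $Y^i_j(t)=Y^i_j(t^-)-1$; (L3) if $i$ is even or $j\ne(i+1)/2$, and $Y^i_j(t^-)=Y^{i-1}_j(t^-)$, nothing moves; (L4) if $i$ is even or $j\neq(i+1)/2$, and $Y^i_j(t^-)>Y^{i-1}_j(t^-)$, then particles $(i,j),(i+1,j+1),\dots,(i+l,j+l)$ all jump to the left by one, where $l$ is the largest integer (with $i+l\le k$) such that $Y^{i+l}_{j+l}(t^-)=Y^i_j(t^-)$. *)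

(* Defs.v *)
From HB Require Import structures.
From mathcomp Require Import all_boot all_order all_algebra finmap.
From mathcomp Require Import all_classical all_reals all_analysis.

Set Implicit Arguments.
Unset Strict Implicit.
Unset Printing Implicit Defensive.

Import Order.TTheory GRing.Theory Num.Theory.
Import numFieldNormedType.Exports.

Local Open Scope classical_set_scope.
Local Open Scope ring_scope.

(* Rows and columns are numbered from 1: row i has (i + 1) / 2 particles.
   Row 0 of the index type 'I_k.+1 is empty, since 1./2 = 0. *)
Definition particle (k : nat) := {i : 'I_k.+1 & 'I_((i : nat).+1)./2}.

Definition prow (k : nat) (p : particle k) : nat := tag p.
Definition pcol (k : nat) (p : particle k) : nat := (tagged p : nat).+1.

Definition pattern (k : nat) := {ffun particle k -> int}.

(* The entry x^i_j; the value 0 is returned if there is no particle (i, j). *)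
Definition pos (k : nat) (x : pattern k) (i j : nat) : int :=
  oapp x 0 [pick p | (prow p == i) && (pcol p == j)].

Definition prow_vec (k : nat) (x : pattern k) (i : nat) : 'rV[int]_(i.+1)./2 :=
  \row_j pos x i j.+1.

Definition absv (n : nat) (x : 'rV[int]_n) : 'rV[int]_n :=
  map_mx (fun a => `|a|) x.

Definition decreasing (n : nat) (x : 'rV[int]_n) : Prop :=
  forall i j : 'I_n, (i <= j)%N -> x 0 j <= x 0 i.

(* The relation x \preceq y, in both cases n = m and n = m + 1. *)
Definition interlaced (m n : nat) (x : 'rV[int]_m) (y : 'rV[int]_n) : Prop :=
  forall (i : 'I_m) (j : 'I_n),
    (j = i :> nat -> x 0 i <= y 0 j) /\ (j = i.+1 :> nat -> y 0 j <= x 0 i).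

(* The label of the last particle of an odd row: its entry may be negative in
   a Gelfand-Tsetlin pattern, and it is reflected at 0 in the dynamics. *)
Definition wall (i j : nat) : bool := odd i && (j == (i.+1)./2).

Definition GT (k : nat) : set (pattern k) :=
  [set x : pattern k |
           [/\ forall p, ~~ wall (prow p) (pcol p) -> 0 <= x p,
               forall i, (1 <= i <= k)%N -> decreasing (absv (prow_vec x i)) &
               forall i, (2 <= i <= k)%N ->
                 interlaced (absv (prow_vec x i.-1)) (absv (prow_vec x i))]].

(* s_k(l). For every l the set below is finite (the entries of a pattern are
   bounded by those of its last row), so fset_set does not take its default. *)
Definition GT_count (k : nat) (l : 'rV[int]_(k.+1)./2) : nat :=
  #|` fset_set [set x : pattern k | GT x /\ prow_vec x k = l]|%fset.

(* The set W^+_{k+1}. *)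
Definition weyl (k : nat) : set 'rV[int]_(k.+1)./2 :=
  [set l : 'rV_(k.+1)./2 | (forall j, 0 <= l 0 j) /\ decreasing l].

(* x_j for 1 <= j <= n. *)
Definition entry (n : nat) (x : 'rV[int]_n) (j : nat) : int :=
  oapp (fun i : 'I_n => x 0 i) 0 (insub j.-1).

Definition adjacent (n : nat) (l b : 'rV[int]_n) : bool :=
  [exists j : 'I_n, (b == l + delta_mx 0 j) || (b == l - delta_mx 0 j)].

Definition rate (R : realType) (k : nat) (l b : 'rV[int]_(k.+1)./2) : R :=
  if adjacent l b then
    (if [&& odd k, entry l (k.+1)./2 == 0 & entry b (k.+1)./2 == 1]
     then 2 else 1) * ((GT_count b)%:R / (GT_count l)%:R) * \1_(@weyl k) b
  else 0.

Definition gen (R : realType) (k : nat) (l b : 'rV[int]_(k.+1)./2) : R :=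
  if b == l then - \sum_(c \in [set~ l]) rate R l c else rate R l b.

Definition moved (k : nat) (y : pattern k) (S : nat -> nat -> bool) (e : int) :
    pattern k :=
  [ffun p => if S (prow p) (pcol p) then y p + e else y p].

(* A right jump of (i, j) is blocked by (i-1, j-1); otherwise it pushes the
   particles (i+1, j), (i+2, j), and so on that are at the same position. *)
Definition try_right (k : nat) (y : pattern k) (i j : nat) : pattern k :=
  if [&& (2 <= i)%N, (2 <= j)%N & pos y i j == pos y i.-1 j.-1] then y
  else
    let l := (\max_(m < k.+1 | (i + m <= k)%N && (pos y (i + m) j == pos y i j))
                m)%N in
    moved y (fun i' j' => (i <= i' <= i + l)%N && (j' == j)) 1.

(* At 0 the wall particle is reflected: its left jump becomes a right jump. Any
   other particle is blocked by (i-1, j) and otherwise pushes (i+1, j+1),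
   (i+2, j+2), and so on, as long as they exist and are at the same position.
   The two equality tests suffice: on the state space the wall particle is at
   a nonnegative position, and (i, j) is never to the left of (i-1, j). *)
Definition try_left (k : nat) (y : pattern k) (i j : nat) : pattern k :=
  if wall i j then
    if pos y i j == 0 then try_right y i j
    else moved y (fun i' j' => (i' == i) && (j' == j)) (-1)
  else if pos y i j == pos y i.-1 j then y
  else
    let l := (\max_(m < k.+1 | [&& i + m <= k, j + m <= ((i + m).+1)./2
                                 & pos y (i + m) (j + m) == pos y i j]) m)%N in
    moved y (fun i' j' => (i <= i' <= i + l)%N && (j' == j + (i' - i))%N) (-1).

(* Each particle carries a clock for the right (true) and one for the left. *)
Definition clock (k : nat) := (particle k * bool)%type.

Definition jump (k : nat) (c : clock k) (y : pattern k) : pattern k :=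
  if c.2 then try_right y (prow c.1) (pcol c.1)
  else try_left y (prow c.1) (pcol c.1).

(* [ring c n] is the time at which clock c rings for the (n+1)-st time. *)
Record follows_rules (R : realType) (k : nat) (ring : clock k -> nat -> R)
    (y : R -> pattern k) : Prop := {
  follows_state : forall t : R,
    0 <= t -> GT (y t) /\ forall p : particle k, 0 <= y t p;
  follows_start : y 0 = [ffun=> 0];
  follows_const : forall t u : R, 0 <= t -> t <= u ->
    (forall c n, ~ (t < ring c n <= u)) -> y u = y t;
  (* y(t^-) is the value of y on a left neighbourhood of t *)
  follows_jump : forall c n,
    \forall t \near (ring c n)^'-, y (ring c n) = jump c (y t) }.

Definition mutually_independent (R : realType) (d : measure_display)
    (T : measurableType d) (P : probability T R) (I : choiceType)
    (X : I -> {RV P >-> R}) : Prop :=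
  forall (J : {fset I}) (B : I -> set R), (forall i, measurable (B i)) ->
    P (\bigcap_(i in [set` J]) (X i @^-1` B i)) =
    (\prod_(i <- J) P (X i @^-1` B i))%E.

(* Y is driven by independent clocks whose successive waiting times tau c 0,
   tau c 1, ... are exponential with mean 1. Almost surely no two clocks ring
   simultaneously and finitely many rings occur in bounded time; the pathwise
   description is only required almost surely. *)
Record particle_process (R : realType) (d : measure_display)
    (T : measurableType d) (P : probability T R) (k : nat)
    (tau : clock k -> nat -> {RV P >-> R}) (Y : R -> T -> pattern k) : Prop := {
  waiting_exponential : forall c n (B : set R), measurable B ->
    distribution P (tau c n) B = exponential_prob 1 B;
  waiting_independent :
    mutually_independent (fun cn : clock k * nat => tau cn.1 cn.2);
  process_measurable : forall (t : R) (y : pattern k),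
    0 <= t -> measurable [set w | Y t w = y];
  process_rules : {ae P, forall w,
    follows_rules (fun c n => \sum_(m < n.+1) tau c m w) (Y^~ w)} }.

(* [p t x y] is a standard Markov transition function on the countable set E,
   with Q-matrix A: the derivative of the semigroup at t = 0. *)
Record transition_function (R : realType) (S : choiceType) (E : set S)
    (p : R -> S -> S -> R) : Prop := {
  transition_ge0 : forall (t : R) (x y : S), 0 <= t -> E x -> E y ->
    0 <= p t x y;
  transition_sum1 : forall (t : R) (x : S), 0 <= t -> E x ->
    (\esum_(y in E) (p t x y)%:E = 1)%E;
  transition_0 : forall x y, E x -> E y -> p 0 x y = (x == y)%:R;
  transition_semigroup : forall (t u : R) (x y : S),
    0 <= t -> 0 <= u -> E x -> E y ->
    (\esum_(z in E) (p t x z * p u z y)%:E = (p (t + u)%R x y)%:E)%E }.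

Definition infinitesimal_generator (R : realType) (S : choiceType) (E : set S)
    (p : R -> S -> S -> R) (A : S -> S -> R) : Prop :=
  forall x y, E x -> E y ->
    (p t x y - (x == y)%:R) / t @[t --> 0^'+] --> A x y.

Record markov_with_transitions (R : realType) (d : measure_display)
    (T : measurableType d) (P : probability T R) (S : choiceType) (E : set S)
    (X : R -> T -> S) (p : R -> S -> S -> R) : Prop := {
  markov_measurable : forall (t : R) (x : S),
    0 <= t -> measurable [set w | X t w = x];
  markov_state : {ae P, forall w, forall t : R, 0 <= t -> E (X t w)};
  markov_property : forall (n : nat) (t : nat -> R) (x : nat -> S),
    0 <= t 0 -> (forall i, (i <= n)%N -> t i <= t i.+1) ->
    (forall i, (i <= n.+1)%N -> E (x i)) ->
    P [set w | forall i, (i <= n.+1)%N -> X (t i) w = x i] =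
    (P [set w | forall i, (i <= n)%N -> X (t i) w = x i] *
     (p (t n.+1 - t n)%R (x n) (x n.+1))%:E)%E }.

Definition markov_process (R : realType) (d : measure_display)
    (T : measurableType d) (P : probability T R) (S : choiceType) (E : set S)
    (X : R -> T -> S) (A : S -> S -> R) : Prop :=
  exists p : R -> S -> S -> R,
    [/\ transition_function E p, infinitesimal_generator E p A &
        markov_with_transitions P E X p].

(* Main.v *)
Require Import Defs.
From HB Require Import structures.
From mathcomp Require Import all_boot all_order all_algebra finmap.
From mathcomp Require Import all_classical all_reals all_analysis.
From mathcomp Require Import measurable_realfun zify ring lra.

(** Why the theorem holds. Let N be the number of clocks. A nonnegative pattern
    [y] gets the weight [mass y], the number of Gelfand-Tsetlin patterns with the
    same last row and the same absolute values; the weights of the patterns with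
    last row l add up to s_k(l) ([GT_countE]). The main fact is [esum_jumps]: for
    a function f of the last row, the sum over y of mass(y) f(row of y), taken
    once for each clock whose ring leads from y to y', is mass(y') times an
    expression that depends on the last row of y' only, namely a combination of
    the values of f at this row and at its neighbors. It is proved by induction
    on the number of rows. When a row is added on top, it may be pushed by the
    row below, be blocked, or move on its own, and these cases compensate each
    other ([arrivals_hold], [arrivals_from_right], [arrivals_from_left]). For
    instance, a particle moved on its own if its old position interlaces with
    the new row below, and was pushed by this row otherwise; both events have
    the same weight. At the wall, the doubled rate of leaving 0 matches the two
    signs of a nonzero entry.

    Let Lambda(l, .) be the weight divided by s_k(l), a probability on the
    patterns with last row l. The identity says that a jump intertwines Lambda
    with a matrix [kernel] on the rows ([esum_kernel]), whose off-diagonal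
    entries are the rates of the statement. Summed over all y', it shows that
    the rows of this matrix add up to N ([sum_rate]). So the generator is
    [kernel] - N, and its semigroup p_t is the exponential series [ptrans], all
    of whose terms are nonnegative.

    On the probabilistic side, lower bounds are enough. An event decided by the
    rings before time u leaves the waiting times in progress without memory;
    therefore during a further time h no clock rings with probability at least
    exp(- N h), and exactly one given clock rings with probability at least
    (1 - exp(- h)) exp(- N h) ([adapted_stay], [adapted_ring], [feasible_step]).
    If the law of the pattern on a history H of the last row is at least
    P(H) Lambda(l, .), then m steps of length t / m, and m going to infinity,
    bound it from below by P(H) p_t(l, l') Lambda(l', .) at time t later
    ([feasible_interval]). The bounds for the various l' add up to P(H), so they
    are equalities ([located_step]). This is the Markov property with
    transition function p_t, and it provides the hypothesis for the next time. *)

Set Implicit Arguments.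
Unset Strict Implicit.
Unset Printing Implicit Defensive.

Import Order.TTheory GRing.Theory Num.Theory.
Import numFieldNormedType.Exports.

Local Open Scope classical_set_scope.
Local Open Scope ring_scope.

(** * Sums of nonnegative families *)

Section EsumExtra.
Context {R : realType}.
Local Open Scope ereal_scope.

Lemma esumZl (S : choiceType) (I : set S) (a : S -> \bar R) (r : R) :
  (0 <= r)%R -> (forall i, I i -> 0 <= a i) ->
  \esum_(i in I) (r%:E * a i) = r%:E * \esum_(i in I) a i.
Proof.
have le_scaled (s : R) (b : S -> \bar R) : (0 <= s)%R ->
    (forall i, I i -> 0 <= b i) ->
    \esum_(i in I) (s%:E * b i) <= s%:E * \esum_(i in I) b i.
  move=> s0 b0; apply: ge_ereal_sup => _ [X [finX XI] <-].
  rewrite fsbig_finite//= big_seq -ge0_sume_distrr -?big_seq; last first.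
    by move=> i; rewrite in_fset_set// inE => /XI/b0.
  rewrite lee_wpmul2l// -fsbig_finite//; apply: ereal_sup_ubound.
  by exists X.
move=> r0 a0; apply/eqP; rewrite eq_le le_scaled//=.
have [->|rn0] := eqVneq r 0%R.
  by rewrite mul0e; apply: esum_ge0 => i _; rewrite mul0e.
have rp : (0 < r)%R by rewrite lt_neqAle eq_sym rn0.
have -> : \esum_(i in I) a i = \esum_(i in I) ((r^-1)%:E * (r%:E * a i)).
  by apply: eq_esum => i Ii; rewrite muleA -EFinM mulVf// mul1e.
rewrite (le_trans (lee_wpmul2l _ (le_scaled _ _ _ _)))// ?lee_fin ?invr_ge0//.
- by move=> i /a0 ai; rewrite mule_ge0.
- by rewrite muleA -EFinM mulfV// mul1e.
Qed.

Lemma esumZr (S : choiceType) (I : set S) (a : S -> \bar R) (r : R) :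
  (0 <= r)%R -> (forall i, I i -> 0 <= a i) ->
  \esum_(i in I) (a i * r%:E) = (\esum_(i in I) a i) * r%:E.
Proof.
by move=> r0 a0; rewrite muleC -esumZl//; apply: eq_esum => i _; rewrite muleC.
Qed.

Lemma esum_exchange (S1 S2 : choiceType) (I : set S1) (J : set S2)
    (a : S1 -> S2 -> \bar R) : (forall i j, I i -> J j -> 0 <= a i j) ->
  \esum_(i in I) \esum_(j in J) a i j = \esum_(j in J) \esum_(i in I) a i j.
Proof.
move=> a0; rewrite (@esum_esum _ _ _ I (fun=> J))//.
rewrite (@esum_esum _ _ _ J (fun=> I)); last by move=> j i Jj Ii; exact: a0.
apply: (reindex_esum _ _ (fun x : S2 * S1 => (x.2, x.1))); split=> /=.
- by move=> [j i] [].
- by move=> [i1 i2] [j1 j2] /= _ _ [] -> ->.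
- by move=> [i j] [Pi Qj] /=; exists (j, i).
Qed.

Lemma esum_finite_support (S : choiceType) (O : finType) (f : O -> S)
    (I : set S) (a : S -> \bar R) : injective f -> (forall s, 0 <= a s) ->
  (forall s, I s -> (forall o, s <> f o) -> a s = 0) ->
  \esum_(s in I) a s = \sum_(o : O) (if f o \in I then a (f o) else 0).
Proof.
move=> finj ag0 a0.
have -> : \esum_(s in I) a s = \esum_(s in range f) (if s \in I then a s else 0).
  rewrite esum_mkcond [RHS]esum_mkcond; apply: eq_esum => s _.
  case: ifPn => [/set_mem Is|_]; last by case: ifP.
  case: ifPn => // /negP nr.
  by apply: a0 => // o so; apply: nr; apply/mem_set; exists o.
rewrite esum_image; last by move=> x y _ _; exact: finj.
rewrite esum_fset; [|exact: finite_finset|by move=> o _; case: ifP].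
rewrite (fsbig_fwiden (index_enum O))//=.
- by move=> x _ /=; rewrite mem_index_enum.
- exact: index_enum_uniq.
- by move=> x [_]; case.
Qed.

Lemma esum_pick (S : choiceType) (I : set S) (y : S) (a : S -> \bar R) :
  (forall s, 0 <= a s) -> (forall s, I s -> s != y -> a s = 0) -> I y ->
  \esum_(z in I) a z = a y.
Proof.
move=> ag0 a0 Iy.
rewrite (@esum_finite_support _ unit (fun=> y))//.
- by rewrite (big_pred1 tt) ?mem_set//; case.
- by move=> [] [].
- by move=> s Is /(_ tt)/eqP/(a0 _ Is).
Qed.

Lemma esum_term_le (S : choiceType) (I : set S) (y : S) (a : S -> \bar R) :
  (forall s, I s -> 0 <= a s) -> I y -> a y <= \esum_(z in I) a z.
Proof.
move=> a0 Iy; apply: esum_ge; exists [set y]; last by rewrite fsbig_set1.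
by split=> // z ->.
Qed.

End EsumExtra.

(** * The semigroup of a kernel with constant row sums *)

(** If all the row sums of [K] are [N], the generator [K - N] has the semigroup
    [exp (t (K - N)) = exp (- N t) * exp (t K)]: its entries are series with
    nonnegative terms, so that all rearrangements are free. *)
Section Uniformized.
Context {R : realType} {S : choiceType}.
Variables (E : set S) (K : S -> S -> R) (N : R).
Hypothesis K_ge0 : forall x y, 0 <= K x y.
Hypothesis N_ge0 : 0 <= N.
Hypothesis K_sum : forall x, E x -> (\esum_(y in E) (K x y)%:E = N%:E)%E.

Fixpoint kpow (j : nat) (x y : S) : R :=
  if j is i.+1 then fine (\esum_(z in E) (kpow i x z * K z y)%:E)%E
  else (x == y)%:R.

Lemma kpow_ge0 j x y : 0 <= kpow j x y.
Proof.
elim: j y => [|j ih] y /=; first by rewrite ler0n.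
by apply: fine_ge0; apply: esum_ge0 => z _; rewrite lee_fin mulr_ge0.
Qed.
Hint Resolve kpow_ge0 : core.

Lemma K_le x y : E x -> E y -> K x y <= N.
Proof.
move=> Ex Ey; rewrite -lee_fin -(K_sum Ex).
by apply: (esum_term_le (a := fun y => (K x y)%:E)) => // s _; rewrite lee_fin.
Qed.

(** Both facts are proved together: the finite total makes every sum that
    defines the next power finite, so that [fine] does not lose anything. *)
Lemma kpow_sum j x : E x -> (\esum_(y in E) (kpow j x y)%:E = (N ^+ j)%:E)%E
  /\ forall y, E y ->
     ((kpow j.+1 x y)%:E = \esum_(z in E) (kpow j x z * K z y)%:E)%E.
Proof.
move=> Ex.
have step i : (\esum_(y in E) (kpow i x y)%:E = (N ^+ i)%:E)%E -> forall y, E y ->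
     ((kpow i.+1 x y)%:E = \esum_(z in E) (kpow i x z * K z y)%:E)%E.
  move=> sumi y Ey /=; rewrite fineK//.
  have pos : (0 <= \esum_(z in E) (kpow i x z * K z y)%:E)%E.
    by apply: esum_ge0 => z _; rewrite lee_fin mulr_ge0.
  rewrite ge0_fin_numE//.
  apply: (@le_lt_trans _ _ (\esum_(z in E) ((kpow i x z)%:E * N%:E))%E).
    apply: le_esum => z Ez; rewrite -EFinM lee_fin ler_wpM2l//.
    exact: K_le.
  rewrite esumZr//; last by move=> z _ /=; rewrite lee_fin.
  by rewrite sumi -EFinM ltry.
suff sums : (\esum_(y in E) (kpow j x y)%:E = (N ^+ j)%:E)%E by split; [|exact: step].
elim: j => [|j ih].
  rewrite expr0 (esum_pick (y := x))//=; first by rewrite eqxx.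
  by move=> s _; rewrite eq_sym => /negbTE ->.
rewrite (eq_esum (step _ ih)) esum_exchange; last first.
  by move=> y z _ _; rewrite lee_fin mulr_ge0.
under eq_esum => z Ez.
  under eq_esum do rewrite EFinM.
  rewrite esumZl//; last by move=> y _ /=; rewrite lee_fin.
  rewrite K_sum//; over.
rewrite esumZr//; last by move=> z _ /=; rewrite lee_fin.
by rewrite ih -EFinM exprSr.
Qed.

Lemma kpowS j x y : E x -> E y ->
  ((kpow j.+1 x y)%:E = \esum_(z in E) (kpow j x z * K z y)%:E)%E.
Proof. by move=> Ex; exact: (kpow_sum j Ex).2. Qed.

Lemma kpow_le j x y : E x -> E y -> kpow j x y <= N ^+ j.
Proof.
move=> Ex Ey; rewrite -lee_fin -(kpow_sum j Ex).1.
by apply: (esum_term_le (a := fun y => (kpow j x y)%:E)) => // s _; rewrite lee_fin.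
Qed.

Lemma kpow1 x y : E x -> E y -> kpow 1 x y = K x y.
Proof.
move=> Ex Ey; apply: EFin_inj; rewrite kpowS// (esum_pick (y := x))//=.
- by rewrite eqxx mul1r.
- by move=> s; rewrite lee_fin mulr_ge0.
- by move=> s _; rewrite eq_sym => /negbTE ->; rewrite mul0r.
Qed.

Lemma kpowD i j x y : E x -> E y ->
  (\esum_(z in E) (kpow i x z * kpow j z y)%:E = (kpow (i + j) x y)%:E)%E.
Proof.
move=> Ex; elim: j y => [|j ih] y Ey.
  rewrite addn0 (esum_pick (y := y))//=.
  - by rewrite eqxx mulr1.
  - by move=> s; rewrite lee_fin mulr_ge0.
  - by move=> s _ /negbTE ->; rewrite mulr0.
rewrite addnS kpowS//.
under eq_esum => z Ez.
  rewrite EFinM kpowS// -esumZl//; last by move=> u _ /=; rewrite lee_fin mulr_ge0.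
  over.
rewrite esum_exchange; last first.
  by move=> z u _ _; rewrite -EFinM lee_fin !mulr_ge0.
apply: eq_esum => u Eu; rewrite EFinM -ih// -esumZr//; last first.
  by move=> z _ /=; rewrite lee_fin mulr_ge0.
by apply: eq_esum => z Ez; rewrite -!EFinM mulrA.
Qed.

(** The Poisson distribution of parameter [N * t], divided by [N ^+ j]. *)
Definition poisson_wt (t : R) (j : nat) : R := expR (- (N * t)) * (t ^+ j / j`!%:R).

Lemma poisson_wt_ge0 t j : 0 <= t -> 0 <= poisson_wt t j.
Proof. by move=> t0; rewrite !mulr_ge0 ?expR_ge0 ?exprn_ge0 ?invr_ge0. Qed.

Lemma poisson_wt_sum t : 0 <= t ->
  (\esum_(j in [set: nat]) (poisson_wt t j * N ^+ j)%:E = 1)%E.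
Proof.
move=> t0; have Nt0 : 0 <= N * t by rewrite mulr_ge0.
transitivity ((expR (- (N * t)))%:E * \esum_(j in [set: nat]) (exp_coeff (N * t) j)%:E)%E.
  rewrite -esumZl ?expR_ge0//; last by move=> j _ /=; rewrite lee_fin exp_coeff_ge0.
  apply: eq_esum => j _; rewrite -EFinM; congr (_%:E).
  by rewrite /poisson_wt /exp_coeff/= exprMn; ring.
rewrite -nneseries_esumT; last by move=> j; rewrite lee_fin exp_coeff_ge0.
have -> : (\sum_(j <oo) (exp_coeff (N * t) j)%:E = (expR (N * t))%:E)%E.
  rewrite /expR -EFin_lim; last exact: is_cvg_series_exp_coeff.
  by congr (limn _); apply/funext => n; rewrite /= sumEFin.
by rewrite -EFinM -expRD addNr expR0.
Qed.

Lemma poisson_wtD t u n : (\sum_(i < n.+1) poisson_wt t i * poisson_wt u (n - i)) =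
  poisson_wt (t + u) n.
Proof.
rewrite /poisson_wt mulrDr opprD expRD [t + u]addrC exprDn mulr_suml mulr_sumr.
apply: eq_bigr => i _; rewrite -[(_ * _) *+ _]mulr_natr.
have ->: ('C(n, i)%:R = n`!%:R / (i`!%:R * (n - i)`!%:R) :> R).
  have in' : (i <= n)%N by rewrite -ltnS.
  rewrite -(bin_fact in') natrM natrM mulfK//.
have f0 m : (m`!%:R != 0 :> R) by rewrite pnatr_eq0 -lt0n fact_gt0.
field; by rewrite !f0.
Qed.

Definition ptrans (t : R) (x y : S) : R :=
  fine (\esum_(j in [set: nat]) (poisson_wt t j * kpow j x y)%:E)%E.

Lemma ptrans_ge0 t x y : 0 <= t -> 0 <= ptrans t x y.
Proof.
move=> t0; apply: fine_ge0; apply: esum_ge0 => j _.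
by rewrite lee_fin mulr_ge0 ?poisson_wt_ge0.
Qed.

Lemma ptransE t x y : 0 <= t -> E x -> E y ->
  ((ptrans t x y)%:E = \esum_(j in [set: nat]) (poisson_wt t j * kpow j x y)%:E)%E.
Proof.
move=> t0 Ex Ey; rewrite fineK// ge0_fin_numE; last first.
  by apply: esum_ge0 => j _; rewrite lee_fin mulr_ge0 ?poisson_wt_ge0.
apply: (@le_lt_trans _ _ 1%E); last exact: ltry.
rewrite -(poisson_wt_sum t0); apply: le_esum => j _.
by rewrite lee_fin ler_wpM2l ?poisson_wt_ge0 ?kpow_le.
Qed.

Lemma ptrans_sum1 t x : 0 <= t -> E x ->
  (\esum_(y in E) (ptrans t x y)%:E = 1)%E.
Proof.
move=> t0 Ex; rewrite (eq_esum (fun y Ey => ptransE t0 Ex Ey)) esum_exchange; last first.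
  by move=> y j _ _; rewrite lee_fin mulr_ge0 ?poisson_wt_ge0.
rewrite -(poisson_wt_sum t0); apply: eq_esum => j _.
under eq_esum do rewrite EFinM.
rewrite esumZl ?poisson_wt_ge0//; last by move=> y _ /=; rewrite lee_fin.
by rewrite (kpow_sum j Ex).1 EFinM.
Qed.

Lemma ptrans0 x y : E x -> E y -> ptrans 0 x y = (x == y)%:R.
Proof.
move=> Ex Ey; apply: EFin_inj; rewrite ptransE// (esum_pick (y := 0%N))//.
- by rewrite /poisson_wt mulr0 oppr0 expR0 fact0 expr0 invr1 !mul1r.
- by move=> j; rewrite lee_fin mulr_ge0// poisson_wt_ge0.
- by move=> j _ j0; rewrite /poisson_wt expr0n (negbTE j0) !(mul0r, mulr0).
Qed.

(** The Poisson weights convolve, as the exponential series does. *)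
Lemma ptransD t u x y : 0 <= t -> 0 <= u -> E x -> E y ->
  (\esum_(z in E) (ptrans t x z * ptrans u z y)%:E = (ptrans (t + u) x y)%:E)%E.
Proof.
move=> t0 u0 Ex Ey; rewrite ptransE ?addr_ge0//.
have wk s j z z' : 0 <= s -> 0 <= poisson_wt s j * kpow j z z'.
  by move=> s0; rewrite mulr_ge0// poisson_wt_ge0.
pose a (z : S) (i j : nat) : R :=
  poisson_wt t i * poisson_wt u j * (kpow i x z * kpow j z y).
have ww0 i j : 0 <= poisson_wt t i * poisson_wt u j.
  by apply: mulr_ge0; exact: poisson_wt_ge0.
have a0 z i j : 0 <= a z i j by apply: mulr_ge0; [|apply: mulr_ge0].
transitivity (\esum_(z in E) \esum_(i in [set: nat]) \esum_(j in [set: nat]) (a z i j)%:E)%E.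
  apply: eq_esum => z Ez; rewrite EFinM ptransE// -esumZr ?ptrans_ge0//; last first.
    by move=> i _ /=; rewrite lee_fin wk.
  apply: eq_esum => i _; rewrite ptransE// -esumZl ?wk//; last first.
    by move=> j _ /=; rewrite lee_fin wk.
  by apply: eq_esum => j _; rewrite -EFinM /a; congr (_%:E); ring.
rewrite esum_exchange; last by move=> z i _ _; apply: esum_ge0 => j _; rewrite lee_fin.
under eq_esum => i _.
  rewrite esum_exchange; last by move=> z j _ _; rewrite lee_fin.
  over.
transitivity (\esum_(i in [set: nat]) \esum_(j in [set: nat])
    (poisson_wt t i * poisson_wt u j * kpow (i + j) x y)%:E)%E.
  apply: eq_esum => i _; apply: eq_esum => j _.
  rewrite [in RHS]EFinM -kpowD// -esumZl ?ww0//.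
  by move=> z _ /=; rewrite lee_fin mulr_ge0.
rewrite esum_esum; last by move=> i j _ _; rewrite lee_fin mulr_ge0.
rewrite (reindex_esum ([set: nat] `*`` (fun n => [set i | (i <= n)%N])) _
   (fun p : nat * nat => (p.2, p.1 - p.2)%N)); last first.
  split=> /=.
  - by move=> [n i].
  - move=> [n i] [n' i']; rewrite !inE/= => -[_ le] [_ le'] [ii' h].
    by congr (_, _); move: le le' h => /=; lia.
  - by move=> [i j] _; exists ((i + j)%N, i) => /=; [split=> //=; lia|congr (_, _); lia].
rewrite -(@esum_esum _ _ _ [set: nat] (fun n => [set i | (i <= n)%N])
   (fun n i => (poisson_wt t i * poisson_wt u (n - i) * kpow (i + (n - i)) x y)%:E)); last first.
  by move=> n i _ _; rewrite lee_fin mulr_ge0.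
apply: eq_esum => n _; rewrite -poisson_wtD.
rewrite (@esum_finite_support _ _ 'I_n.+1 (@nat_of_ord n.+1)); first last.
- by move=> i /= lin ne; exfalso; apply: (ne (Ordinal (n := n.+1) (m := i) _)) => //.
- by move=> i; rewrite lee_fin mulr_ge0.
- exact: ord_inj.
rewrite mulr_suml -sumEFin; apply: eq_bigr => i _.
have lin : (i <= n)%N by rewrite -ltnS.
by rewrite mem_set//= subnKC.
Qed.

Lemma ptrans_transition : transition_function E ptrans.
Proof.
split.
- by move=> t x y t0 _ _; exact: ptrans_ge0.
- exact: ptrans_sum1.
- exact: ptrans0.
- exact: ptransD.
Qed.

(** Two terms of the series give the derivative at 0; the remaining ones have
    total mass at most [1 - (1 + N t) exp (- N t)], which is of order [t ^+ 2]. *)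
Lemma ptrans_near0 t x y : 0 <= t -> E x -> E y ->
  `|ptrans t x y - ((x == y)%:R + t * (K x y - N * (x == y)%:R))| <=
    3 * N ^+ 2 * t ^+ 2.
Proof.
move=> t0 Ex Ey.
have w0 := poisson_wt_ge0 _ t0.
pose e := expR (- (N * t)).
have Nt0 : 0 <= N * t by rewrite mulr_ge0.
have e_ge : 1 - N * t <= e by rewrite /e; exact: expR_ge1Dx.
have e_le : e <= 1 by rewrite /e expR_le1 oppr_le0.
have e_le2 : e - 1 + N * t <= (N * t) ^+ 2.
  have h : e * (1 + N * t) <= 1.
    rewrite /e expRN mulrC ler_pdivrMr ?expR_gt0// mul1r; exact: expR_ge1Dx.
  have e0 : 0 <= e by rewrite expR_ge0.
  by nra.
have split2 (f : nat -> R) : (forall j, 0 <= f j) ->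
    (\esum_(j in [set: nat]) (f j)%:E =
     (f 0%N + f 1%N)%:E + \esum_(j in [set: nat]) (f j.+2)%:E)%E.
  move=> f0; rewrite -!nneseries_esumT//; try by move=> j; rewrite lee_fin.
  rewrite (nneseries_split _ 2)//; last by move=> j _ /=; rewrite lee_fin.
  rewrite add0n -[in X in (_ + X)%E](nneseries_addn 2)//.
  congr (_ + _)%E; first by rewrite big_ltn// big_ltn// big_geq// adde0.
  by apply: eq_eseriesr => j _; rewrite addn2.
have sumP := ptransE t0 Ex Ey.
have sum1 := poisson_wt_sum t0.
rewrite split2 in sumP; last by move=> j; rewrite mulr_ge0 ?w0.
rewrite kpow1// in sumP.
rewrite split2 in sum1; last by move=> j; rewrite mulr_ge0 ?w0 ?exprn_ge0.
set r := (X in _ = (_ + X)%E) in sumP.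
set r1 := (X in (_ + X)%E = _) in sum1.
have r_ge : (0 <= r)%E by apply: esum_ge0 => j _; rewrite lee_fin mulr_ge0 ?w0.
have r_le : (r <= r1)%E.
  by apply: le_esum => j _; rewrite lee_fin ler_wpM2l ?w0 ?kpow_le.
have r1f : r1 \is a fin_num.
  rewrite ge0_fin_numE; last first.
    by apply: esum_ge0 => j _; rewrite lee_fin mulr_ge0 ?w0 ?exprn_ge0.
  rewrite ltNge leye_eq; apply/negP => /eqP r1y.
  by move: sum1; rewrite r1y addey.
have rf : r \is a fin_num.
  by rewrite ge0_fin_numE// (le_lt_trans r_le)// -ge0_fin_numE// (le_trans r_ge r_le).
rewrite -(fineK rf) -EFinD in sumP; case: sumP => sumP.
rewrite -(fineK r1f) -EFinD in sum1; case: sum1 => sum1.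
have {}r_le : fine r <= fine r1 by rewrite fine_le.
have {}r_ge : 0 <= fine r by rewrite fine_ge0.
rewrite sumP /= /poisson_wt !fact0 -/e.
rewrite /poisson_wt !fact0 -/e in sum1.
have K0 := K_ge0 x y; have KN := K_le Ex Ey.
rewrite !expr0 !expr1 !divr1 in sum1 *.
have rle2 : fine r <= (N * t) ^+ 2 by nra.
set d : R := (x == y)%:R; have [d0 d1] : 0 <= d /\ d <= 1 by rewrite /d; case: eqP.
have t2 : t * (K x y) * (1 - e) <= N ^+ 2 * t ^+ 2.
  have -> : N ^+ 2 * t ^+ 2 = t * N * (N * t) by ring.
  apply: ler_pM; rewrite ?mulr_ge0 ?subr_ge0//; first exact: ler_wpM2l.
  by lra.
have t20 : 0 <= t * (K x y) * (1 - e) by rewrite !mulr_ge0 ?subr_ge0.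
have t1 : `|d * (e - 1 + N * t)| <= N ^+ 2 * t ^+ 2.
  rewrite ger0_norm ?mulr_ge0//; last by lra.
  rewrite -exprMn; apply: le_trans (e_le2); apply: ler_piMl => //; lra.
have -> : e * 1 * d + e * t * K x y + fine r - (d + t * (K x y - N * d)) =
   d * (e - 1 + N * t) - t * K x y * (1 - e) + fine r by ring.
rewrite (le_trans (ler_normD _ _))// (le_trans (lerD (ler_normB _ _) (lexx _)))//.
rewrite (ger0_norm t20) (ger0_norm r_ge).
rewrite exprMn in rle2; lra.
Qed.

Lemma ptrans_generator :
  infinitesimal_generator E ptrans (fun x y => K x y - N * (x == y)%:R).
Proof.
move=> x y Ex Ey; apply/cvgrPdist_le => eps eps0.
set C := 3 * N ^+ 2.
have C0 : 0 <= C by rewrite mulr_ge0// exprn_ge0.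
near=> t.
have t0 : 0 < t by near: t; exact: nbhs_right_gt.
have tC : t < eps / (C + 1) by near: t; apply: nbhs_right_lt; rewrite divr_gt0 ?ltr_wpDl.
have -> : K x y - N * (x == y)%:R - (ptrans t x y - (x == y)%:R) / t =
  - (ptrans t x y - ((x == y)%:R + t * (K x y - N * (x == y)%:R))) / t.
  by field; rewrite gt_eqF.
rewrite normrM normrN normfV (gtr0_norm t0) ler_pdivrMr//.
apply: le_trans (ptrans_near0 (ltW t0) Ex Ey) _.
rewrite -/C expr2 mulrA ler_wpM2r ?(ltW t0)//.
move: tC; rewrite ltr_pdivlMr ?ltr_wpDl// => tC.
by nra.
Unshelve. all: by end_near. Qed.

End Uniformized.

(** * Exponential waiting times: independence and lack of memory *)

Section UnionScale.
Context {R : realType} d (T : measurableType d) (P : probability T R).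
Local Open Scope ereal_scope.

Lemma lt_fun_measurable (f g : T -> R) : measurable_fun setT f ->
  measurable_fun setT g -> measurable [set w | f w < g w]%R.
Proof.
move=> mf mg; rewrite -[X in measurable X]setTI.
by have := measurable_fun_ltr mf mg measurableT (Y := [set true]); apply.
Qed.

Lemma le_fun_measurable (f g : T -> R) : measurable_fun setT f ->
  measurable_fun setT g -> measurable [set w | f w <= g w]%R.
Proof.
move=> mf mg; rewrite -[X in measurable X]setTI.
by have := measurable_fun_ler mf mg measurableT (Y := [set true]); apply.
Qed.

Lemma between_measurable (f g : T -> R) (a b : R) : measurable_fun setT f ->
  measurable_fun setT g -> measurable [set w | f w + a < g w <= f w + b]%R.
Proof.
move=> mf mg; have mfc c : measurable_fun setT (f \+ cst c)%R.
  by apply: measurable_funD => //; exact: measurable_cst.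
rewrite (_ : [set w | _] = [set w | f w + a < g w]%R `&` [set w | g w <= f w + b]%R).
  apply: measurableI; first exact: (lt_fun_measurable (mfc a)).
  exact: (le_fun_measurable mg (mfc b)).
by apply/seteqP; split=> w /= => [/andP[]|[-> ->]].
Qed.

Lemma preimage_measurable (X : {RV P >-> R}) B : measurable B -> measurable (X @^-1` B).
Proof. by move=> mB; rewrite -[X in measurable X]setTI; exact: measurable_funP. Qed.

Lemma bigcup_pickle (I : countType) (F : I -> set T) :
  \bigcup_i F i = \bigcup_m oapp F set0 (choice.pickle_inv m).
Proof.
apply/seteqP; split=> w [i _ Fi].
  by exists (choice.pickle i) => //; rewrite choice.pickleK_inv.
by move: Fi; case: choice.pickle_inv => //= j Fj; exists j.
Qed.

Lemma bigcup_measurable_countType (I : countType) (F : I -> set T) :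
  (forall i, measurable (F i)) -> measurable (\bigcup_i F i).
Proof.
move=> mF; rewrite bigcup_pickle; apply: bigcupT_measurable => m.
by case: choice.pickle_inv => [i|]; [exact: mF|exact: measurable0].
Qed.

Lemma measure_bigcup_scale (I : countType) (F G : I -> set T) (r : R) :
  (0 <= r)%R -> (forall i, measurable (F i)) -> (forall i, measurable (G i)) ->
  trivIset setT G -> (forall i, r%:E * P (F i) <= P (G i)) ->
  r%:E * P (\bigcup_i F i) <= P (\bigcup_i G i).
Proof.
move=> r0 mF mG tG FG; rewrite (bigcup_pickle F) (bigcup_pickle G).
set F' := fun m => oapp F set0 (choice.pickle_inv m).
set G' := fun m => oapp G set0 (choice.pickle_inv m).
have mF' m : measurable (F' m).
  by rewrite /F'; case: choice.pickle_inv => [i|]; [exact: mF|exact: measurable0].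
have mG' m : measurable (G' m).
  by rewrite /G'; case: choice.pickle_inv => [i|]; [exact: mG|exact: measurable0].
have mUG : measurable (\bigcup_m G' m) by exact: bigcupT_measurable.
have tG' : trivIset setT G'.
  move=> m n _ _; rewrite /G'.
  have := @choice.pickle_invK I m; have := @choice.pickle_invK I n.
  case: (choice.pickle_inv m) => [i|] /=; last by rewrite set0I => _ _ [].
  case: (choice.pickle_inv n) => [j|] /=; last by rewrite setI0 => _ _ [].
  by move=> <- <- /(tG i j Logic.I Logic.I) ->.
rewrite [leRHS]measure_semi_bigcup//.
apply: (@le_trans _ _ (\sum_(m <oo) r%:E * P (F' m))).
  rewrite nneseriesZl//.
  rewrite lee_wpmul2l//.
  by apply: measure_sigma_subadditive => //; exact: bigcupT_measurable.
apply: lee_nneseries => m _; first by rewrite mule_ge0.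
rewrite /F' /G'; case: choice.pickle_inv => [i|] /=; first exact: FG.
by rewrite measure0 mule0.
Qed.

End UnionScale.

Section Independent.
Context {R : realType} d (T : measurableType d) (P : probability T R).
Context (I : choiceType) (X : I -> {RV P >-> R}).
Hypothesis X_indep : mutually_independent X.
Local Open Scope ereal_scope.

Definition info_gen (J : set I) : set (set T) :=
  [set A | exists2 i, J i & exists2 B, measurable B & A = X i @^-1` B].

Definition info (J : set I) : set (set T) := <<s info_gen J >>.

Definition info_fun (J : set I) (f : T -> R) : Prop :=
  measurable_fun (setT : set (g_sigma_algebraType (info_gen J))) f.

Lemma info_measurable J A : info J A -> measurable A.
Proof.
apply: smallest_sub; first exact: sigma_algebra_measurable.
by move=> _ [i _ [B mB ->]]; exact: preimage_measurable.
Qed.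

Lemma info_mono J J' : J `<=` J' -> info J `<=` info J'.
Proof.
move=> JJ'; apply: sub_sigma_algebra2 => _ [i Ji [B mB ->]].
by exists i; [exact: JJ'|exists B].
Qed.

Lemma info_set J (A : set T) :
  info J A = measurable (A : set (g_sigma_algebraType (info_gen J))).
Proof. by []. Qed.

Lemma info_var J i : J i -> info_fun J (X i).
Proof.
move=> Ji _ B mB; rewrite setTI -info_set.
by apply: sub_sigma_algebra; exists i => //; exists B.
Qed.

Lemma info_sum J (s : seq I) : (forall i, i \in s -> J i) ->
  info_fun J (fun w => \sum_(i <- s) X i w)%R.
Proof.
elim: s => [|i s ih] sJ.
  rewrite (_ : (fun w => _) = cst 0%R); first exact: measurable_cst.
  by apply/funext => w; rewrite big_nil.
rewrite (_ : (fun w => _) = (X i \+ (fun w => \sum_(j <- s) X j w))%R); last first.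
  by apply/funext => w; rewrite big_cons.
apply: measurable_funD; first by apply: info_var; apply: sJ; rewrite mem_head.
by apply: ih => j js; apply: sJ; rewrite in_cons js orbT.
Qed.

Lemma info_lt J f g : info_fun J f -> info_fun J g ->
  info J [set w | f w < g w]%R.
Proof. by move=> mf mg; rewrite info_set; exact: lt_fun_measurable. Qed.

Lemma info_le J f g : info_fun J f -> info_fun J g ->
  info J [set w | f w <= g w]%R.
Proof. by move=> mf mg; rewrite info_set; exact: le_fun_measurable. Qed.

Lemma info_fun_measurable J f : info_fun J f -> measurable_fun setT f.
Proof.
move=> mf _ B mB; apply: (@info_measurable J); rewrite info_set.
exact: mf.
Qed.

Lemma infoI J A B : info J A -> info J B -> info J (A `&` B).
Proof. by rewrite !info_set; exact: measurableI. Qed.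

Lemma infoT J : info J setT.
Proof. by rewrite info_set; exact: measurableT. Qed.

Lemma info0 J : info J set0.
Proof. by rewrite info_set; exact: measurable0. Qed.

(** Independence is a statement about these events only. *)
Definition cylinder (J : set I) : set (set T) :=
  [set A | exists K : {fset I}, exists2 B : I -> set R,
    (forall i, measurable (B i)) /\ (forall i, i \in K -> J i) &
    A = \bigcap_(i in [set` K]) (X i @^-1` B i)].

Lemma cylinder_setI J : setI_closed (cylinder J).
Proof.
move=> _ _ [K [B [mB KJ] ->]] [K' [B' [mB' KJ'] ->]].
exists (K `|` K')%fset.
exists (fun i => (if i \in K then B i else setT) `&` (if i \in K' then B' i else setT)).
  split=> [i|i]; first by apply: measurableI; case: ifP.
  by rewrite in_fsetU => /orP[/KJ|/KJ'].
apply/seteqP; split=> [w [BK BK'] i /=|w BB]; last split=> i /= iK.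
- rewrite in_fsetU => iU; split; case: ifP => // h; [exact: BK|exact: BK'].
- by have /= := BB i; rewrite in_fsetU iK => /(_ isT)[].
- by have /= := BB i; rewrite in_fsetU iK orbT => /(_ isT)[].
Qed.

Lemma cylinder_measurable J A : cylinder J A -> measurable A.
Proof.
move=> [K [B [mB _] ->]]; apply: fin_bigcap_measurable => // i _.
exact: preimage_measurable.
Qed.

(** Independence of the family extends from cylinders to the generated
    sigma-algebra, because cylinders are stable under intersection. *)
Lemma info_indep J i0 A B : info J A -> ~ J i0 -> measurable B ->
  P (A `&` X i0 @^-1` B) = P A * P (X i0 @^-1` B).
Proof.
move=> JA nJ mB; set D := X i0 @^-1` B.
have mD : measurable D by exact: preimage_measurable.
have PDf : P D \is a fin_num by exact: fin_num_measure.
pose c : {nonneg R} := NngNum (fine_ge0 (measure_ge0 P D)).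
have cyl_T : cylinder J setT.
  exists fset0; exists (fun=> setT) => //.
  by apply/seteqP; split.
have subs : <<s info_gen J >> `<=` <<s cylinder J >>.
  apply: sub_sigma_algebra2 => _ [i Ji [C mC ->]].
  exists [fset i]%fset; exists (fun=> C).
    by split=> // j; rewrite inE => /eqP ->.
  by apply/seteqP; split=> [w h j /=|w /(_ i)/=]; rewrite inE ?eqxx; [move=> /eqP ->|apply].
suff : mrestr P mD A = mscale c P A.
  by rewrite /mrestr /mscale/= fineK// muleC.
apply: (g_sigma_algebra_measure_unique (cylinder J) _ (fun=> setT)) => //.
- exact: cylinder_measurable.
- by apply/seteqP; split=> // w _; exists 0%N.
- exact: cylinder_setI.
- move=> _ [K [C [mC KJ] ->]]; rewrite /= /mrestr /mscale/= fineK// [RHS]muleC.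
  have i0K : i0 \notin K by apply/negP => /KJ.
  have h := X_indep K mC.
  pose C' i := if i == i0 then B else C i.
  have h' := @X_indep (i0 |` K)%fset C'.
  have e (Q : I -> set T) : \bigcap_(i in [set` (i0 |` K)%fset]) Q i =
      Q i0 `&` \bigcap_(i in [set` K]) Q i.
    apply/seteqP; split=> [w QK|w [Q0 QK] i /=]; last first.
      by rewrite in_fset1U => /orP[/eqP ->|/QK].
    by split=> [|i /= iK]; apply: QK; rewrite /= in_fset1U ?eqxx// iK orbT.
  have eC : \bigcap_(i in [set` K]) (X i @^-1` C' i) = \bigcap_(i in [set` K]) (X i @^-1` C i).
    apply: eq_bigcapr => i /= iK; rewrite /C'; case: eqP => // ii0.
    by move: i0K; rewrite -ii0 iK.
  have DE : D = X i0 @^-1` C' i0 by rewrite /D /C' eqxx.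
  have mC' i : measurable (C' i) by rewrite /C'; case: ifP.
  rewrite setIC DE -eC -(e (fun i => X i @^-1` C' i)) (h' mC') eC h.
  rewrite big_fsetU1//= muleC; congr (_ * _).
  apply: eq_big_seq => i iK.
  by rewrite /C'; case: eqP => // ii0; move: i0K; rewrite -ii0 iK.
- by move=> _; rewrite /= /mrestr setTI (le_lt_trans (probability_le1 _ _)) ?ltry.
- exact: subs.
Qed.

Hypothesis X_exp : forall i B, measurable B ->
  distribution P (X i) B = exponential_prob 1 B.

Lemma wait_le i (x : R) : (0 <= x)%R ->
  P (X i @^-1` [set` `]-oo, x]]) = (1 - expR (- x))%:E.
Proof.
move=> x0; transitivity (exponential_prob 1 [set` `[0%R, x]]).
  transitivity (exponential_prob 1 [set` `]-oo, x]]); first by rewrite -(X_exp i).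
  rewrite /exponential_prob.
  rewrite integral_mkcond [RHS]integral_mkcond; apply: eq_integral => y _.
  rewrite !patchE !mem_setE !in_itv/=; case: (y <= x)%R; rewrite ?andbF// andbT.
  by case: leP => // /lt0_exponential_pdf ->.
move: x0; rewrite le_eqVlt => /orP[/eqP <-|x0].
  by rewrite oppr0 expR0 subrr /exponential_prob set_itv1 integral_set1.
by rewrite exponential_prob_itv0c// EFinB mulN1r.
Qed.

Lemma wait_oc i (x y : R) : (0 <= x)%R -> (x <= y)%R ->
  P (X i @^-1` [set` `]x, y]]) = (expR (- x) - expR (- y))%:E.
Proof.
move=> x0 xy; have y0 := le_trans x0 xy.
have mX z : measurable (X i @^-1` [set` `]-oo, z]]) by exact: preimage_measurable.
have -> : X i @^-1` [set` `]x, y]] = X i @^-1` [set` `]-oo, y]] `\` X i @^-1` [set` `]-oo, x]].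
  apply/seteqP; split=> [w|w []] /=; rewrite !in_itv/=.
    by move=> /andP[xr ry]; split=> //; apply/negP; rewrite -ltNge.
  by move=> ry /negP; rewrite -ltNge => ->.
rewrite measureD//; last by rewrite (le_lt_trans (probability_le1 _ _)) ?ltry//; exact: mX.
rewrite setIidr; last first.
  by apply: preimage_subset => r /=; rewrite !in_itv/= => /le_trans ->.
by rewrite [X in X - _]wait_le// [X in _ - X]wait_le// -EFinB; congr (_%:E); ring.
Qed.

Lemma wait_gt i (x : R) : (0 <= x)%R -> P (X i @^-1` [set` `]x, +oo[]) = (expR (- x))%:E.
Proof.
move=> x0; have mX : measurable (X i @^-1` [set` `]-oo, x]]) by exact: preimage_measurable.
have -> : X i @^-1` [set` `]x, +oo[] = ~` (X i @^-1` [set` `]-oo, x]]).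
  by rewrite preimage_setC setCitvl.
by rewrite [LHS]probability_setC// wait_le// -EFinB; congr (_%:E); ring.
Qed.

End Independent.

Section Memoryless.
Context {R : realType} d (T : measurableType d) (P : probability T R).
Context (I : choiceType) (X : I -> {RV P >-> R}).
Hypothesis X_indep : mutually_independent X.
Hypothesis X_exp : forall i B, measurable B ->
  distribution P (X i) B = exponential_prob 1 B.
Local Open Scope ereal_scope.

(** Cutting the range of [F] into cells of length [dt] replaces [F] by a
    constant on each cell, where independence applies directly. *)
Lemma memoryless_cells (J : set I) i0 (H : set T) (F : T -> R) (a b dt : R) :
  ~ J i0 -> info X J H -> info_fun X J F ->
  (forall w, H w -> 0 <= F w)%R -> (0 <= a)%R -> (0 < dt)%R -> (a + dt <= b)%R ->
  (expR (- (a + dt)) - expR (- b))%:E * P (H `&` [set w | F w < X i0 w]%R) <=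
  P (H `&` [set w | F w + a < X i0 w <= F w + b]%R).
Proof.
move=> nJ JH JF F0 a0 dt0 adb.
pose cell (n : nat) := H `&` [set w | n%:R * dt <= F w]%R `&`
  [set w | F w < n.+1%:R * dt]%R.
have Jcst (r : R) : info_fun X J (cst r) by exact: measurable_cst.
have Jcell n : info X J (cell n).
  by apply: infoI; [apply: infoI => //|]; [exact: (info_le (Jcst _) JF)|exact: (info_lt JF (Jcst _))].
have mF := info_fun_measurable JF.
have mX : measurable_fun setT (X i0) by exact: measurable_funP.
have mH := info_measurable JH.
have mlt : measurable [set w | F w < X i0 w]%R by exact: lt_fun_measurable.
have mbetween := between_measurable a b mF mX.
have mcell n := info_measurable (Jcell n).
have HE (A : set T) : H `&` A = \bigcup_n (cell n `&` A).
  apply/seteqP; split=> [w [Hw Aw]|w [n _ [[[Hw _] _] Aw]]]; last by split.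
  have Fdt : (0 <= F w / dt)%R by rewrite divr_ge0// ?F0// ltW.
  exists (Num.truncn (F w / dt)) => //; split=> //.
  have /andP[h1 h2] := truncn_itv Fdt.
  by split; [split=> //=; rewrite -ler_pdivlMr|rewrite /= -ltr_pdivrMr].
have tcell (A : set T) : trivIset setT (fun n => cell n `&` A).
  move=> m n _ _ [w [[[[_ /= m1] m2] _] [[[_ /= n1] n2] _]]].
  have lt_succ p q : (p%:R * dt <= F w)%R -> (F w < q.+1%:R * dt)%R -> (p <= q)%N.
    by move=> h1 h2; have := le_lt_trans h1 h2; rewrite ltr_pM2r// ltr_nat ltnS.
  by apply/eqP; rewrite eqn_leq !lt_succ.
rewrite !HE; apply: measure_bigcup_scale => //.
- by rewrite subr_ge0 ler_expR lerN2.
- by move=> n; exact: measurableI.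
- by move=> n; exact: measurableI.
move=> n; set x := (n%:R * dt)%R.
have x0 : (0 <= x)%R by rewrite mulr_ge0// ltW.
have xS : (n.+1%:R * dt = x + dt)%R by rewrite /x -addn1 natrD mulrDl mul1r.
apply: (@le_trans _ _ ((expR (- (a + dt)) - expR (- b))%:E *
   P (cell n `&` X i0 @^-1` [set` `]x, +oo[]))).
  rewrite lee_wpmul2l ?lee_fin ?subr_ge0 ?ler_expR ?lerN2//.
  apply: le_measure; rewrite ?inE.
  - exact: measurableI.
  - by apply: measurableI => //; exact: preimage_measurable.
  - move=> w [[[Hw h1] h2] /= h3]; split=> //=.
    by rewrite in_itv/= andbT (le_lt_trans h1).
apply: (@le_trans _ _ (P (cell n `&` X i0 @^-1` [set` `]x + dt + a, x + b]])))%R; last first.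
  apply: le_measure; rewrite ?inE.
  - by apply: measurableI => //; exact: preimage_measurable.
  - exact: measurableI.
  - move=> w [[[Hw h1] h2] /=]; rewrite in_itv/= => /andP[h3 h4].
    move: h2; rewrite /= xS => h2.
    split; first by split=> //=; rewrite xS.
    by apply/andP; split=> /=; move: h1; rewrite -/x /= => h1; lra.
rewrite (info_indep X_indep (Jcell n) nJ)// (info_indep X_indep (Jcell n) nJ)//.
rewrite wait_gt// wait_oc//; [|by lra|by lra].
rewrite muleCA lee_wpmul2l// -EFinM lee_fin.
rewrite (_ : (expR (- (x + dt + a)) - expR (- (x + b)) =
  (expR (- (a + dt)) - expR (- b)) * expR (- x))%R)//.
by rewrite mulrBl -!expRD; congr (expR _ - expR _)%R; ring.
Qed.

(** The loss in the previous bound is at most the length of the cells. *)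
Lemma memoryless_interval (J : set I) i0 (H : set T) (F : T -> R) (a b : R) :
  ~ J i0 -> info X J H -> info_fun X J F ->
  (forall w, H w -> 0 <= F w)%R -> (0 <= a)%R -> (a <= b)%R ->
  (expR (- a) - expR (- b))%:E * P (H `&` [set w | F w < X i0 w]%R) <=
  P (H `&` [set w | F w + a < X i0 w <= F w + b]%R).
Proof.
move=> nJ JH JF F0 a0; rewrite le_eqVlt => /orP[/eqP <-|ab].
  by rewrite subrr mul0e.
apply/lee_addgt0Pr => e e0.
pose dt := Num.min e (b - a)%R.
have dt0 : (0 < dt)%R by rewrite lt_min e0 subr_gt0.
have dte : (dt <= e)%R by rewrite ge_min lexx.
have dtb : (a + dt <= b)%R by rewrite -lerBrDl ge_min lexx orbT.
apply: le_trans (leeD2r _ (memoryless_cells nJ JH JF F0 a0 dt0 dtb)).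
set p := P (H `&` _).
have [p0 p1] : 0 <= p /\ p <= 1.
  split; first exact: measure_ge0.
  apply: probability_le1; apply: measurableI; first exact: info_measurable JH.
  by apply: lt_fun_measurable; [exact: info_fun_measurable JF|exact: measurable_funP].
have pf : p \is a fin_num by rewrite ge0_fin_numE// (le_lt_trans p1)// ltry.
move: p0 p1; rewrite -(fineK pf) !lee_fin => p0 p1.
rewrite opprD expRD.
have h1 : (1 - dt <= expR (- dt))%R by exact: expR_ge1Dx.
have h2 : (expR (- a) <= 1)%R by rewrite expR_le1 oppr_le0.
have h3 : (0 <= expR (- a))%R by exact: expR_ge0.
set q := fine p in p0 p1 *; set ea := expR (- a) in h2 h3 *; set ed := expR (- dt) in h1 *.
have : (ea * q * (1 - ed) <= e)%R.
  apply: le_trans dte; apply: (@le_trans _ _ (1 * dt)%R); last by rewrite mul1r.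
  have : (1 - ed <= dt)%R by lra.
  have eq0 : (0 <= ea * q)%R by rewrite mulr_ge0.
  have eq1 : (ea * q <= 1)%R by rewrite mulr_ile1.
  move=> h; apply: (@le_trans _ _ (ea * q * dt)%R); first exact: ler_wpM2l.
  by rewrite ler_wpM2r// ltW.
by lra.
Qed.

(** The interval of the previous bound grows to a half-line. *)
Lemma memoryless_gt (J : set I) i0 (H : set T) (F : T -> R) (a : R) :
  ~ J i0 -> info X J H -> info_fun X J F ->
  (forall w, H w -> 0 <= F w)%R -> (0 <= a)%R ->
  (expR (- a))%:E * P (H `&` [set w | F w < X i0 w]%R) <=
  P (H `&` [set w | F w + a < X i0 w]%R).
Proof.
move=> nJ JH JF F0 a0.
have mF := info_fun_measurable JF.
have mX : measurable_fun setT (X i0) by exact: measurable_funP.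
have mH := info_measurable JH.
have mlt : measurable [set w | F w + a < X i0 w]%R.
  apply: (@lt_fun_measurable _ _ _ (F \+ cst a)%R) => //.
  by apply: measurable_funD => //; exact: measurable_cst.
set p := P _; set q := P _.
have q0 : 0 <= q by exact: measure_ge0.
have mp : measurable [set w | F w < X i0 w]%R by exact: lt_fun_measurable.
have p1 : p <= 1 by apply: probability_le1; exact: measurableI.
have p0 : 0 <= p by exact: measure_ge0.
have pf : p \is a fin_num by rewrite ge0_fin_numE// (le_lt_trans p1)// ltry.
have bound n : (expR (- a) - expR (- (a + n%:R)))%:E * p <= q.
  apply: le_trans (memoryless_interval nJ JH JF F0 a0 (b := a + n%:R) _) _ => //.
    by rewrite lerDl.
  apply: le_measure; rewrite ?inE.
  - by apply: measurableI => //; exact: between_measurable.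
  - exact: measurableI.
  - by move=> w [Hw /= /andP[]].
apply/lee_addgt0Pr => e e0.
have [n hn] : exists n, (expR (- n%:R) <= e :> R)%R.
  have /cvgrPdist_le /(_ _ e0) [n _ /(_ n)/=] := @cvgn_expR R.
  by rewrite sub0r normrN ger0_norm ?expR_ge0// => /(_ (leqnn _)); exists n.
apply: le_trans (leeD2r _ (bound n)).
move: p0 p1; rewrite -(fineK pf) !lee_fin => p0 p1.
rewrite opprD expRD.
have h2 : (expR (- a) <= 1)%R by rewrite expR_le1 oppr_le0.
have h3 : (0 <= expR (- a))%R by exact: expR_ge0.
have h4 : (0 <= expR (- n%:R) :> R)%R by exact: expR_ge0.
set x := expR (- a) in h2 h3 *; set y := expR (- n%:R) in hn h4 *.
set r := fine p in p0 p1 *.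
have : (x * y * r <= e)%R.
  apply: le_trans hn; rewrite mulrAC; apply: ler_piMl => //.
  by rewrite mulr_ile1.
by lra.
Qed.

End Memoryless.

(** * Events decided by the rings up to a given time *)

Section Windows.
Context {R : realType} d (T : measurableType d) (P : probability T R).
Context (C : finType) (tau : C -> nat -> {RV P >-> R}).
Let X (cm : C * nat) : {RV P >-> R} := tau cm.1 cm.2.
Hypothesis X_indep : mutually_independent X.
Hypothesis X_exp : forall c m B, measurable B ->
  distribution P (tau c m) B = exponential_prob 1 B.
Local Open Scope ereal_scope.

Let X_exp' i B : measurable B -> distribution P (X i) B = exponential_prob 1 B.
Proof. exact: X_exp. Qed.

Definition counts := {ffun C -> nat}.
Implicit Types (n : counts) (c : C) (u h : R).

(** Rings are numbered from 1; the number 0 stands for the start. *)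
Definition ring_time c (m : nat) (w : T) : R := (\sum_(j < m) tau c j w)%R.

Lemma ring_timeS c m w : ring_time c m.+1 w = (ring_time c m w + tau c m w)%R.
Proof. by rewrite /ring_time big_ord_recr. Qed.

Lemma ring_time_le c m m' w : (m <= m')%N ->
  (forall j, (j < m')%N -> 0 <= tau c j w)%R -> (ring_time c m w <= ring_time c m' w)%R.
Proof.
move=> mm' t0; rewrite -(subnKC mm'); rewrite -(subnKC mm') in t0.
elim: (m' - m)%N t0 => [|e ih] t0; first by rewrite addn0.
rewrite addnS ring_timeS (le_trans (ih _))//.
  by move=> j je; apply: t0; rewrite addnS ltnS ltnW.
by rewrite lerDl; apply: t0; rewrite addnS.
Qed.

Definition used n : set (C * nat) := [set cm | (cm.2 < n cm.1)%N].

(** The part of [window] below that depends only on the waiting times that have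
    been used up. Their signs are included so that the windows of different
    counts are disjoint everywhere and not only almost surely. *)
Definition past n u : set T :=
  [set w | forall c, (forall m, (m < n c)%N -> 0 <= tau c m w)%R /\
                     (ring_time c (n c) w <= u)%R].

(** Each clock [c] has rung exactly [n c] times at time [u]. *)
Definition window n u : set T :=
  past n u `&` [set w | forall c, (u < ring_time c (n c).+1 w)%R].

Lemma info_forall (J : set (C * nat)) (A : countType) (B : A -> set T) :
  (forall a, info X J (B a)) -> info X J [set w | forall a, B a w].
Proof.
move=> JB; have -> : [set w | forall a, B a w] = ~` (\bigcup_a ~` B a).
  apply/seteqP; split=> [w h [a _]|w h a]; first by apply; exact: h.
  by apply: contrapT => nB; apply: h; exists a.
rewrite info_set; apply: measurableC; apply: bigcup_measurable_countType => a.
by apply: measurableC; exact: JB.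
Qed.

Lemma info_imply (J : set (C * nat)) (p : Prop) (B : set T) :
  (p -> info X J B) -> info X J [set w | p -> B w].
Proof.
have [pp|np] := pselect p => JB.
  suff -> : [set w | p -> B w] = B by exact: JB.
  by apply/seteqP; split=> w /=; [apply|].
suff -> : [set w | p -> B w] = setT by exact: infoT.
by apply/seteqP; split=> w _ // /np.
Qed.

Lemma info_cst (J : set (C * nat)) (r : R) : info_fun X J (fun=> r).
Proof. exact: measurable_cst. Qed.

Lemma info_ring_time (J : set (C * nat)) c m :
  (forall j, (j < m)%N -> J (c, j)) -> info_fun X J (ring_time c m).
Proof.
move=> Jc; have -> : ring_time c m = (fun w => \sum_(i <- [seq (c, j) | j <- index_iota 0 m]) X i w)%R.
  by apply/funext => w; rewrite big_map big_mkord.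
by apply: info_sum => _ /mapP[j + ->]; rewrite mem_index_iota => /= jm; exact: Jc.
Qed.

Lemma used_neq n c0 : used n `<=` [set~ (c0, n c0)].
Proof. by move=> [c m]; rewrite /used/= => h1 [cc0 mn]; move: h1; rewrite mn cc0 ltnn. Qed.

Lemma info_elapsed n u (J : set (C * nat)) c : used n `<=` J ->
  info_fun X J (fun w => u - ring_time c (n c) w)%R.
Proof.
move=> nJ; apply: (@measurable_funB _ _ _ _ (cst u)); first exact: measurable_cst.
by apply: info_ring_time => j jn; exact: nJ.
Qed.

Lemma past_info n u (J : set (C * nat)) : used n `<=` J -> info X J (past n u).
Proof.
move=> nJ; apply: info_forall => c; apply: infoI.
  apply: info_forall => m; apply: info_imply => mn.
  have JX : info_fun X J (X (c, m)) by apply: info_var; exact: nJ.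
  by apply: info_le => //; exact: info_cst.
apply: info_le; last exact: info_cst.
by apply: info_ring_time => j jn; exact: nJ.
Qed.

Lemma window_info n u : info X setT (window n u).
Proof.
apply: infoI; first exact: past_info.
apply: info_forall => c.
by apply: info_lt; [exact: info_cst|exact: info_ring_time].
Qed.

Lemma window_measurable n u : measurable (window n u).
Proof. exact: info_measurable (window_info n u). Qed.

Lemma window_disjoint n n' u w : window n u w -> window n' u w -> n = n'.
Proof.
have aux (m m' : counts) c : window m u w -> window m' u w -> (m' c <= m c)%N.
  move=> [pm nm] [pm' nm']; rewrite leqNgt; apply/negP => lt_mm'.
  have [t0 le_u] := pm' c.
  have := le_lt_trans (le_trans (ring_time_le lt_mm' t0) le_u) (nm c).
  by rewrite ltxx.
by move=> wn wn'; apply/ffunP => c; apply/eqP; rewrite eqn_leq !aux.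
Qed.

Definition incr c0 n : counts := [ffun c => if c == c0 then (n c).+1 else n c].

Lemma incr_neq c0 n : incr c0 n <> n.
Proof. by move=> /ffunP/(_ c0); rewrite ffunE eqxx; lia. Qed.

Lemma incr_inj_clock c c' n : incr c n = incr c' n -> c = c'.
Proof. by move=> /ffunP/(_ c); rewrite !ffunE eqxx; case: eqP => // _; lia. Qed.

(** [thr c] is the time up to which the clock [c] is known not to have rung
    again since [u]. *)
Let waiting n u (thr : C -> R) : set T :=
  past n u `&` [set w | forall c, (thr c < ring_time c (n c).+1 w)%R].

(** The waiting time in progress of [c0] is independent of [G], of the past and
    of the other clocks, hence it lacks memory. *)
Lemma raise_threshold n u h (G : set T) (thr : C -> R) c0 :
  info X (used n) G -> (0 <= h)%R -> thr c0 = u ->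
  (expR (- h))%:E * P (G `&` waiting n u thr) <=
  P (G `&` waiting n u (fun c => if c == c0 then (u + h)%R else thr c)).
Proof.
move=> JG h0 thr0; pose i0 := (c0, n c0); pose J : set (C * nat) := [set~ i0].
have usedJ : used n `<=` J := @used_neq n c0.
pose H := G `&` past n u `&`
  [set w | forall c, c != c0 -> (thr c < ring_time c (n c).+1 w)%R].
have JH : info X J H.
  apply: infoI; first by apply: infoI; [exact: info_mono usedJ _ JG|exact: past_info].
  apply: info_forall => c; apply: info_imply => cc0.
  apply: info_lt; first exact: info_cst.
  by apply: info_ring_time => j _ [cc]; move: cc0; rewrite cc eqxx.
pose F w := (u - ring_time c0 (n c0) w)%R.
have JF : info_fun X J F := info_elapsed u c0 usedJ.
have F0 w : H w -> (0 <= F w)%R by move=> [[_ pw] _]; rewrite subr_ge0; case: (pw c0).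
have nJ : ~ J i0 by apply.
have := memoryless_gt X_indep X_exp' nJ JH JF F0 h0.
rewrite (_ : H `&` _ = G `&` waiting n u thr); last first.
  apply/seteqP; split=> w /=.
    move=> [[[Gw pw] others] /= lt0]; split=> //; split=> // c.
    have [->|cc0] := eqVneq c c0; last exact: others.
    by rewrite thr0 ring_timeS; move: lt0; rewrite /F /X/=; lra.
  move=> [Gw [pw all_]]; split; first by split=> // c _; exact: all_.
  by have := all_ c0; rewrite thr0 ring_timeS /F /X/=; lra.
rewrite (_ : H `&` _ = G `&` waiting n u (fun c => if c == c0 then (u + h)%R else thr c))//.
apply/seteqP; split=> w /=.
  move=> [[[Gw pw] others] /= lt0]; split=> //; split=> // c.
  have [->|cc0] := eqVneq c c0; last exact: others.
  by rewrite ring_timeS; move: lt0; rewrite /F /X/=; lra.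
move=> [Gw [pw all_]]; split.
  split=> // c cc0; have := all_ c; by rewrite (negbTE cc0).
by have := all_ c0; rewrite eqxx ring_timeS /F /X/=; lra.
Qed.

Lemma waiting_measurable n u thr (G : set T) :
  info X (used n) G -> measurable (G `&` waiting n u thr).
Proof.
move=> JG; apply: (@info_measurable _ _ _ _ _ X setT); apply: infoI.
  by apply: info_mono JG.
apply: infoI; first exact: past_info.
apply: info_forall => c.
by apply: info_lt; [exact: info_cst|exact: info_ring_time].
Qed.

Lemma raise_thresholds n u h (G : set T) (s : seq C) :
  info X (used n) G -> (0 <= h)%R -> uniq s ->
  (expR (- ((size s)%:R * h)))%:E * P (G `&` window n u) <=
  P (G `&` waiting n u (fun c => if c \in s then (u + h)%R else u)).
Proof.
move=> JG h0; elim: s => [_|c s ih] /=.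
  by rewrite mul0r oppr0 expR0 mul1e.
move=> /andP[cs us].
have := raise_threshold (thr := fun c => if c \in s then (u + h)%R else u) (c0 := c) JG h0.
rewrite (negbTE cs) => /(_ u erefl).
rewrite (_ : waiting n u (fun c1 => if c1 == c then _ else _) =
  waiting n u (fun c1 => if c1 \in c :: s then (u + h)%R else u)); last first.
  by congr waiting; apply/funext => c1; rewrite in_cons; case: eqP.
apply: le_trans.
rewrite -natr1 mulrDl mul1r opprD addrC expRD EFinM -muleA.
by rewrite lee_wpmul2l// ?lee_fin ?expR_ge0// ih.
Qed.

Lemma window_stay n u h (G : set T) : info X (used n) G -> (0 <= h)%R ->
  (expR (- (#|C|%:R * h)))%:E * P (G `&` window n u) <=
  P (G `&` (window n u `&` window n (u + h))).
Proof.
move=> JG h0.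
have := raise_thresholds u JG h0 (enum_uniq C).
rewrite -cardE => /le_trans; apply.
apply: le_measure; rewrite ?inE.
- exact: waiting_measurable.
- apply: measurableI; first exact: info_measurable JG.
  by apply: measurableI; exact: window_measurable.
move=> w [Gw [pw lt_w]]; split=> //.
have lt_uh c : (u + h < ring_time c (n c).+1 w)%R.
  by have := lt_w c; rewrite mem_enum.
split; split=> // c.
- by apply: le_lt_trans (lt_uh c); rewrite lerDl.
- by have [t0 tu] := pw c; split=> //; rewrite (le_trans tu)// lerDl.
Qed.

(** The clock [c0] rings in the interval and the others do not; its next waiting
    time exceeds the length of the interval, so that it rings only once. *)
Lemma window_ring n u h c0 (G : set T) : info X (used n) G -> (0 <= h)%R ->
  ((1 - expR (- h)) * expR (- (#|C|%:R * h)))%:E * P (G `&` window n u) <=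
  P (G `&` (window n u `&` window (incr c0 n) (u + h))).
Proof.
move=> JG h0.
pose s := rem c0 (enum C).
have s_uniq : uniq s by rewrite rem_uniq// enum_uniq.
have mem_s c : (c \in s) = (c != c0) by rewrite mem_rem_uniq ?enum_uniq// !inE mem_enum andbT.
have size_s : (size s)%:R = (#|C|%:R - 1 :> R)%R.
  rewrite size_rem ?mem_enum// -cardE.
  have : (0 < #|C|)%N by apply/card_gt0P; exists c0.
  by move=> C0; rewrite -subn1 natrB.
have step1 := raise_thresholds u JG h0 s_uniq; rewrite size_s in step1.
pose i0 := (c0, n c0); pose J : set (C * nat) := [set~ i0].
have usedJ : used n `<=` J := @used_neq n c0.
pose H := G `&` past n u `&`
  [set w | forall c, c != c0 -> (u + h < ring_time c (n c).+1 w)%R].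
have H_info J' : used n `<=` J' -> (forall c, c != c0 -> J' (c, n c)) -> info X J' H.
  move=> nJ' J'c; apply: infoI.
    by apply: infoI; [exact: info_mono nJ' _ JG|exact: past_info].
  apply: info_forall => c; apply: info_imply => cc0.
  apply: info_lt; first exact: info_cst.
  apply: info_ring_time => j; rewrite ltnS leq_eqVlt => /orP[/eqP ->|]; first exact: J'c.
  by move=> jn; apply: nJ'.
have JH : info X J H.
  by apply: H_info => // c cc0 [cc]; move: cc0; rewrite cc eqxx.
pose F w := (u - ring_time c0 (n c0) w)%R.
have JF : info_fun X J F := info_elapsed u c0 usedJ.
have F0 w : H w -> (0 <= F w)%R by move=> [[_ pw] _]; rewrite subr_ge0; case: (pw c0).
have nJ : ~ J i0 by apply.
have step2 := memoryless_interval X_indep X_exp' nJ JH JF F0 (lexx 0%R) h0.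
have e1 : H `&` [set w | (F w < X i0 w)%R] =
    G `&` waiting n u (fun c => if c \in s then (u + h)%R else u).
  apply/seteqP; split=> w /=.
    move=> [[[Gw pw] others] /= lt0]; split=> //; split=> // c.
    rewrite mem_s; have [->|cc0] := eqVneq c c0; last exact: others.
    by rewrite ring_timeS; move: lt0; rewrite /F /X/=; lra.
  move=> [Gw [pw all_]]; split.
    by split=> // c cc0; have := all_ c; rewrite mem_s cc0.
  by have := all_ c0; rewrite mem_s eqxx ring_timeS /F /X/=; lra.
rewrite e1 oppr0 expR0 in step2.
set H2 := H `&` [set w | (F w + 0 < X i0 w <= F w + h)%R] in step2.
(* [H2] puts a ring of [c0] in the interval; [i1] indexes the waiting time
   after this ring *)
pose i1 := (c0, (n c0).+1); pose J1 : set (C * nat) := [set~ i1].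
have J1H2 : info X J1 H2.
  have usedJ1 : used n `<=` J1.
    by move=> [c m]; rewrite /used/= => h1 [cc0 mn]; move: h1; rewrite mn cc0; lia.
  apply: infoI; first by apply: H_info => // c cc0 [cc]; move: cc0; rewrite cc eqxx.
  have J1X : info_fun X J1 (X i0) by apply: info_var => -[]; lia.
  have J1F b : info_fun X J1 (fun w => F w + b)%R.
    rewrite (_ : (fun w => F w + b)%R = ((cst u \- ring_time c0 (n c0)) \+ cst b)%R)//.
    apply: measurable_funD; last exact: measurable_cst.
    exact: info_elapsed.
  rewrite (_ : [set w | _] = [set w | F w + 0 < X i0 w]%R `&` [set w | X i0 w <= F w + h]%R).
    by apply: infoI; [exact: info_lt|exact: info_le].
  by apply/seteqP; split=> w /= => [/andP[]|[-> ->]].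
have nJ1 : ~ J1 i1 by apply.
have step3 : P (H2 `&` X i1 @^-1` [set` `]h, +oo[]) = P H2 * (expR (- h))%:E.
  by rewrite (info_indep X_indep J1H2 nJ1)// wait_gt.
apply: (@le_trans _ _ (P (H2 `&` X i1 @^-1` [set` `]h, +oo[]))); last first.
  apply: le_measure; rewrite ?inE.
  - apply: measurableI; first exact: info_measurable J1H2.
    exact: preimage_measurable.
  - apply: measurableI; first exact: info_measurable JG.
    by apply: measurableI; exact: window_measurable.
  move=> w [[[[Gw pw] others] /= /andP[lt1 le1]]]; rewrite in_itv/= andbT => lt2.
  have [t0 tu] := pw c0.
  split=> //; split; split=> // c.
  - have [->|cc0] := eqVneq c c0; first by rewrite ring_timeS; move: lt1; rewrite /F /X/=; lra.
    by apply: le_lt_trans (others _ cc0); rewrite lerDl.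
  - rewrite /incr ffunE; have [->|cc0] := eqVneq c c0; last first.
      by have [t0' tu'] := pw c; split=> //; rewrite (le_trans tu')// lerDl.
    split; last by rewrite ring_timeS; move: le1; rewrite /F /X/=; lra.
    move=> m; rewrite ltnS leq_eqVlt => /orP[/eqP ->|]; last exact: t0.
    by move: lt1; rewrite /F /X/=; lra.
  - rewrite /incr ffunE; have [->|cc0] := eqVneq c c0; last exact: others.
    by rewrite ring_timeS ring_timeS; move: lt1 lt2; rewrite /F /X/=; lra.
rewrite step3 muleC; apply: (@le_trans _ _ ((expR (- h))%:E * ((1 - expR (- h))%:E *
   P (G `&` waiting n u (fun c => if c \in s then (u + h)%R else u))))); last first.
  by rewrite [leRHS]muleC lee_wpmul2l// ?lee_fin ?expR_ge0.
rewrite -[leLHS]muleC.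
rewrite (_ : ((1 - expR (- h)) * expR (- (#|C|%:R * h)))%R =
  (expR (- h) * ((1 - expR (- h)) * expR (- ((#|C|%:R - 1) * h))))%R); last first.
  rewrite mulrCA -expRD; congr (_ * expR _)%R; ring.
rewrite !EFinM -!muleA lee_wpmul2l// ?lee_fin ?expR_ge0//.
rewrite lee_wpmul2l// lee_fin subr_ge0 expR_le1 oppr_le0//.
Qed.

End Windows.

Section Adapted.
Context {R : realType} d (T : measurableType d) (P : probability T R).
Context (C : finType) (tau : C -> nat -> {RV P >-> R}).
Let X (cm : C * nat) : {RV P >-> R} := tau cm.1 cm.2.
Hypothesis X_indep : mutually_independent X.
Hypothesis X_exp : forall c m B, measurable B ->
  distribution P (tau c m) B = exponential_prob 1 B.
Local Open Scope ereal_scope.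
Local Notation counts := (counts C).
Local Notation window := (window tau).
Local Notation past := (past tau).
Local Notation ring_time := (ring_time tau).
Implicit Types (n : counts) (c : C) (u h : R) (D : set T).

Definition pieces u (G : counts -> set T) : set T := \bigcup_n (G n `&` window n u).

(** An event is adapted at time [u] if, once the number of rings up to [u] of
    each clock is known, it is decided by the waiting times before these
    rings. The waiting times in progress are then independent of it. *)
Definition adapted u D : Prop :=
  exists2 G : counts -> set T, (forall n, info X (used n) (G n)) & D = pieces u G.

Lemma adapted_measurable u D : adapted u D -> measurable D.
Proof.
move=> [G JG ->]; apply: bigcup_measurable_countType => n.
by apply: measurableI; [exact: info_measurable (JG n)|exact: window_measurable].
Qed.

Lemma adapted_set0 u : adapted u set0.
Proof.
exists (fun=> set0); first by move=> n; exact: info0.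
by apply/seteqP; split=> // w [n _ [[]]].
Qed.

Lemma adapted_bigcup u (A : countType) (D : A -> set T) :
  (forall a, adapted u (D a)) -> adapted u (\bigcup_a D a).
Proof.
move=> /(_ _)/cid2-/all_sig2[G JG DG]; exists (fun n => \bigcup_a G a n).
  by move=> n; rewrite info_set; apply: bigcup_measurable_countType => a; exact: JG.
apply/seteqP; split=> w.
  by move=> [a _]; rewrite DG => -[n _ [Gw ww]]; exists n => //; split=> //; exists a.
by move=> [n _ [[a _ Gw] ww]]; exists a => //; rewrite DG; exists n.
Qed.

Lemma adapted_stay u h D : (0 <= h)%R -> adapted u D ->
  exists D', [/\ adapted (u + h) D',
    (expR (- (#|C|%:R * h)))%:E * P D <= P D' &
    forall w, D' w -> D w /\ exists2 n, window n u w & window n (u + h) w].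
Proof.
move=> h0 [G JG ->].
exists (\bigcup_n (G n `&` (window n u `&` window n (u + h)))); split.
- exists (fun n => G n `&` past n u).
    by move=> n; apply: infoI => //; exact: past_info.
  apply/seteqP; split=> w [n _].
    by move=> [Gw [[pw _] ww]]; exists n.
  move=> [[Gw pw] [pw' lt_w]]; exists n => //; split=> //; split=> //; split=> // c.
  by apply: le_lt_trans (lt_w c); rewrite lerDl.
- apply: measure_bigcup_scale; first exact: expR_ge0.
  + by move=> n; apply: measurableI; [exact: info_measurable (JG n)|exact: window_measurable].
  + move=> n; apply: measurableI; first exact: info_measurable (JG n).
    by apply: measurableI; exact: window_measurable.
  + by move=> n n' _ _ [w [[_ [wn _]] [_ [wn' _]]]]; exact: window_disjoint wn wn'.
  + by move=> n; exact: window_stay.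
- move=> w [n _ [Gw [ww ww']]]; split; last by exists n.
  by exists n.
Qed.

(** The counts after the ring determine those before it, hence the new event is
    adapted again. *)
Lemma adapted_ring u h c0 D : (0 <= h)%R -> adapted u D ->
  exists D', [/\ adapted (u + h) D',
    ((1 - expR (- h)) * expR (- (#|C|%:R * h)))%:E * P D <= P D' &
    forall w, D' w -> D w /\ exists2 n, window n u w & window (incr c0 n) (u + h) w].
Proof.
move=> h0 [G JG ->].
exists (\bigcup_n (G n `&` (window n u `&` window (incr c0 n) (u + h)))); split.
- pose decr n : counts := [ffun c => if c == c0 then (n c).-1 else n c].
  have incrK n : decr (incr c0 n) = n.
    by apply/ffunP => c; rewrite !ffunE; case: eqP.
  have decrK n : n c0 != 0%N -> incr c0 (decr n) = n.
    move=> n0; apply/ffunP => c; rewrite !ffunE; case: eqP => // ->.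
    by rewrite prednK// lt0n.
  have used_decr n : used (decr n) `<=` used n.
    move=> [c m]; rewrite /used/= ffunE; case: eqP => // _ /leq_trans; apply.
    exact: leq_pred.
  pose G' n := if n c0 == 0%N then set0 else
     (G (decr n) `&` past (decr n) u) `&` [set w | u < ring_time c0 (n c0) w]%R.
  exists G'.
    move=> n; rewrite /G'; case: ifP => // _; first exact: info0.
    apply: infoI; first apply: infoI.
    + exact: info_mono (used_decr n) _ (JG _).
    + exact: past_info.
    + by apply: info_lt; [exact: info_cst|exact: info_ring_time].
  apply/seteqP; split=> w [n _].
    move=> [Gw [[pw lt_w] ww]]; exists (incr c0 n) => //; split=> //.
    by rewrite /G' incrK ffunE eqxx/=; split=> //; exact: lt_w.
  rewrite /G'; case: ifP => [_ []//|n0 [[[Gw pw] lt0] [pw' lt_w]]].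
  exists (decr n) => //; split=> //; rewrite decrK ?n0//; split=> //; split=> // c.
  rewrite ffunE; have [->|cc0] := eqVneq c c0; first by rewrite prednK// lt0n n0.
  by apply: le_lt_trans (lt_w c); rewrite lerDl.
- apply: measure_bigcup_scale.
  + by rewrite mulr_ge0 ?expR_ge0// subr_ge0 expR_le1 oppr_le0.
  + by move=> n; apply: measurableI; [exact: info_measurable (JG n)|exact: window_measurable].
  + move=> n; apply: measurableI; first exact: info_measurable (JG n).
    by apply: measurableI; exact: window_measurable.
  + by move=> n n' _ _ [w [[_ [wn _]] [_ [wn' _]]]]; exact: window_disjoint wn wn'.
  + by move=> n; exact: window_ring.
- move=> w [n _ [Gw [ww ww']]]; split; last by exists n.
  by exists n.
Qed.

Lemma wait_pos c m : P [set w | (0 < tau c m w)%R] = 1.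
Proof.
have := wait_gt (X := X) (fun i => @X_exp i.1 i.2) (c, m) (lexx 0%R).
rewrite oppr0 expR0 => <-; congr (P _).
by apply/seteqP; split=> w; rewrite /= in_itv/= andbT.
Qed.

Lemma wait_pos_ae : P.-negligible (~` [set w | forall c m, (0 < tau c m w)%R]).
Proof.
pose Z (cm : C * nat) := ~` [set w | (0 < tau cm.1 cm.2 w)%R].
have mpos cm : measurable [set w | (0 < tau cm.1 cm.2 w)%R].
  apply: (@info_measurable _ _ _ _ _ X setT).
  have JX : info_fun X setT (X cm) by exact: info_var.
  by apply: info_lt => //; exact: info_cst.
apply: (@negligibleS _ _ _ _ (\bigcup_cm Z cm)).
  by move=> w nw; apply: contrapT => nZ; apply: nw => c m; apply: contrapT => h;
     apply: nZ; exists (c, m).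
rewrite bigcup_pickle; apply: negligible_bigcup => j.
case: (choice.pickle_inv j) => [cm|] /=; last exact: negligible_set0.
apply/negligibleP; first exact: measurableC.
have := probability_setC P (mpos cm).
by rewrite wait_pos subee.
Qed.

Lemma full_measure D : measurable D -> P.-negligible (~` D) -> P D = 1.
Proof.
move=> mD /negligibleP => /(_ (measurableC mD)) h.
have := probability_setC P (measurableC mD).
by rewrite setCK => ->; move: h => /= ->; rewrite sube0.
Qed.

Lemma adapted_start : exists D, [/\ adapted 0 D, P D = 1 &
  forall w, D w -> window [ffun=> 0%N] 0 w].
Proof.
pose n0 : counts := [ffun=> 0%N].
exists (window n0 0); split=> //.
  exists (fun n => if n == n0 then setT else set0).
    by move=> n; case: ifP => _; [exact: infoT|exact: info0].
  apply/seteqP; split=> [w ww|w [n _ []]]; first by exists n0 => //; rewrite eqxx.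
  by case: eqP => [->|].
apply: full_measure; first exact: window_measurable.
apply: negligibleS wait_pos_ae; apply: subsetC => w pos_w.
have r0 c : ring_time c (n0 c) w = 0%R by rewrite ffunE /ring_time big_ord0.
split=> c.
- by rewrite r0; split=> // m; rewrite ffunE.
- by rewrite ring_timeS r0 add0r.
Qed.

End Adapted.

(** * Lower bounds for the law of the process *)

Section Feasible.
Context {R : realType} d (T : measurableType d) (P : probability T R) (k : nat).
Context (tau : clock k -> nat -> {RV P >-> R}) (Y : R -> T -> pattern k).
Hypothesis X_indep : mutually_independent (fun cm : clock k * nat => tau cm.1 cm.2).
Hypothesis X_exp : forall c m B, measurable B ->
  distribution P (tau c m) B = exponential_prob 1 B.
Variable good : set T.
Hypothesis good_measurable : measurable good.
Hypothesis good_null : P (~` good) = 0%E.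
Hypothesis good_rules : forall w, good w ->
  follows_rules (fun c n => \sum_(m < n.+1) tau c m w) (Y^~ w).
Hypothesis good_pos : forall w, good w -> forall c m, 0 < tau c m w.
Local Notation counts := (counts (clock k)).
Local Notation window := (window tau).
Local Notation ring_time := (ring_time tau).
Local Notation adapted := (adapted tau).
Implicit Types (n : counts) (c : clock k) (u h : R) (D H : set T) (w : T).

Let nclocks : R := #|{: clock k}|%:R.

Lemma ring_time_mono w c m m' : good w -> (m <= m')%N ->
  ring_time c m w <= ring_time c m' w.
Proof. by move=> gw mm'; apply: ring_time_le => // j _; apply/ltW/good_pos. Qed.

Lemma ring_time_window n u w c m : good w -> window n u w ->
  ring_time c m w <= u -> (m <= n c)%N.
Proof.
move=> gw [_ lt_w] le_u; rewrite leqNgt; apply/negP => nm.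
have := le_lt_trans (le_trans (ring_time_mono c gw nm) le_u) (lt_w c).
by rewrite ltxx.
Qed.

Lemma window_le n u w c m : window n u w -> (m <= n c)%N -> good w ->
  ring_time c m w <= u.
Proof.
by move=> [pw _] mn gw; apply: le_trans (ring_time_mono c gw mn) _; case: (pw c).
Qed.

Lemma path_stay n u h w : good w -> 0 <= u -> 0 <= h ->
  window n u w -> window n (u + h) w -> Y (u + h) w = Y u w.
Proof.
move=> gw u0 h0 wu wuh; have [_ _ const _] := good_rules gw.
apply: const => //; first by rewrite lerDl.
move=> c m /andP[lt_u le_uh].
have mn := ring_time_window gw wuh (le_uh : ring_time c m.+1 w <= u + h).
have := le_lt_trans (window_le wu mn gw) lt_u.
by rewrite ltxx.
Qed.

(** The rules give the effect of a ring on the left limit of the path, which is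
    the value at [u] because no clock rings in between. *)
Lemma path_ring n u h w c0 : good w -> 0 <= u -> 0 <= h ->
  window n u w -> window (incr c0 n) (u + h) w ->
  Y (u + h) w = jump c0 (Y u w).
Proof.
move=> gw u0 h0 wu wuh; have [_ _ const jmp] := good_rules gw.
set r := ring_time c0 (n c0).+1 w.
have ur : u < r by have [_ /(_ c0)] := wu.
have ruh : r <= u + h.
  by have [/(_ c0)[_]] := wuh; rewrite ffunE eqxx.
(* within the interval, the only ring is that of [c0] at time [r] *)
have only c m : u < ring_time c m.+1 w -> ring_time c m.+1 w <= u + h ->
    c = c0 /\ m = n c0.
  move=> lt_u le_uh.
  have := ring_time_window gw wuh le_uh; rewrite ffunE.
  have nm : (n c < m.+1)%N.
    rewrite ltnNge; apply/negP => mn.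
    by have := le_lt_trans (window_le wu mn gw) lt_u; rewrite ltxx.
  case: eqP => [cc0|_ mn]; last by move: (leq_trans nm mn); rewrite ltnn.
  rewrite cc0 in nm * => mn; split=> //.
  by apply/eqP; rewrite eqn_leq -ltnS mn -ltnS nm.
have -> : Y (u + h) w = Y r w.
  apply: const => //; first exact: ltW (le_lt_trans u0 ur).
  move=> c m /andP[lt_r le_uh].
  have [cc0 mn] := only c m (lt_trans ur lt_r) le_uh.
  by move: lt_r; rewrite cc0 mn -[X in _ < X]/r ltxx.
have near_r := jmp c0 (n c0).
have near_u : \forall t \near r^'-, u < t by exact: nbhs_left_gt.
have near_lt : \forall t \near r^'-, t < r by exact: nbhs_left_lt.
have [t [[]]] : exists t, [/\ u < t, t < r & Y r w = jump c0 (Y t w)] /\ True.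
  apply: (@filter_ex _ (r^'-)).
  by near=> t; split=> //; split; near: t.
move=> ut tr -> _; congr (jump c0 _).
apply: const => //; first exact: ltW.
move=> c m /andP[lt_u le_t].
have [cc0 mn] := only c m lt_u (le_trans le_t (le_trans (ltW tr) ruh)).
by have := le_lt_trans le_t tr; rewrite cc0 mn -[X in X < _]/r ltxx.
Unshelve. all: by end_near. Qed.

Local Open Scope ereal_scope.

Lemma measure_good D : measurable D -> P (D `&` good) = P D.
Proof.
move=> mD; rewrite (measureDI P mD good_measurable) [X in _ = X + _](_ : _ = 0) ?add0e//.
apply: (@subset_measure0 _ _ _ P _ (~` good)) => //.
- exact: measurableD.
- exact: measurableC.
Qed.

(** The events met below are disjoint because the path has one value at each
    time; this argument works on the good event only. *)
Lemma esum_measure_le (A : countType) (J : set A) (F : A -> set T) D :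
  (forall a, J a -> measurable (F a)) -> measurable D ->
  (forall a a' w, J a -> J a' -> good w -> F a w -> F a' w -> a = a') ->
  (forall a w, J a -> good w -> F a w -> D w) ->
  \esum_(a in J) P (F a) <= P D.
Proof.
move=> mF mD disj FD; apply: ge_ereal_sup => _ [B [finB BJ] <-].
rewrite (eq_fsbigr (fun a => P (F a `&` good))); last first.
  by move=> a /set_mem/BJ Ja; rewrite measure_good//; exact: mF.
rewrite -measure_fin_bigcup//; last 2 first.
- move=> a a' /BJ Ja /BJ Ja' [w [[Fw gw] [Fw' _]]]; exact: disj Fw Fw'.
- by move=> a /BJ Ja; apply: measurableI => //; exact: mF.
apply: le_measure; rewrite ?inE//.
  apply: fin_bigcup_measurable => // a /BJ Ja; apply: measurableI => //; exact: mF.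
by move=> w [a /BJ Ja [Fw gw]]; exact: FD Fw.
Qed.

(** Lower bounds for the law of the process at time [u] within the event [H].
    They are witnessed by adapted events, so that they can be carried over to
    later times by lack of memory. *)
Definition feasible u H (v : pattern k -> \bar R) : Prop :=
  forall y, exists D, [/\ adapted u D, v y <= P D &
    forall w, good w -> D w -> H w /\ Y u w = y].

Lemma feasible_le u H v v' : (forall y, v' y <= v y) -> feasible u H v ->
  feasible u H v'.
Proof.
move=> vv' fv y; have [D [aD vD DH]] := fv y.
by exists D; split=> //; exact: le_trans (vv' y) vD.
Qed.

Lemma feasible_sup u H (v : nat -> pattern k -> \bar R) :
  (forall m, feasible u H (v m)) ->
  feasible u H (fun y => ereal_sup [set v m y | m in [set: nat]]).
Proof.
move=> fv y; have /(_ _)/cid-/all_sig[D Dprop] := fv ^~ y.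
have aD : adapted u (\bigcup_m D m) by apply: adapted_bigcup => m; case: (Dprop m).
exists (\bigcup_m D m); split=> //.
  apply: ge_ereal_sup => _ [m _ <-]; have [am vm _] := Dprop m.
  apply: le_trans vm _; apply: le_measure; rewrite ?inE.
  - exact: adapted_measurable am.
  - exact: adapted_measurable aD.
  - exact: bigcup_sup.
by move=> w gw [m _ Dw]; have [_ _] := Dprop m; apply.
Qed.

Lemma feasible_sub u H H' (A : set (pattern k)) v :
  feasible u H v -> (forall w, good w -> H w -> A (Y u w) -> H' w) ->
  (forall y, ~ A y -> v y <= 0) -> feasible u H' v.
Proof.
move=> fv HH' v0 y; have [Ay|nAy] := pselect (A y); last first.
  by exists set0; split=> //; [exact: adapted_set0|rewrite measure0 v0].
have [D [aD vD DH]] := fv y; exists D; split=> // w gw Dw.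
by have [Hw yw] := DH w gw Dw; split=> //; apply: HH' => //; rewrite yw.
Qed.

Lemma feasible_start : feasible 0 setT (fun y => if y == [ffun=> 0%R] then 1 else 0).
Proof.
move=> y; case: eqP => [->|_]; last first.
  by exists set0; split=> //; exact: adapted_set0.
have [D [aD PD Dw]] := adapted_start X_exp.
exists D; split=> //; first by rewrite PD.
by move=> w gw _; split=> //; have [_ ->] := good_rules gw.
Qed.

(** During a short interval, either no clock rings or exactly one does, once.
    The other cases have a probability of second order and are dropped. *)
Lemma feasible_step u h H v : (0 <= u)%R -> (0 <= h)%R -> (forall y, 0 <= v y) ->
  feasible u H v ->
  feasible (u + h) H (fun y => (expR (- (nclocks * h)))%:E *
    (v y + (1 - expR (- h))%:E *
       \esum_(cy in [set cy : clock k * pattern k | jump cy.1 cy.2 = y]) v cy.2)).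
Proof.
move=> u0 h0 v0 /(_ _)/cid-/all_sig[D Dprop] y'.
have aD y : adapted u (D y) by case: (Dprop y).
have /(_ _)/cid-/all_sig[S Sprop] := (fun y => adapted_stay X_indep X_exp h0 (aD y)).
have /(_ _)/cid-/all_sig[Q Qprop] :=
  (fun cy : clock k * pattern k => adapted_ring X_indep X_exp cy.1 h0 (aD cy.2)).
pose pre := [set cy : clock k * pattern k | jump cy.1 cy.2 = y'].
pose F (o : option (clock k * pattern k)) := if o is Some cy then Q cy else S y'.
pose J := [set o : option (clock k * pattern k) | if o is Some cy then pre cy else True].
pose U := \bigcup_o (if o \in J then F o else set0).
have aF o : adapted (u + h) (F o).
  by case: o => [cy|] /=; [case: (Qprop cy)|case: (Sprop y')].
have aU : adapted (u + h) U.
  by apply: adapted_bigcup => o; case: ifP => _; [exact: aF|exact: adapted_set0].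
have FW o w : good w -> F o w -> exists n, [/\ window n u w,
    window (if o is Some cy then incr cy.1 n else n) (u + h) w, H w &
    Y u w = if o is Some cy then cy.2 else y'].
  move=> gw; case: o => [cy|] /=.
    have [_ _ Qw] := Qprop cy => /Qw[Dw [n wn wn']].
    by have [_ _ /(_ w gw Dw)[Hw yw]] := Dprop cy.2; exists n.
  have [_ _ Sw] := Sprop y' => /Sw[Dw [n wn wn']].
  by have [_ _ /(_ w gw Dw)[Hw yw]] := Dprop y'; exists n.
have FY o w : J o -> good w -> F o w -> H w /\ Y (u + h) w = y'.
  move=> Jo gw /(FW _ _ gw)[n [wn wn' Hw yw]]; split=> //.
  case: o Jo wn' yw => [cy|] Jo wn' yw.
    by rewrite (path_ring gw u0 h0 wn wn') yw.
  by rewrite (path_stay gw u0 h0 wn wn') yw.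
exists U; split=> //; last first.
  by move=> w gw [i _]; case: ifP => // /set_mem Jo Fw; exact: FY Fw.
apply: (@le_trans _ _ (\esum_(o in J) P (F o))); last first.
  apply: esum_measure_le.
  - by move=> o _; exact: adapted_measurable (aF o).
  - exact: adapted_measurable aU.
  - move=> a a' w _ _ gw /(FW _ _ gw)[n [wn wn' _ yw]] /(FW _ _ gw)[m [wm wm' _ yw']].
    rewrite -(window_disjoint wn wm) in wm'; have e := window_disjoint wn' wm'.
    case: a a' e yw yw' {wn' wm'} => [[c z]|] [[c' z']|] //= e ->.
    + by move=> ->; rewrite (incr_inj_clock e).
    + by have := incr_neq e.
    + by have := incr_neq (esym e).
  - by move=> o w Jo gw Fw; exists o => //; rewrite mem_set.
have -> : \esum_(o in J) P (F o) = P (S y') + \esum_(cy in pre) P (Q cy).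
  rewrite (esumID [set None])//; congr (_ + _).
    by rewrite (_ : _ `&` _ = [set None]) ?esum_set1//; apply/seteqP; split=> [a []|a ->].
  rewrite -(esum_image pre Some (fun o => P (F o))); last by move=> a b _ _ [].
  congr (\esum_(o in _) _); apply/seteqP; split=> [[cy|]|_ [cy pcy <-]]//=.
  - by move=> [pcy _]; exists cy.
  - by move=> [].
rewrite ge0_muleDr//; last first.
  by apply: mule_ge0; [rewrite lee_fin subr_ge0 expR_le1 oppr_le0|apply: esum_ge0].
apply: leeD.
  have [_ le_S _] := Sprop y'; apply: le_trans le_S.
  by rewrite lee_wpmul2l ?lee_fin ?expR_ge0//; case: (Dprop y').
rewrite muleA -EFinM -esumZl//; last first.
  by rewrite mulr_ge0 ?expR_ge0// subr_ge0 expR_le1 oppr_le0.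
apply: le_esum => cy _; have [_ le_Q _] := Qprop cy; apply: le_trans le_Q.
rewrite mulrC lee_wpmul2l ?lee_fin//; last by case: (Dprop cy.2).
by rewrite mulr_ge0 ?expR_ge0// subr_ge0 expR_le1 oppr_le0.
Qed.

Lemma feasible_measure u H v (A : set (pattern k)) (G : set T) :
  feasible u H v -> measurable G ->
  (forall w, good w -> H w -> A (Y u w) -> G w) ->
  \esum_(y in A) v y <= P G.
Proof.
move=> /(_ _)/cid-/all_sig[D Dprop] mG HG.
apply: (@le_trans _ _ (\esum_(y in A) P (D y))).
  by apply: le_esum => y _; case: (Dprop y).
apply: esum_measure_le => //.
- by move=> y _; have [aD _ _] := Dprop y; exact: adapted_measurable aD.
- move=> y y' w _ _ gw Dw Dw'.
  have [_ _ /(_ w gw Dw)[_ <-]] := Dprop y.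
  by have [_ _ /(_ w gw Dw')[_ <-]] := Dprop y'.
- move=> y w Ay gw Dw; have [_ _ /(_ w gw Dw)[Hw yw]] := Dprop y.
  by apply: HG => //; rewrite yw.
Qed.

End Feasible.

(** * Patterns as arrays of integers *)

Definition rowlen (i : nat) : nat := (i.+1)./2.
Arguments rowlen : simpl never.

Definition in_triangle (k i j : nat) : bool := (i <= k)%N && (0 < j <= rowlen i)%N.

Definition pattern_of (k : nat) (F : nat -> nat -> int) : pattern k :=
  [ffun p => F (prow p) (pcol p)].

Section Positions.
Variable k : nat.
Implicit Types (y : pattern k) (i j : nat) (p : particle k).

Lemma particle_in_triangle p : in_triangle k (prow p) (pcol p).
Proof. by rewrite /in_triangle -ltnS !ltn_ord. Qed.

Lemma particle_inj p p' : prow p = prow p' -> pcol p = pcol p' -> p = p'.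
Proof.
case: p p' => [i j] [i' j']; rewrite /prow /pcol /= => /ord_inj ii'.
by case: i' / ii' j' => j' [/ord_inj ->].
Qed.

Lemma pos_particle y p : pos y (prow p) (pcol p) = y p.
Proof.
rewrite /pos; case: pickP => [p' /andP[/eqP h1 /eqP h2]|/(_ p)].
  by rewrite /= (particle_inj h1 h2).
by rewrite !eqxx.
Qed.

Lemma in_triangleP i j : in_triangle k i j ->
  exists p, prow p = i /\ pcol p = j.
Proof.
case: j => [|j]; first by rewrite /in_triangle andbF.
move=> /andP[ik /= jr].
have ik' : (i < k.+1)%N by [].
by exists (Tagged (fun i : 'I_k.+1 => 'I_((i : nat).+1)./2) (Ordinal jr : 'I_(((Ordinal ik') : nat).+1)./2)).
Qed.

Lemma pos_out y i j : ~~ in_triangle k i j -> pos y i j = 0.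
Proof.
move=> nt; rewrite /pos; case: pickP => // p /andP[/eqP pi /eqP pj].
by move: nt; rewrite -pi -pj particle_in_triangle.
Qed.

Lemma pos_pattern_of F i j :
  pos (pattern_of k F) i j = if in_triangle k i j then F i j else 0.
Proof.
case: ifP => [/in_triangleP[p [<- <-]]|/negbT]; last exact: pos_out.
by rewrite pos_particle ffunE.
Qed.

Lemma pos_inj y y' : (forall i j, in_triangle k i j -> pos y i j = pos y' i j) -> y = y'.
Proof.
move=> h; apply/ffunP => p.
by rewrite -!pos_particle h// particle_in_triangle.
Qed.

Lemma pos_moved y S e i j :
  pos (moved y S e) i j = pos y i j + (if in_triangle k i j && S i j then e else 0).
Proof.
have -> : moved y S e = pattern_of k (fun i j => if S i j then pos y i j + e else pos y i j).
  by apply/ffunP => p; rewrite !ffunE pos_particle.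
rewrite pos_pattern_of; case: ifP => [_|/negbT/pos_out ->] /=; last by rewrite addr0.
by case: ifP; rewrite ?addr0.
Qed.

End Positions.

(** [interl n x y] is the interlacing of a row [x] of length [n] with the next
    row; entries are numbered from 1 and vanish outside of the row, which
    makes it cover both parities of the row number. *)
Definition interl (n : nat) (x y : nat -> int) : Prop :=
  forall j, (0 < j <= n)%N -> x j <= y j /\ y j.+1 <= x j.

(** The state space of the process, see [GT_nonneg]; rows that interlace in this
    sense are automatically decreasing, see [chamber_row]. *)
Definition nonneg_pattern (k : nat) (y : pattern k) : Prop :=
  (forall i j, 0 <= pos y i j) /\
  (forall i, (i < k)%N -> interl (rowlen i) (pos y i) (pos y i.+1)).

Lemma rowlenS i : (rowlen i <= rowlen i.+1 <= (rowlen i).+1)%N.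
Proof. rewrite /rowlen; lia. Qed.

Section Moves.
Variable k : nat.
Implicit Types (y : pattern k) (i j : nat).

Lemma pos_col_le y i m j : nonneg_pattern y -> (0 < j <= rowlen i)%N ->
  (i + m <= k)%N -> pos y i j <= pos y (i + m) j.
Proof.
move=> [_ hy] j_in; elim: m => [|m ih] im; first by rewrite addn0.
rewrite addnS in im *; apply: le_trans (ih (ltnW im)) _.
have j_in' : (0 < j <= rowlen (i + m))%N.
  by case/andP: j_in => -> /= /leq_trans; apply; rewrite /rowlen; lia.
by have [] := hy _ im _ j_in'.
Qed.

Lemma pos_diag_le y i m j : nonneg_pattern y -> (0 < j)%N ->
  (i + m <= k)%N -> (j + m <= rowlen (i + m))%N -> pos y (i + m) (j + m) <= pos y i j.
Proof.
move=> [_ hy] j0; elim: m => [|m ih] im jm; first by rewrite !addn0.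
rewrite !addnS in im jm *.
have jm' : (j + m <= rowlen (i + m))%N by move: jm; rewrite /rowlen; lia.
apply: le_trans (ih (ltnW im) jm').
have jm_in : (0 < j + m <= rowlen (i + m))%N by rewrite jm' addn_gt0 j0.
by have [_] := hy _ im _ jm_in.
Qed.

Definition blocked_right (y : pattern k) i j : bool :=
  [&& (2 <= i)%N, (2 <= j)%N & pos y i j == pos y i.-1 j.-1].

(** A block of particles that move together is described by its last particle;
    monotonicity turns this into a condition on the position of each particle. *)
Lemma run_length (ok : pred nat) (g : nat -> int) m :
  ok 0%N -> (forall m, ok m -> (m <= k)%N) ->
  (forall m m', ok m' -> (m <= m')%N -> g m <= g m') -> ok m ->
  (m <= \max_(m' < k.+1 | ok m' && (g m' == g 0%N)) m')%N = (g m == g 0%N).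
Proof.
move=> ok0 okk mono okm; apply/idP/idP => [le_m|e].
  have [m' /andP[om' /eqP em'] lm'] :
      {m' : 'I_k.+1 | ok m' && (g m' == g 0%N) & (\max_(m' < k.+1 | ok m' && (g m' == g 0%N)) m' = m')%N}.
    by apply: eq_bigmax_cond; apply/card_gt0P; exists ord0; rewrite unfold_in/= ok0 eqxx.
  rewrite lm' in le_m; rewrite eq_le (mono 0%N m)// andbT -em'.
  exact: mono.
have mk : (m < k.+1)%N by rewrite ltnS okk.
by apply: (@leq_bigmax_cond _ _ (fun m : 'I_k.+1 => nat_of_ord m) (Ordinal mk)); rewrite /= okm.
Qed.

(** Since columns increase with the row number, the particles that are pushed
    are exactly those of the column that sit at the same position. *)
Lemma pos_try_right y i j i' j' : nonneg_pattern y -> in_triangle k i j ->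
  pos (try_right y i j) i' j' =
  pos y i' j' + (if [&& ~~ blocked_right y i j, in_triangle k i' j', (i <= i')%N,
                       j' == j & pos y i' j' == pos y i j] then 1 else 0).
Proof.
move=> py /andP[ik j_in]; rewrite /try_right -/(blocked_right y i j).
case: ifP => bl /=; first by rewrite addr0.
rewrite pos_moved; congr (_ + _); congr (if _ then _ else _).
case tri : (in_triangle k i' j') => //=.
have [->|_] := eqVneq j' j; last by rewrite /= !andbF.
rewrite andbT; case ii' : (i <= i')%N => //=.
move/andP: tri => [ik' _].
have := @run_length (fun m => i + m <= k)%N (fun m => pos y (i + m) j) (i' - i).
rewrite addn0 subnKC// leq_subLR => -> //; first by move=> m; lia.
move=> m m' im' mm'; rewrite -(subnKC mm') addnA; apply: pos_col_le => //.
  by case/andP: j_in => -> /= /leq_trans; apply; rewrite /rowlen; lia.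
by rewrite -addnA subnKC.
Qed.

(** Likewise along diagonals, which decrease with the row number. *)
Lemma pos_try_left y i j i' j' : nonneg_pattern y -> in_triangle k i j ->
  ~~ wall i j ->
  pos (try_left y i j) i' j' =
  pos y i' j' - (if [&& pos y i j != pos y i.-1 j, in_triangle k i' j', (i <= i')%N,
                       j' == (j + (i' - i))%N & pos y i' j' == pos y i j] then 1 else 0).
Proof.
move=> py /andP[ik j_in]; rewrite /try_left => /negbTE ->.
case: ifP => bl /=; first by rewrite subr0.
rewrite pos_moved; congr (_ + _).
set c := (in_triangle k i' j' && _); set c' := [&& in_triangle k i' j', _, _ & _].
suff -> : c = c' by case: c'; rewrite ?oppr0.
rewrite /c /c'; case tri : (in_triangle k i' j') => //=.
have [jj'|_] := eqVneq j' (j + (i' - i))%N; last by rewrite /= !andbF.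
rewrite andbT; case ii' : (i <= i')%N => //=.
move/andP: tri => [ik' /andP[_ j'r]]; have /andP[j0 jr] := j_in.
have := @run_length (fun m => (i + m <= k) && (j + m <= rowlen (i + m)))%N
  (fun m => - pos y (i + m) (j + m)) (i' - i).
rewrite !addn0 subnKC// -jj' leq_subLR eqr_opp.
rewrite (eq_bigl (fun m : 'I_k.+1 =>
  (i + m <= k)%N && (j + m <= rowlen (i + m))%N && (- pos y (i + m) (j + m) == - pos y i j))).
  move=> -> //; first by rewrite ik.
  - by move=> m; lia.
  - move=> m m' /andP[im' jm'] mm'; rewrite lerN2 -(subnKC mm') !addnA.
    by apply: pos_diag_le; rewrite // -?addnA ?subnKC// addn_gt0 j0.
  - by rewrite ik'.
by move=> m; rewrite eqr_opp andbA.
Qed.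

End Moves.

Section Stability.
Variable k : nat.
Implicit Types (y : pattern k) (i j : nat).

Lemma pos_wall_left y i j i' j' : wall i j -> pos y i j != 0 ->
  pos (try_left y i j) i' j' =
  pos y i' j' - (if [&& in_triangle k i' j', i' == i & j' == j] then 1 else 0).
Proof.
move=> w /negbTE y0; rewrite /try_left w y0 pos_moved; congr (_ + _).
by case: ifP => // _; rewrite oppr0.
Qed.

Lemma wallE i j : wall i j = odd i && (j == rowlen i).
Proof. by []. Qed.

Lemma try_right_nonneg y i j : nonneg_pattern y -> in_triangle k i j ->
  nonneg_pattern (try_right y i j).
Proof.
move=> py tij; have [y0 hy] := py; have /andP[ik /andP[j0 jr]] := tij.
have E := pos_try_right _ _ py tij.
split=> [i' j'|i' i'k j' /andP[j'0 j'r]].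
  by rewrite E addr_ge0//; case: ifP.
have j'in : (0 < j' <= rowlen i')%N by rewrite j'0.
have [h1 h2] := hy i' i'k j' j'in.
rewrite !E; case bl : (blocked_right y i j) => /=; first by rewrite !addr0.
have t' : in_triangle k i' j' by rewrite /in_triangle j'0 j'r (ltnW i'k).
have t1 : in_triangle k i'.+1 j'.
  by rewrite /in_triangle j'0 i'k/= (leq_trans j'r)//; case/andP: (rowlenS i').
rewrite t' t1 /=; split.
  have [jj|_] := eqVneq j' j; last by rewrite !andbF !addr0.
  rewrite jj in h1 *.
  case ii : (i <= i')%N => /=; last by rewrite addr0; case: ifP; lia.
  rewrite (leqW ii) /=; case: eqP => [e|_]; last by case: ifP; lia.
  case: eqP => [//|e']; first by lia.
  by rewrite addr0; move: h1; lia.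
case: ifP => [/and4P[t2 ii /eqP jj /eqP e]|_]; last by case: ifP; lia.
suff lt_e : pos y i j < pos y i' j' by rewrite e; case: ifP; lia.
have j2 : (2 <= j)%N by rewrite -jj ltnS.
have i2 : (2 <= i)%N by move: jr j2; rewrite /rowlen; lia.
have lt_prev : pos y i j < pos y i.-1 j.-1.
  have i1k : (i.-1 < k)%N by lia.
  have j1r : (0 < j.-1 <= rowlen i.-1)%N by move: jr j2; rewrite /rowlen; lia.
  have [_] := hy _ i1k _ j1r; rewrite (ltn_predK i2) (ltn_predK j2).
  by move: bl; rewrite /blocked_right i2 j2/= => /negbT; lia.
apply: lt_le_trans lt_prev _; rewrite -jj /=.
have -> : i' = (i.-1 + (i' - i.-1))%N by lia.
apply: pos_col_le => //; last by lia.
by move: jr j2; rewrite -jj /rowlen; lia.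
Qed.

Lemma try_left_nonneg y i j : nonneg_pattern y -> in_triangle k i j ->
  nonneg_pattern (try_left y i j).
Proof.
move=> py tij; have [y0 hy] := py; have /andP[ik /andP[j0 jr]] := tij.
have [w|nw] := boolP (wall i j).
  have [z|nz] := eqVneq (pos y i j) 0.
    by rewrite /try_left w z eqxx; exact: try_right_nonneg.
  have E := fun i' j' => pos_wall_left i' j' w nz.
  move: w; rewrite wallE => /andP[oi /eqP jE].
  split=> [i' j'|i' i'k j' /andP[j'0 j'r]].
    rewrite E; case: ifP => [/and3P[_ /eqP -> /eqP ->]|_]; last by rewrite subr0.
    by have := y0 i j; lia.
  have j'in : (0 < j' <= rowlen i')%N by rewrite j'0.
have [h1 h2] := hy i' i'k j' j'in.
  rewrite !E; split.
    have -> : [&& in_triangle k i'.+1 j', i'.+1 == i & j' == j] = false.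
      apply/negP => /and3P[_ /eqP ei /eqP ej].
      by move: j'r jE; rewrite ej -ei /rowlen; lia.
    by case: ifP; lia.
  case: (ifP [&& in_triangle k i' j', _ & _]) => [/and3P[_ /eqP ei /eqP ej]|_]; last first.
    by case: ifP; lia.
  have -> : pos y i'.+1 j'.+1 = 0.
    by apply: pos_out; rewrite /in_triangle; move: oi jE; rewrite ei ej /rowlen; lia.
  by rewrite ei ej; have := y0 i j; case: ifP; lia.
have E := fun i' j' => pos_try_left i' j' py tij nw.
have i2 : (2 <= i)%N by move: jr j0 nw; rewrite wallE /rowlen; lia.
have j1r : (0 < j <= rowlen i.-1)%N.
  by move: jr j0 nw; rewrite wallE /rowlen; lia.
have i1k : (i.-1 < k)%N by lia.
have le_prev : pos y i.-1 j <= pos y i j.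
  by have [] := hy _ i1k _ j1r; rewrite prednK// ltnW.
have [bl|nbl] := eqVneq (pos y i j) (pos y i.-1 j).
  have -> : try_left y i j = y by rewrite /try_left (negbTE nw) bl eqxx.
  exact: py.
rewrite nbl in E.
have lt_prev : pos y i.-1 j < pos y i j by lia.
have pos1 : 0 < pos y i j by apply: le_lt_trans lt_prev.
split=> [i' j'|i' i'k j' /andP[j'0 j'r]].
  rewrite E; case: ifP => [/and5P[_ _ _ _ /eqP ->]|_]; first by lia.
  by rewrite subr0.
have j'in : (0 < j' <= rowlen i')%N by rewrite j'0.
have [h1 h2] := hy i' i'k j' j'in.
have t' : in_triangle k i' j' by rewrite /in_triangle j'0 j'r (ltnW i'k).
rewrite !E; split.
  case: (ifP [&& _, in_triangle k i'.+1 j', _, _ & _]) => [/and5P[_ t1 ii /eqP jj /eqP e]|_]; last first.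
    by case: ifP; lia.
  suff : pos y i' j' < pos y i j by rewrite e; case: ifP; lia.
  apply: le_lt_trans lt_prev.
  have -> : i' = (i.-1 + (i'.+1 - i))%N by lia.
  rewrite jj; apply: pos_diag_le => //; first by lia.
  have <- : i' = (i.-1 + (i'.+1 - i))%N by lia.
  by rewrite -jj.
case: (ifP [&& _, in_triangle k i' j', _, _ & _]) => [/and5P[_ _ ii /eqP jj /eqP e]|_]; last first.
  by case: ifP; lia.
case t2 : (in_triangle k i'.+1 j'.+1); last first.
  by rewrite /= subr0 pos_out ?t2// e; lia.
rewrite (leqW ii) /= jj subSn// addnS eqxx /=.
by case: eqP; rewrite -?jj; lia.
Qed.

Lemma jump_nonneg (c : clock k) y : nonneg_pattern y -> nonneg_pattern (jump c y).
Proof.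
move=> py; rewrite /jump; case: ifP => _.
  by apply: try_right_nonneg => //; exact: particle_in_triangle.
by apply: try_left_nonneg => //; exact: particle_in_triangle.
Qed.

End Stability.

(** * Adding a row to a pattern *)

Definition row := nat -> int.

Definition in_row (n j : nat) : bool := (0 < j <= n)%N.

Definition row_of_length (n : nat) (x : row) : Prop := forall j, ~~ in_row n j -> x j = 0.

Lemma row_neq (x x' : row) i : x i != x' i -> `[< x = x' >] = false.
Proof. by move=> ne; apply/asboolP => e; move: ne; rewrite e eqxx. Qed.

Definition shift (x : row) (j : nat) (e : int) : row :=
  fun j' => x j' + (if j' == j then e else 0).

(** The new position of the row of length [n] above a row that went from [x]
    to [x'], when it does not move on its own. *)
Definition push (n : nat) (x x' z : row) : row := fun j =>
  z j + (if [&& in_row n j, x' j == x j + 1 & z j == x j] then 1 else 0)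
      - (if [&& in_row n j, (1 < j)%N, x' j.-1 == x j.-1 - 1 & z j == x j.-1] then 1 else 0).

(** The jumps of the particles of row [k.+1], at [z], above a row at [x]: they
    do not affect the lower rows. *)
Definition row_right (x z : row) (j : nat) : row :=
  if (1 < j)%N && (z j == x j.-1) then z else shift z j 1.

Definition row_left (k : nat) (x z : row) (j : nat) : row :=
  if wall k.+1 j then (if z j == 0 then row_right x z j else shift z j (-1))
  else if z j == x j then z else shift z j (-1).

Definition row_moves (k : nat) (x z z' : row) : nat :=
  (\sum_(j < rowlen k.+1)
     (`[< row_right x z j.+1 = z' >] + `[< row_left k x z j.+1 = z' >]))%N.

Definition moves (k i : nat) (y y' : pattern k) : nat :=
  (\sum_(j < rowlen i) ((try_right y i j.+1 == y') + (try_left y i j.+1 == y')))%N.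

Definition jumps (k : nat) (y y' : pattern k) : nat :=
  (\sum_(i < k.+1) moves i y y')%N.

Lemma jumpsE k (y y' : pattern k) :
  jumps y y' = (\sum_(c : clock k) (jump c y == y'))%N.
Proof.
rewrite (eq_bigr (fun c : clock k => (jump (c.1, c.2) y == y') : nat)); last by case.
rewrite -(pair_bigA _ (fun p b => (jump ((p, b) : clock k) y == y') : nat))/=.
rewrite /jumps /moves.
rewrite (eq_bigr (fun p : particle k =>
   ((try_right y (prow p) (pcol p) == y') + (try_left y (prow p) (pcol p) == y'))%N)); last first.
  by move=> p _; rewrite /index_enum !unlock /= /jump/= addn0.
rewrite (sig_big_dep (fun i : 'I_k.+1 => true) (fun i (j : 'I_((i : nat).+1)./2) => true)
  (fun i (j : 'I_((i : nat).+1)./2) => ((try_right y i j.+1 == y') + (try_left y i j.+1 == y'))%N)).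
by apply: eq_bigr => -[i j].
Qed.

Lemma pos_row_of_length k (y : pattern k) i : row_of_length (rowlen i) (pos y i).
Proof. by move=> j nj; rewrite pos_out// /in_triangle negb_and nj orbT. Qed.

Section AddRow.
Variable k : nat.
Implicit Types (y : pattern k) (z : row).
Let n := rowlen k.+1.

Definition add_row (z : row) y : pattern k.+1 :=
  pattern_of k.+1 (fun i j => if i == k.+1 then z j else pos y i j).

Definition drop_row (y : pattern k.+1) : pattern k := pattern_of k (pos y).

Lemma pos_add_row z y i j : (i <= k)%N -> pos (add_row z y) i j = pos y i j.
Proof.
move=> ik; rewrite pos_pattern_of (ltn_eqF (ik : (i < k.+1)%N)).
case: ifP => // /negbT nt; rewrite pos_out//; apply: contra nt.
by move=> /andP[_ jr]; rewrite /in_triangle (leqW ik).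
Qed.

Lemma pos_add_row_top z y : row_of_length n z -> pos (add_row z y) k.+1 = z.
Proof.
move=> zn; apply/funext => j; rewrite pos_pattern_of eqxx /in_triangle leqnn /=.
by case: ifP => // /negbT/zn.
Qed.

Lemma drop_rowK (y : pattern k.+1) : add_row (pos y k.+1) (drop_row y) = y.
Proof.
apply: pos_inj => i j /andP[ik jr].
have [->|ne] := eqVneq i k.+1; first by rewrite pos_add_row_top//; exact: pos_row_of_length.
have ik' : (i <= k)%N by rewrite -ltnS ltn_neqAle ne.
by rewrite pos_add_row// pos_pattern_of /in_triangle ik' jr.
Qed.

Lemma add_rowK z y : drop_row (add_row z y) = y.
Proof.
by apply: pos_inj => i j /[dup] t /andP[ik _]; rewrite pos_pattern_of t pos_add_row.
Qed.

Lemma add_row_eq z z' y y' : row_of_length n z -> row_of_length n z' ->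
  (add_row z y == add_row z' y') = (y == y') && `[< z = z' >].
Proof.
move=> zn zn'; apply/eqP/andP => [e|[/eqP -> /asboolP ->//]]; split.
  by apply/eqP; rewrite -(add_rowK z y) e add_rowK.
by apply/asboolP; rewrite -(pos_add_row_top y zn) e pos_add_row_top.
Qed.

Lemma add_rowP z y (y1 : pattern k.+1) : row_of_length n z ->
  (forall i j, (i <= k)%N -> pos y1 i j = pos y i j) ->
  (forall j, (0 < j <= rowlen k.+1)%N -> pos y1 k.+1 j = z j) -> y1 = add_row z y.
Proof.
move=> zn low top; apply: pos_inj => i j /andP[ik jr].
have [e|ne] := eqVneq i k.+1; first by rewrite e in jr *; rewrite pos_add_row_top// top.
have ik' : (i <= k)%N by rewrite -ltnS ltn_neqAle ne.
by rewrite low// pos_add_row.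
Qed.

Lemma nonneg_add_row z y : row_of_length n z ->
  nonneg_pattern (add_row z y) <->
  [/\ nonneg_pattern y, forall j, 0 <= z j & interl (rowlen k) (pos y k) z].
Proof.
move=> zn; have top := pos_add_row_top y zn.
have low i : (i <= k)%N -> pos (add_row z y) i = pos y i.
  by move=> ik; apply/funext => j; rewrite pos_add_row.
split=> [[p0 hp]|[[y0 hy] z0 zi]].
  split; last by have := hp k (ltnSn k); rewrite top low.
    split=> [i j|i ik]; last by have := hp i (ltnW ik); rewrite !low// ltnW.
    have [ik|ki] := leqP i k; first by rewrite -low.
    by rewrite pos_out// /in_triangle leqNgt ki.
  by move=> j; rewrite -top.
split=> [i j|i]; last first.
  rewrite ltnS leq_eqVlt => /orP[/eqP ->|ik]; first by rewrite top low.
  by rewrite !low// ?(ltnW ik)//; exact: hy.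
have [ik|ki] := leqP i k; first by rewrite low.
have [->|ne] := eqVneq i k.+1; first by rewrite top.
by rewrite pos_out// /in_triangle; move: ki ne; lia.
Qed.

Lemma shift_length (l : nat) z j e : in_row l j -> row_of_length l z ->
  row_of_length l (shift z j e).
Proof.
move=> jn zn j' nj'; rewrite /shift zn// add0r; case: eqP => // jj.
by move: nj'; rewrite jj jn.
Qed.

Lemma push_length x x' z : row_of_length n z -> row_of_length n (push n x x' z).
Proof. by move=> zn j nj; rewrite /push (negbTE nj)/= addr0 subr0 zn. Qed.

Lemma row_right_length x z j : in_row n j -> row_of_length n z ->
  row_of_length n (row_right x z j).
Proof. by move=> jn zn; rewrite /row_right; case: ifP => // _; exact: shift_length. Qed.

Lemma row_left_length x z j : in_row n j -> row_of_length n z ->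
  row_of_length n (row_left k x z j).
Proof.
move=> jn zn; rewrite /row_left.
case: ifP => _; case: ifP => // _; try exact: shift_length.
exact: row_right_length.
Qed.

Section Low.
Variables (z : row) (y : pattern k).
Hypothesis zn : row_of_length n z.
Hypothesis yz : nonneg_pattern (add_row z y).

Let y_nonneg : nonneg_pattern y. Proof. by have [] := (nonneg_add_row y zn).1 yz. Qed.

Let low i j : (i <= k)%N -> pos (add_row z y) i j = pos y i j.
Proof. exact: pos_add_row. Qed.

Let top j : pos (add_row z y) k.+1 j = z j.
Proof. by rewrite pos_add_row_top. Qed.

Let triangleS i j : in_triangle k i j -> in_triangle k.+1 i j.
Proof. by move=> /andP[ik jr]; rewrite /in_triangle (leqW ik). Qed.

Let triangle_low i j : (i <= k)%N -> in_triangle k.+1 i j = in_triangle k i j.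
Proof. by move=> ik; rewrite /in_triangle ik (leqW ik). Qed.

(** A jump in the lower rows reaches the top row only through the move of the
    row just below it. *)
Lemma try_right_add_row i j : in_triangle k i j ->
  try_right (add_row z y) i j =
  add_row (push n (pos y k) (pos (try_right y i j) k) z) (try_right y i j).
Proof.
move=> tij; have /andP[ik jr] := tij.
have E' := pos_try_right _ _ yz (triangleS tij).
have E := pos_try_right _ _ y_nonneg tij.
have bl : blocked_right (add_row z y) i j = blocked_right y i j.
  by rewrite /blocked_right !low//; lia.
apply: add_rowP => [|i' j' i'k|j' jr']; first exact: push_length.
  by rewrite E' bl (low j ik) (low j' i'k) E triangle_low.
rewrite E' bl (low j ik) top.
rewrite /push /in_row jr' /in_triangle leqnn jr' (leqW ik) /= !E.
rewrite -addrA; congr (_ + _).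
rewrite [X in _ - X](_ : _ = 0) ?subr0; last first.
  by case: ifP => // /and3P[_ h _]; move: h; case: ifP => _; lia.
congr (if _ then _ else _).
have tk : in_row (rowlen k) j.
  by move: jr; rewrite /in_row /rowlen; lia.
have jle1 : pos y i j <= pos y k j.
  by have := pos_col_le (m := k - i) y_nonneg jr; rewrite subnKC//; apply.
have jle2 : pos y k j <= z j.
  by have [_ _ /(_ j tk)[]] := (nonneg_add_row y zn).1 yz.
case: (blocked_right y i j) => /=.
  by rewrite ?andbF addr0 (_ : (_ == _ + 1) = false)//; lia.
have [->|_] /= := eqVneq j' j; last first.
  by rewrite ?andbF addr0 (_ : (_ == _ + 1) = false)//; lia.
have tkk : in_triangle k k j by rewrite /in_triangle leqnn.
rewrite ik tkk /=.
case: (eqVneq (pos y k j) (pos y i j)) => [->|ne].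
  by rewrite eqxx.
rewrite addr0; apply/eqP/andP => [|[]]; first by lia.
by move=> /eqP; lia.
Qed.

Lemma try_left_add_row i j : in_triangle k i j ->
  try_left (add_row z y) i j =
  add_row (push n (pos y k) (pos (try_left y i j) k) z) (try_left y i j).
Proof.
move=> tij; have /andP[ik jr] := tij; have /andP[j0 jri] := jr.
have [w|nw] := boolP (wall i j).
  have [e0|ne0] := eqVneq (pos y i j) 0.
    rewrite (_ : try_left y i j = try_right y i j); last by rewrite /try_left w e0 eqxx.
    by rewrite /try_left w low// e0 eqxx; exact: try_right_add_row.
  have E := fun i' j' => pos_wall_left i' j' w ne0.
  have E' i' j' := @pos_wall_left _ (add_row z y) i j i' j' w.
  rewrite low// in E'.
  apply: add_rowP => [|i' j' i'k|j' jr']; first exact: push_length.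
    by rewrite (E' _ _ ne0) (low j' i'k) E triangle_low.
  rewrite (E' _ _ ne0) top.
  rewrite /push !E; have -> : (k.+1 == i) = false by lia.
  rewrite andbF subr0.
  rewrite (_ : [&& _, _ - _ == _ & _] = false) ?addr0; last first.
    by apply/negP => /and3P[_ h _]; move: h; case: ifP => _; lia.
  rewrite (_ : [&& _, _ & _] = false) ?subr0//.
  apply/negP => /and4P[_ j1 h _]; move: h; case: ifP => [/and3P[_ /eqP ki /eqP jj]|_]; last by lia.
  by move: w jr'; rewrite wallE -ki /rowlen; lia.
have E' := pos_try_left _ _ yz (triangleS tij) nw.
have E := pos_try_left _ _ y_nonneg tij nw.
have i1k : (i.-1 <= k)%N by lia.
apply: add_rowP => [|i' j' i'k|j' jr']; first exact: push_length.
  by rewrite E' (low j ik) (low j i1k) (low j' i'k) E triangle_low.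
rewrite E' (low j ik) (low j i1k) top.
rewrite /push /in_row jr' /in_triangle leqnn jr' (leqW ik) /= !E.
rewrite [X in _ + X - _](_ : _ = 0) ?addr0; last first.
  by case: ifP => // /andP[h _]; move: h; case: ifP => _; lia.
congr (_ - _); congr (if _ then _ else _).
case: (pos y i j != pos y i.-1 j) => /=; last first.
  by rewrite subr0; case: (1 < j')%N => //=; case: eqP => //; lia.
rewrite ik /=.
have [jj|jj] := eqVneq j' (j + (k.+1 - i))%N; last first.
  rewrite /=; symmetry; apply/negP => /and3P[j1 h _]; move: h.
  have -> : (j'.-1 == (j + (k - i))%N) = false by move: jj; lia.
  by rewrite /= ?andbF; lia.
have jj1 : j'.-1 = (j + (k - i))%N by lia.
have j1 : (1 < j')%N by lia.
have tk : in_row (rowlen k) j'.-1.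
  by move: jr' (rowlenS k); rewrite /in_row; lia.
have le1 : pos y k j'.-1 <= pos y i j.
  have := @pos_diag_le _ y i (k - i) j y_nonneg j0; rewrite subnKC// -jj1; apply=> //.
  by case/andP: tk.
have le2 : z j' <= pos y k j'.-1.
  have [_ _ /(_ _ tk)[_]] := (nonneg_add_row y zn).1 yz.
  by rewrite (ltn_predK j1).
have tkk : in_triangle k k j'.-1 by rewrite /in_triangle leqnn.
rewrite j1 tkk jj1 eqxx /= -jj1.
case: (eqVneq (pos y k j'.-1) (pos y i j)) => [->|ne].
  by rewrite eqxx.
rewrite subr0; apply/eqP/andP => [|[]]; first by lia.
by move=> /eqP; lia.
Qed.

Lemma try_right_top j : in_row n j ->
  try_right (add_row z y) k.+1 j = add_row (row_right (pos y k) z j) y.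
Proof.
move=> jn; have tj : in_triangle k.+1 k.+1 j by rewrite /in_triangle leqnn.
have E := pos_try_right _ _ yz tj.
have bl : blocked_right (add_row z y) k.+1 j = (1 < j)%N && (z j == pos y k j.-1).
  rewrite /blocked_right top /= low//; case j1 : (1 < j)%N => //=; rewrite ?andbF//.
  by move: jn j1; rewrite /in_row /n /rowlen; lia.
apply: add_rowP => [|i' j' i'k|j' jr']; first exact: row_right_length.
  by rewrite E bl top (low j' i'k) (ltnNge k) i'k !andbF addr0.
rewrite E bl !top.
rewrite /row_right /in_triangle leqnn jr' /=.
case: ((1 < j)%N && _) => /=; first by rewrite addr0.
by rewrite /shift; have [->|_] := eqVneq j' j; rewrite ?eqxx.
Qed.

Lemma try_left_top j : in_row n j ->
  try_left (add_row z y) k.+1 j = add_row (row_left k (pos y k) z j) y.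
Proof.
move=> jn; have tj : in_triangle k.+1 k.+1 j by rewrite /in_triangle leqnn.
rewrite /row_left; case: ifP => w.
  case: ifP => z0.
    by rewrite -try_right_top// /try_left w top z0.
  have ne0 : pos (add_row z y) k.+1 j != 0 by rewrite top z0.
  apply: add_rowP => [|i' j' i'k|j' jr']; rewrite ?(pos_wall_left _ _ w ne0).
  - exact: shift_length.
  - by rewrite (low j' i'k) (ltn_eqF (i'k : (i' < k.+1)%N)) andbF subr0.
  rewrite top.
  rewrite /shift /in_triangle leqnn jr' /=.
  by rewrite eqxx /=; case: ifP; rewrite ?oppr0.
have E := pos_try_left _ _ yz tj (negbT w).
have tk : in_row (rowlen k) j.
  by move: w jn; rewrite wallE /in_row /n /rowlen; lia.
apply: add_rowP => [|i' j' i'k|j' jr']; first by case: ifP => // _; exact: shift_length.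
  by rewrite E top (low j' i'k) (ltnNge k) i'k !andbF subr0.
rewrite E !top /= (low j (leqnn k)).
rewrite /in_triangle leqnn jr' /= subnn addn0.
case: (z j == pos y k j) => /=; first by rewrite subr0.
by rewrite /shift; have [->|_] := eqVneq j' j; rewrite ?eqxx //= subr0 addr0.
Qed.

(** Either a lower row jumps and the top row is pushed, or the top row jumps. *)
Lemma jumps_add_row z' y' : row_of_length n z' ->
  jumps (add_row z y) (add_row z' y') =
  (`[< push n (pos y k) (pos y' k) z = z' >] * jumps y y' +
   (y == y') * row_moves k (pos y k) z z')%N.
Proof.
move=> zn'; rewrite /jumps big_ord_recr /=; congr addn.
  rewrite big_distrr /=; apply: eq_bigr => i _; rewrite /moves big_distrr /=.
  apply: eq_bigr => j _.
  have tij : in_triangle k i j.+1 by rewrite /in_triangle -ltnS ltn_ord /= ltn_ord.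
  rewrite try_right_add_row// try_left_add_row// !add_row_eq//; try exact: push_length.
  rewrite mulnDr; congr addn.
    by case: eqP => [<-|_]; rewrite ?muln0//= muln1.
  by case: eqP => [<-|_]; rewrite ?muln0//= muln1.
rewrite /moves /row_moves big_distrr /=; apply: eq_bigr => j _.
have jn : in_row n j.+1 by rewrite /in_row /= ltn_ord.
rewrite try_right_top// try_left_top// !add_row_eq//; last 2 first.
- exact: row_left_length.
- exact: row_right_length.
by case: (y == y'); rewrite /= ?mul1n ?mul0n.
Qed.

End Low.
End AddRow.

(** * The identity for two consecutive rows *)

(** The rows of the vectors in [weyl], see [weylE]. *)
Definition chamber (x : row) : Prop :=
  forall j, 0 <= x j /\ ((0 < j)%N -> x j.+1 <= x j).

(** The number of signs that the last entry of an odd row can take. *)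
Definition sign_weight (k : nat) (x : row) : nat :=
  if odd k && (x (rowlen k) != 0) then 2 else 1.

(** The number of clocks whose ring leaves the last row fixed, on the average
    over the patterns above it, up to the correction made in [hold]. *)
Fixpoint hold_const (k : nat) : nat :=
  if k is k'.+1 then (hold_const k' + 2 * rowlen k')%N else 0%N.

(** [hold], [down] and [up] give the weighted number of ways in which a row
    arrives at [x]: from [x] itself, from [x - e_j] and from [x + e_j]. *)
Definition hold (k : nat) (x : row) : nat :=
  (hold_const k - [&& (0 < k)%N, ~~ odd k & x (rowlen k) == 0%R])%N.

Definition down (k : nat) (x : row) (j : nat) : nat :=
  (`[< chamber (shift x j (-1)) >] *
   (if [&& odd k, j == rowlen k & x j == 1%R] then 2 else 1))%N.

Definition up (x : row) (j : nat) : nat := `[< chamber (shift x j 1) >].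

Definition arrivals (k : nat) (f : row -> nat) (x : row) : nat :=
  (hold k x * f x +
   \sum_(j < rowlen k) (down k x j.+1 * f (shift x j.+1 (-1)%R) +
                        up x j.+1 * f (shift x j.+1 1%R)))%N.

(** The configurations [x2] of the lower row that carry [z] to [z'] when the
    lower row becomes [x]. *)
Definition carried (k : nat) (x z z' : row) (x2 : row) : nat :=
  (`[< interl (rowlen k) x2 z >] * sign_weight k x2 *
   `[< push (rowlen k.+1) x2 x z = z' >])%N.

(** For a configuration [x], [z'] of two consecutive rows, the three identities
    [arrivals_hold], [arrivals_from_right] and [arrivals_from_left] count the
    ways to reach it when the upper row starts from [z'], [z' + e_j] and
    [z' - e_j]. The count includes the moves of the lower row to [x], possibly
    with a push, and those of the upper row; the outcome is the weight of [x]
    times a function of [z'] alone. *)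
Section TwoRows.
Variables (k : nat) (x z' : row).
Local Notation n := (rowlen k.+1).
Local Notation m := (rowlen k).
Hypotheses (xm : row_of_length m x) (zn' : row_of_length n z').
Hypotheses (cx : chamber x) (cz' : chamber z') (xz' : interl m x z').

Let x0 j : 0 <= x j. Proof. by have [] := cx j. Qed.
Let z0' j : 0 <= z' j. Proof. by have [] := cz' j. Qed.
Let m_le_n : (m <= n <= m.+1)%N. Proof. exact: rowlenS. Qed.

Lemma push_id z : push n x x z = z.
Proof.
apply/funext => j; rewrite /push.
have -> : (x j == x j + 1) = false by lia.
have -> : (x j.-1 == x j.-1 - 1) = false by lia.
by rewrite !andbF addr0 subr0.
Qed.

Lemma push_up z j : push n (shift x j (-1)) x z =
  if in_row n j && (z j == x j - 1) then shift z j 1 else z.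
Proof.
apply/funext => i; rewrite /push /shift.
rewrite [X in _ - X](_ : _ = 0) ?subr0; last first.
  by case: ifP => // /and4P[_ _ h _]; move: h; case: (i.-1 == j); lia.
have [->|ne] := eqVneq i j; last first.
  have -> : (x i == x i + 0 + 1) = false by lia.
  by rewrite andbF addr0; case: ifP => // _; rewrite (negbTE ne) addr0.
rewrite subrK eqxx /= addrC.
by case: ifP => _; rewrite ?eqxx ?add0r // addrC.
Qed.

Lemma push_down z j : (0 < j)%N -> push n (shift x j 1) x z =
  if in_row n j.+1 && (z j.+1 == x j + 1) then shift z j.+1 (-1) else z.
Proof.
move=> j0; apply/funext => i; rewrite /push /shift.
rewrite [X in _ + X - _](_ : _ = 0) ?addr0; last first.
  by case: ifP => // /andP[_ /andP[h _]]; move: h; case: (i == j); lia.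
have [->|ne] := eqVneq i j.+1; last first.
  rewrite [X in _ - X](_ : _ = 0) ?subr0; last first.
    case: ifP => // /and4P[_ i1 h _]; move: h.
    have -> : (i.-1 == j) = false by move: ne i1; lia.
    by lia.
  by case: ifP => // _; rewrite (negbTE ne) addr0.
rewrite /= eqxx ltnS j0 /= addrK eqxx /=.
by case: ifP => _; rewrite ?eqxx ?subr0.
Qed.

Lemma shift_eqE (z : row) j e : (shift z j e = z') <->
  z j + e = z' j /\ forall i, i != j -> z i = z' i.
Proof.
split=> [<-|[zj zi]].
  by rewrite /shift eqxx; split=> // i /negbTE ->; rewrite addr0.
apply/funext => i; rewrite /shift; have [->//|ne] := eqVneq i j.
by rewrite addr0 zi.
Qed.

Lemma chamber_below x2 z : chamber z -> row_of_length m x2 -> interl m x2 z ->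
  row_of_length n z -> chamber x2.
Proof.
move=> cz x2m x2z zn j.
have pos2 i : 0 <= x2 i.
  have [im|im] := boolP (in_row m i); last by rewrite x2m.
  by have [_] := x2z i im; have [] := cz i.+1; lia.
split=> // j0; have [jm|jm] := boolP (in_row m j.+1); last by rewrite x2m.
have jm' : in_row m j by move: jm; rewrite /in_row; lia.
have [_ h1] := x2z j jm'; have [h2 _] := x2z _ jm; lia.
Qed.

Lemma interl_shift z j e : in_row m j -> (forall i, in_row m i -> i != j -> x i <= z i /\ z i.+1 <= x i) ->
  interl m (shift x j e) z <-> (x j + e <= z j /\ z j.+1 <= x j + e).
Proof.
move=> jm others; split=> [/(_ j jm)|h i im]; first by rewrite /shift eqxx.
rewrite /shift; have [->//|ne] := eqVneq i j.
by rewrite addr0; exact: others.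
Qed.

Lemma sign_weight_shift j e : in_row m j -> (odd k && (j == m)) = false ->
  sign_weight k (shift x j e) = sign_weight k x.
Proof.
move=> jm; rewrite /sign_weight /shift; case: (odd k) => //= h.
by rewrite (eq_sym m) h addr0.
Qed.

(** Moving the last entry to or from 0 changes the number of signs; the double
    rate of leaving 0 compensates for it. *)
Lemma down_weight j : in_row m j -> 0 < x j -> chamber (shift x j (-1)) ->
  (down k x j * sign_weight k (shift x j (-1)%R) = sign_weight k x)%N.
Proof.
move=> jm xj cj; rewrite /down asboolT// mul1n.
have [/andP[ok /eqP jE]|h] := boolP (odd k && (j == m)); last first.
  have hF : (odd k && (j == m)) = false by exact: negbTE.
  rewrite sign_weight_shift// (_ : [&& _, _ & _] = false) ?mul1n//.
  by rewrite andbA hF.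
rewrite /sign_weight ok jE eqxx /= /shift eqxx -jE.
have -> : x j != 0 by lia.
case: eqP => [->|ne]; first by rewrite subrr eqxx.
by have -> : x j - 1 != 0 by lia.
Qed.

Lemma up_weight j : in_row m j -> chamber (shift x j 1) ->
  (up x j * sign_weight k (shift x j 1%R) =
   sign_weight k x * (if [&& odd k, j == m & x j == 0%R] then 2 else 1))%N.
Proof.
move=> jm cj; rewrite /up asboolT// mul1n.
have [/andP[ok /eqP jE]|h] := boolP (odd k && (j == m)); last first.
  have hF : (odd k && (j == m)) = false by exact: negbTE.
  rewrite sign_weight_shift// (_ : [&& _, _ & _] = false) ?muln1//.
  by rewrite andbA hF.
rewrite /sign_weight ok jE eqxx /= /shift eqxx -jE.
have -> : x j + 1 != 0 by have := x0 j; lia.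
by case: eqP.
Qed.

Lemma carried_hold : carried k x z' z' x = sign_weight k x.
Proof. by rewrite /carried !asboolT ?mul1n ?muln1//; exact: push_id. Qed.

Lemma carried_hold_down j : in_row m j ->
  (down k x j * carried k x z' z' (shift x j (-1)%R) =
   sign_weight k x * (z' j.+1 < x j)%R)%N.
Proof.
move=> jm; have [h1 h2] := xz' jm.
have others i : in_row m i -> i != j -> x i <= z' i /\ z' i.+1 <= x i by move=> im _; exact: xz'.
rewrite /carried push_up (_ : (z' j == x j - 1) = false); last by lia.
rewrite andbF /= (asboolT (erefl z')) muln1.
have iE := interl_shift (z := z') (-1) jm others.
have [lt|ge] := boolP (z' j.+1 < x j); last first.
  rewrite asboolF ?muln0// => /iE; move: ge; lia.
have il : interl m (shift x j (-1)) z' by apply/iE; lia.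
rewrite asboolT// mul1n muln1 down_weight//; first by have := z0' j.+1; lia.
by apply: chamber_below il _ => //; exact: shift_length.
Qed.

Lemma carried_hold_up j : in_row m j ->
  (up x j * carried k x z' z' (shift x j 1%R) =
   sign_weight k x * ((x j < z' j)%R * (if [&& odd k, j == m & x j == 0%R] then 2 else 1)))%N.
Proof.
move=> jm; have [h1 h2] := xz' jm.
have others i : in_row m i -> i != j -> x i <= z' i /\ z' i.+1 <= x i by move=> im _; exact: xz'.
have j0 : (0 < j)%N by case/andP: jm.
rewrite /carried push_down// (_ : (z' j.+1 == x j + 1) = false); last by lia.
rewrite andbF /= (asboolT (erefl z')) muln1.
have iE := interl_shift (z := z') 1 jm others.
have [lt|ge] := boolP (x j < z' j); last first.
  rewrite asboolF ?muln0// => /iE; move: ge; lia.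
have il : interl m (shift x j 1) z' by apply/iE; lia.
rewrite asboolT// !mul1n up_weight//.
by apply: chamber_below il _ => //; exact: shift_length.
Qed.

Lemma row_right_hold j : `[< row_right x z' j = z' >] = (1 < j)%N && (z' j == x j.-1).
Proof.
rewrite /row_right; case: ifP => _; first exact/asboolP.
by apply/asboolP => /shift_eqE[]; lia.
Qed.

Lemma row_left_hold j : `[< row_left k x z' j = z' >] =
  if wall k.+1 j then [&& z' j == 0, (1 < j)%N & z' j == x j.-1] else z' j == x j.
Proof.
rewrite /row_left; case: ifP => _; case: ifP => _ /=.
- exact: row_right_hold.
- by apply/asboolP => /shift_eqE[]; lia.
- exact/asboolP.
- by apply/asboolP => /shift_eqE[]; lia.
Qed.

Lemma sum_lt_eq l (F G : 'I_l -> int) : (forall j, F j <= G j) ->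
  (\sum_j (F j < G j)%R + \sum_j (F j == G j) = l)%N.
Proof.
move=> FG; rewrite -big_split /= (eq_bigr (fun=> 1%N)) ?sum_nat_const ?card_ord ?muln1//.
by move=> j _; move: (FG j); case: ltgtP.
Qed.

(** The sum of the contributions in which the upper row does not move: for each
    [j], either [x - e_j] is admissible or the particle [j + 1] of the upper
    row is blocked, and likewise for [x + e_j] and the particle [j]. *)
Lemma arrivals_hold :
  (arrivals k (carried k x z' z') x + sign_weight k x * row_moves k x z' z' =
   sign_weight k x * hold k.+1 z')%N.
Proof.
rewrite /arrivals carried_hold.
under eq_bigr => j _.
  rewrite carried_hold_down ?carried_hold_up ?/in_row ?ltn_ord// -mulnDr.
  over.
rewrite -big_distrr /= [(hold k x * _)%N]mulnC -mulnDr -mulnDr; congr muln.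
rewrite /row_moves.
under [X in (_ + X)%N]eq_bigr do rewrite row_right_hold row_left_hold wallE /=.
rewrite !big_split /=.
have [ok|ek] := boolP (odd k).
- have [m' mE] : exists m', m = m'.+1 by exists m.-1; move: ok; rewrite /rowlen; lia.
  have nE : n = m'.+1 by rewrite -mE /rowlen; move: ok; lia.
  have z'0 : z' m'.+2 = 0 by rewrite zn'// nE /in_row ltnn andbF.
  have xm' i : (i <= m')%N -> x i.+1 <= z' i.+1 /\ z' i.+2 <= x i.+1.
    by move=> im; apply: xz'; rewrite mE /in_row.
  rewrite /hold /= ok nE mE /= andbF subn0.
  have -> : (\sum_(i < m'.+1) (z' i.+2 < x i.+1)%R =
      \sum_(i < m') (z' i.+2 < x i.+1)%R + (0 < x m'.+1)%R)%N.
    by rewrite big_ord_recr /= z'0.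
  have -> : (\sum_(i < m'.+1) ((1 < i.+1)%N && (z' i.+1 == x i)) =
      \sum_(i < m') (z' i.+2 == x i.+1))%N.
    by rewrite big_ord_recl.
  have -> : (\sum_(i < m'.+1) (x i.+1 < z' i.+1)%R *
        (if (i.+1 == m'.+1) && (x i.+1 == 0%R) then 2 else 1) =
      \sum_(i < m') (x i.+1 < z' i.+1)%R +
        (x m'.+1 < z' m'.+1)%R * (if x m'.+1 == 0%R then 2 else 1))%N.
    rewrite big_ord_recr /= eqxx; congr addn; apply: eq_bigr => i _.
    by rewrite eqSS (ltn_eqF (ltn_ord i)) muln1.
  have -> : (\sum_(i < m'.+1) (z' i.+1 == x i.+1) =
      \sum_(i < m') (z' i.+1 == x i.+1) + (z' m'.+1 == x m'.+1))%N.
    by rewrite big_ord_recr.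
  have s1 := sum_lt_eq (fun i : 'I_m' => (xm' i (ltnW (ltn_ord i))).2).
  have := sum_lt_eq (fun i : 'I_m' => (xm' i (ltnW (ltn_ord i))).1).
  rewrite [X in (_ + X)%N](eq_bigr _ (fun i _ => congr1 nat_of_bool (eq_sym _ _))) => s2.
  have last_x := x0 m'.+1; have last_z := z0' m'.+1; have [le_l _] := xm' _ (leqnn m').
  move: s1 s2.
  set a := (\sum_(i < m') (z' i.+2 < x i.+1)%R)%N; set b := (\sum_(i < m') (z' i.+2 == x i.+1))%N.
  set c := (\sum_(i < m') (x i.+1 < z' i.+1)%R)%N; set e := (\sum_(i < m') (z' i.+1 == x i.+1))%N.
  move: last_x last_z le_l; case: (eqVneq (x m'.+1) 0) => [->|ne].
    case: (eqVneq (z' m'.+1) 0) => [->|ne']; first by rewrite ltxx; lia.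
    move=> _ hz _; have -> : (0 < z' m'.+1) = true by move: hz ne'; lia.
    by rewrite ltxx; lia.
  move=> hx hz le_l; have -> : (0 < x m'.+1) = true by move: hx ne; lia.
  have -> : (z' m'.+1 == 0) = false by move: hx ne le_l; lia.
  by move: le_l; case: (ltgtP (x m'.+1) (z' m'.+1)) => //=; lia.
- have nE : n = m.+1 by rewrite /rowlen; move: ek; lia.
  have xm' i : (i < m)%N -> x i.+1 <= z' i.+1 /\ z' i.+2 <= x i.+1.
    by move=> im; apply: xz'; rewrite /in_row.
  rewrite /hold /= ek nE /= subn0.
  have -> : (\sum_(i < m.+1) ((1 < i.+1)%N && (z' i.+1 == x i)) =
      \sum_(i < m) (z' i.+2 == x i.+1))%N.
    by rewrite big_ord_recl.
  have -> : (\sum_(i < m) (x i.+1 < z' i.+1)%R *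
        (if [&& false, i.+1 == m & x i.+1 == 0%R] then 2 else 1) =
      \sum_(i < m) (x i.+1 < z' i.+1)%R)%N.
    by apply: eq_bigr => i _; rewrite muln1.
  have -> : (\sum_(i < m.+1)
      (if ~~ false && (i.+1 == m.+1)
       then [&& z' i.+1 == 0%R, (1 < i.+1)%N & z' i.+1 == x i]
       else z' i.+1 == x i.+1) =
      \sum_(i < m) (z' i.+1 == x i.+1) + [&& z' m.+1 == 0%R, (0 < m)%N & z' m.+1 == x m])%N.
    rewrite big_ord_recr /= eqxx; congr addn; apply: eq_bigr => i _.
    by rewrite eqSS (ltn_eqF (ltn_ord i)).
  have s1 := sum_lt_eq (fun i : 'I_m => (xm' i (ltn_ord i)).2).
  have := sum_lt_eq (fun i : 'I_m => (xm' i (ltn_ord i)).1).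
  rewrite [X in (_ + X)%N](eq_bigr _ (fun i _ => congr1 nat_of_bool (eq_sym _ _))) => s2.
  have -> : [&& z' m.+1 == 0, (0 < m)%N & z' m.+1 == x m] = (0 < k)%N && (x m == 0).
    have -> : (0 < k)%N = (0 < m)%N by rewrite /rowlen; move: ek; lia.
    case: posnP => [_|m0]; first by rewrite andbF.
    have [_] := xm' m.-1 (ltac:(lia)); rewrite (ltn_predK m0) /= => h.
    have h0 := z0' m.+1.
    by apply/andP/eqP => [[/eqP -> /eqP <-]//|xm0]; rewrite xm0 in h *; split; lia.
  have hc : ((0 < k)%N && (x m == 0) <= hold_const k)%N.
    case: andP => // -[k0 _]; move: ek k0; case: (k) => // k' ek' _ /=.
    by rewrite /rowlen; move: ek'; lia.
  rewrite /= in s1 s2; move: s1 s2 hc.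
  set a := (\sum_(i < m) (z' i.+2 < x i.+1)%R)%N; set b := (\sum_(i < m) (z' i.+2 == x i.+1))%N.
  set c := (\sum_(i < m) (x i.+1 < z' i.+1)%R)%N; set e := (\sum_(i < m) (z' i.+1 == x i.+1))%N.
  by move: a b c e (nat_of_bool _) => a b c e h; lia.
Qed.

Lemma prev_in_row j : in_row n j -> (1 < j)%N -> in_row m j.-1.
Proof. by move: m_le_n; rewrite /in_row; lia. Qed.

Lemma shifted_row j e (z := shift z' j e) : in_row n j -> e != 0 ->
  [/\ z j = z' j + e, forall i, i != j -> z i = z' i, row_of_length n z,
      shift z j (- e) = z' & carried k x z z' x = 0%N].
Proof.
move=> jn e0; have zj : z j = z' j + e by rewrite /z /shift eqxx.
have zi i : i != j -> z i = z' i by move=> /negbTE h; rewrite /z /shift h addr0.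
split=> //; [exact: shift_length|by apply/shift_eqE; rewrite zj addrK|].
by rewrite /carried push_id (row_neq (i := j)) ?muln0// zj; move: e0; lia.
Qed.

Lemma sum_single (l i c : nat) (F : 'I_l -> nat) :
  (forall j : 'I_l, F j = if j == i :> nat then c else 0)%N -> (i < l)%N ->
  (\sum_(j < l) F j = c)%N.
Proof.
move=> FE il; rewrite (eq_bigr _ (fun j _ => FE j)) -big_mkcond /=.
by rewrite (big_ord1_eq _ (fun=> c)) il.
Qed.

(** Here the particle [j0] of the upper row moves to the left. If its old
    position interlaces with [x], it moved on its own, and otherwise it was
    pushed by the particle [j0 - 1] of the lower row. *)
Lemma arrivals_from_right j0 : in_row n j0 -> chamber (shift z' j0 1) ->
  (arrivals k (carried k x (shift z' j0 1%R) z') x +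
   `[< interl m x (shift z' j0 1%R) >] * sign_weight k x *
     row_moves k x (shift z' j0 1%R) z' = sign_weight k x)%N.
Proof.
move=> jn; set z := shift z' j0 1 => cz.
have := shifted_row jn (isT : (1 : int) != 0); rewrite /= -/z => -[zj zi zn zK carried_x].
have j00 : (0 < j0)%N by case/andP: jn.
pose pushed : bool := (1 < j0)%N && (z' j0 == x j0.-1).
have prev_in := prev_in_row jn.
have carried_down j : carried k x z z' (shift x j (-1)) = 0%N.
  rewrite /carried push_up (row_neq (i := j0)) ?muln0//.
  by case: ifP => _; rewrite /shift zj; [case: (j0 == j)|]; lia.
have carried_up j : in_row m j -> (up x j * carried k x z z' (shift x j 1%R) =
    if j.+1 == j0 then pushed * sign_weight k x else 0)%N.
  move=> jm; have j0' : (0 < j)%N by case/andP: jm.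
  rewrite /carried push_down//.
  case: (eqVneq j.+1 j0) => [jj|ne]; last first.
    rewrite (row_neq (i := j0)) ?muln0//; case: ifP => _; last by rewrite zj; lia.
    by rewrite /shift (eq_sym j0) (negbTE ne) zj; lia.
  rewrite jj jn /= zj.
  have pE : pushed = (z' j0 == x j) by rewrite /pushed -jj ltnS j0' /=.
  have -> : (z' j0 + 1 == x j + 1) = pushed by rewrite pE; lia.
  case p : pushed; last by rewrite (row_neq (i := j0)) ?muln0// zj; lia.
  rewrite (asboolT zK) muln1 mul1n.
  have zx : z' j0 = x j by apply/eqP; rewrite -pE.
  have il : interl m (shift x j 1) z.
    move=> i im; rewrite /shift; have [h1 h2] := xz' im.
    have [ij|ij] := eqVneq i j.
      have [_ /(_ j0')] := cz j; rewrite ij jj zj zx => h; split; lia.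
    have -> : z i.+1 = z' i.+1 by rewrite zi// -jj eqSS.
    rewrite addr0; split=> //; have [e|ne] := eqVneq i j0; last by rewrite zi.
    by rewrite e zj; move: h1; rewrite e; lia.
  rewrite asboolT// mul1n up_weight//; last first.
    by apply: chamber_below il _ => //; exact: shift_length.
  rewrite (_ : [&& odd k, _ & _] = false) ?muln1//.
  by apply/negP => /and3P[ok /eqP jmE _]; move: jn; rewrite -jj jmE /in_row /rowlen; lia.
have -> : arrivals k (carried k x z z') x = (pushed * sign_weight k x)%N.
  rewrite /arrivals carried_x muln0 add0n.
  rewrite (eq_bigr (fun j : 'I_m => if j.+2 == j0 then pushed * sign_weight k x else 0)%N); last first.
    by move=> j _; rewrite carried_down muln0 add0n carried_up// /in_row /= ltn_ord.
  have [j1|j1] := ltnP 1 j0; last first.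
    rewrite /pushed ltnNge j1 /= big1// => j _; by case: ifP; rewrite ?mul0n.
  apply: (@sum_single _ j0.-2); last by have := prev_in j1; rewrite /in_row; lia.
  by move=> j; congr (if _ then _ else _); apply/eqP/eqP; lia.
have -> : row_moves k x z z' = 1%N.
  apply: (@sum_single _ j0.-1); last by move: jn; rewrite /in_row; lia.
  move=> j; rewrite (row_neq (i := j0)) ?add0n; last first.
    by rewrite /row_right; case: ifP => _; rewrite /shift zj; [|case: (j0 == _)]; lia.
  have [jj|ne] := eqVneq (j : nat) j0.-1.
    have -> : j.+1 = j0 by rewrite jj prednK.
    rewrite /row_left; have zj0 : (z j0 == 0) = false by rewrite zj; have := z0' j0; lia.
    case: ifP => w; first by rewrite zj0 asboolT.
    have jm : in_row m j0 by move: w jn m_le_n; rewrite wallE /in_row /rowlen; lia.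
    have [h1 _] := xz' jm.
    by rewrite (_ : (z j0 == x j0) = false) ?asboolT// zj; lia.
  have ne' : (j0 == j.+1) = false by apply/eqP; move: ne j00; lia.
  rewrite (row_neq (i := j0))// /row_left /row_right.
  by do 3?case: ifP => _; rewrite /shift ?ne' ?addr0 zj; lia.
have -> : `[< interl m x z >] = ~~ pushed.
  apply/asboolP/negP => [xz|np].
    move=> /andP[j1 /eqP e]; have [_] := xz _ (prev_in j1).
    by rewrite prednK// zj e; lia.
  move=> i im; have [h1 h2] := xz' im; split.
    by have [e|ne] := eqVneq i j0; [move: h1; rewrite e zj; lia|rewrite zi].
  have [e|ne] := eqVneq i.+1 j0; last by rewrite zi.
  have j1 : (1 < j0)%N by rewrite -e ltnS; case/andP: im.
  by move: np h2; rewrite /pushed j1 -e /= e zj => /negP; lia.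
by case: (pushed); rewrite ?mul1n ?mul0n ?muln1 ?addn0 ?add0n.
Qed.

(** Here the particle [j0] of the upper row moves to the right, on its own or
    pushed. A reflected left jump is a second way for the wall particle to go
    from 0 to 1. *)
Lemma arrivals_from_left j0 : in_row n j0 -> chamber (shift z' j0 (-1)) ->
  (arrivals k (carried k x (shift z' j0 (-1)%R) z') x +
   `[< interl m x (shift z' j0 (-1)%R) >] * sign_weight k x *
     row_moves k x (shift z' j0 (-1)%R) z' = sign_weight k x * down k.+1 z' j0)%N.
Proof.
move=> jn; set z := shift z' j0 (-1) => cz.
have := shifted_row jn (isT : (-1 : int) != 0); rewrite /= -/z => -[zj zi zn zK carried_x].
have zj0 : 0 <= z j0 by have [] := cz j0.
have j00 : (0 < j0)%N by case/andP: jn.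
pose pushed : bool := in_row m j0 && (z' j0 == x j0).
have prev_in := prev_in_row jn.
have carried_up j : in_row m j -> carried k x z z' (shift x j 1) = 0%N.
  move=> /andP[j1 _]; rewrite /carried push_down// (row_neq (i := j0)) ?muln0//.
  by case: ifP => _; rewrite /shift zj; [case: (j0 == j.+1)|]; lia.
have carried_down j : in_row m j -> (down k x j * carried k x z z' (shift x j (-1)%R) =
    if j == j0 then pushed * sign_weight k x else 0)%N.
  move=> jm; rewrite /carried push_up.
  case: (eqVneq j j0) => [jj|ne]; last first.
    rewrite (row_neq (i := j0)) ?muln0//; case: ifP => _; last by rewrite zj; lia.
    by rewrite /shift (eq_sym j0) (negbTE ne) zj; lia.
  rewrite jj jn /= zj.
  have pE : pushed = (z' j0 == x j0) by rewrite /pushed -jj jm.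
  have -> : (z' j0 - 1 == x j0 - 1) = pushed by rewrite pE; lia.
  case p : pushed; last by rewrite (row_neq (i := j0)) ?muln0// zj; lia.
  rewrite (asboolT zK) muln1 mul1n.
  have zx : z' j0 = x j0 by apply/eqP; rewrite -pE.
  have il : interl m (shift x j0 (-1)) z.
    move=> i im; rewrite /shift; have [h1 h2] := xz' im.
    have [ij|ij] := eqVneq i j0.
      have [_ /(_ j00)] := cz j0; rewrite ij zj zx => h; split; lia.
    rewrite (zi i)// addr0; split=> //; have [e|ne] := eqVneq i.+1 j0; last by rewrite zi.
    by rewrite e zj; move: h2; rewrite e; lia.
  have j0m : in_row m j0 by rewrite -jj.
  rewrite asboolT// mul1n down_weight//; first by rewrite -zx; move: zj0; rewrite zj; lia.
  by apply: chamber_below il _ => //; exact: shift_length.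
have -> : arrivals k (carried k x z z') x = (pushed * sign_weight k x)%N.
  rewrite /arrivals carried_x muln0 add0n.
  rewrite (eq_bigr (fun j : 'I_m => if j.+1 == j0 then pushed * sign_weight k x else 0)%N); last first.
    move=> j _; have jm : in_row m j.+1 by rewrite /in_row /= ltn_ord.
    by rewrite carried_up// muln0 addn0 carried_down.
  have [j0m|j0m] := boolP (in_row m j0); last first.
    by rewrite /pushed (negbTE j0m) big1// => j _; case: ifP; rewrite ?mul0n.
  apply: (@sum_single _ j0.-1); last by move: j0m; rewrite /in_row; lia.
  by move=> j; congr (if _ then _ else _); apply/eqP/eqP; lia.
have prev_lt : (1 < j0)%N -> (z j0 == x j0.-1) = false.
  by move=> j1; have [_] := xz' (prev_in j1); rewrite prednK// zj; lia.
have right_j0 : `[< row_right x z j0 = z' >].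
  by rewrite /row_right; case: ltnP => [j1|_] /=; [rewrite prev_lt//|]; exact: asboolT.
have right_ne j : j != j0 -> `[< row_right x z j = z' >] = false.
  move=> /negbTE ne; rewrite (row_neq (i := j0))// /row_right.
  by case: ifP => _; rewrite /shift ?(eq_sym j0) ?ne ?addr0 zj; lia.
have -> : row_moves k x z z' = (if wall k.+1 j0 && (z' j0 == 1) then 2 else 1)%N.
  apply: (@sum_single _ j0.-1); last by move: jn; rewrite /in_row; lia.
  move=> j; have -> : ((j : nat) == j0.-1) = (j.+1 == j0) by apply/eqP/eqP; lia.
  have left_ne (b : bool) z1 : z1 j0 = z j0 \/ z1 j0 = z j0 - 1 -> `[< z1 = z' >] = false.
    by move=> h; rewrite (row_neq (i := j0))//; move: h; rewrite zj; lia.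
  rewrite /row_left; case: (eqVneq j.+1 j0) => [->|ne].
    rewrite right_j0; case: (wall k.+1 j0) => /=; last first.
      rewrite left_ne//; case: ifP => _; first by left.
      by right; rewrite /shift eqxx.
    have -> : (z j0 == 0) = (z' j0 == 1) by rewrite zj; lia.
    case: (z' j0 == 1); first by rewrite right_j0.
    by rewrite left_ne//; right; rewrite /shift eqxx.
  rewrite right_ne//; case: ifP => _; case: ifP => _.
  - by rewrite right_ne.
  - by rewrite left_ne//; left; rewrite /shift (eq_sym j0) (negbTE ne) addr0.
  - by rewrite left_ne//; left.
  - by rewrite left_ne//; left; rewrite /shift (eq_sym j0) (negbTE ne) addr0.
have -> : `[< interl m x z >] = ~~ pushed.
  apply/asboolP/negP => [xz|np].
    by move=> /andP[jm /eqP e]; have [] := xz _ jm; rewrite zj e; lia.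
  move=> i im; have [h1 h2] := xz' im; split.
    have [e|ne] := eqVneq i j0; last by rewrite zi.
    by move: np h1; rewrite /pushed -e /in_row im /= e zj => /negP; lia.
  have [e|ne] := eqVneq i.+1 j0; last by rewrite zi.
  by move: h2; rewrite e zj; lia.
rewrite /down asboolT// mul1n wallE -andbA.
have [p|np] := boolP pushed; rewrite ?mul1n ?mul0n ?addn0 ?add0n //.
rewrite (_ : [&& odd k.+1, _ & _] = false) ?muln1//.
apply/negP => /and3P[ok /eqP jE _]; case/andP: p; rewrite jE /in_row.
by move: ok; rewrite /rowlen; lia.
Qed.

End TwoRows.

(** * Weighted patterns and the jumps that lead to a given pattern *)

(** The number of Gelfand-Tsetlin patterns with the last row of [y] and the
    absolute values of [y]: only the nonzero last entries of the odd rows below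
    the last one have a free sign. *)
Definition mass (k : nat) (y : pattern k) : nat :=
  (\prod_(i < k) sign_weight i (pos y i))%N.

Definition nonneg_patterns (k : nat) : set (pattern k) := [set y | nonneg_pattern y].

Lemma mass_gt0 k (y : pattern k) : (0 < mass y)%N.
Proof. by rewrite /mass prodn_gt0// => i; rewrite /sign_weight; case: ifP. Qed.

Lemma mass_add_row k (z : row) (y : pattern k) :
  mass (add_row z y) = (mass y * sign_weight k (pos y k))%N.
Proof.
have low i : (i <= k)%N -> pos (add_row z y) i = pos y i.
  by move=> ik; apply/funext => j; rewrite pos_add_row.
rewrite /mass big_ord_recr /= low//; congr muln; apply: eq_bigr => i _.
by rewrite low// ltnW.
Qed.

Lemma chamber_row k (y : pattern k) i : nonneg_pattern y -> chamber (pos y i).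
Proof.
move=> [y0 hy] j; split=> // j0.
have [/andP[ik jr]|nt] := boolP (in_triangle k i j.+1); last by rewrite (pos_out _ nt).
case: i ik jr => [|i] ik jr; first by move: jr; rewrite /rowlen /=; lia.
have ji : (0 < j <= rowlen i)%N by move: jr (rowlenS i); lia.
by have [h1 h2] := hy i ik j ji; exact: le_trans h2 h1.
Qed.

Lemma moved_row k (y : pattern k) S e i (b : bool) j0 :
  (forall j, S i j = b && (j == j0)) -> pos (moved y S e) i = pos y i \/
  in_row (rowlen i) j0 /\ pos (moved y S e) i = shift (pos y i) j0 e.
Proof.
move=> SE; have [/andP[bT t]|nbt] := boolP (b && in_triangle k i j0).
  right; split; first by case/andP: t.
  apply/funext => j; rewrite pos_moved SE bT /shift.
  by case: eqP => [->|_]; rewrite ?t ?andbF.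
left; apply/funext => j; rewrite pos_moved SE.
by case: ifP; rewrite ?addr0// => /and3P[t bT /eqP jj]; move: nbt; rewrite bT -jj t.
Qed.

(** A jump moves particles along a column or a diagonal, which meets each row
    at most once. *)
Lemma jump_row k (c : clock k) (y : pattern k) i :
  pos (jump c y) i = pos y i \/ exists2 j, in_row (rowlen i) j &
  exists e : bool, pos (jump c y) i = shift (pos y i) j (if e then 1 else -1).
Proof.
have by_moved S (e : bool) b j0 : (forall j, S i j = b && (j == j0)) ->
    pos (moved y S (if e then 1 else -1)) i = pos y i \/
    exists2 j, in_row (rowlen i) j & exists e' : bool,
    pos (moved y S (if e then 1 else -1)) i = shift (pos y i) j (if e' then 1 else -1).
  move=> SE; have [->|[jr ->]] := moved_row y (if e then 1 else -1) SE; first by left.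
  by right; exists j0 => //; exists e.
have right j : pos (try_right y (prow c.1) j) i = pos y i \/
    exists2 j', in_row (rowlen i) j' & exists e : bool,
    pos (try_right y (prow c.1) j) i = shift (pos y i) j' (if e then 1 else -1).
  by rewrite /try_right; case: ifP => _; [left|exact: (by_moved _ true)].
rewrite /jump; case: ifP => _; first exact: right.
rewrite /try_left; case: ifP => _; case: ifP => _; [exact: right| |by left|].
  exact: (by_moved _ false).
exact: (by_moved _ false).
Qed.

Section Arrivals.
Context {R : realType}.

Definition arrivalsR (k : nat) (f : row -> R) (x : row) : R :=
  (hold k x)%:R * f x +
  \sum_(j < rowlen k) ((down k x j.+1)%:R * f (shift x j.+1 (-1)) +
                       (up x j.+1)%:R * f (shift x j.+1 1)).

Lemma arrivalsR_nat k (f : row -> nat) x :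
  arrivalsR k (fun x => (f x)%:R) x = (arrivals k f x)%:R.
Proof.
rewrite /arrivalsR /arrivals natrD natrM natr_sum; congr (_ + _).
by apply: eq_bigr => j _; rewrite natrD !natrM.
Qed.

(** The rows from which [x] is reached in one step are pairwise distinct, so
    that a function is recovered from its values at these rows. *)
Definition select (n : nat) (f : row -> R) (x r : row) : R :=
  (`[< r = x >])%:R * f x +
  \sum_(j < n) ((`[< r = shift x j.+1 (-1) >])%:R * f (shift x j.+1 (-1)) +
                (`[< r = shift x j.+1 1 >])%:R * f (shift x j.+1 1)).

Lemma select_id n f x : select n f x x = f x.
Proof.
rewrite /select asboolT// mul1r big1 ?addr0// => j _.
rewrite !(row_neq (i := j.+1)) ?mul0r ?addr0// /shift eqxx; lia.
Qed.

Lemma select_shift n f x j (e : bool) : in_row n j ->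
  select n f x (shift x j (if e then 1 else -1)) = f (shift x j (if e then 1 else -1)).
Proof.
move=> jn; rewrite /select (row_neq (i := j)) ?mul0r ?add0r; last first.
  by rewrite /shift eqxx; case: e; lia.
have jlt : (j.-1 < n)%N by move: jn; rewrite /in_row; lia.
rewrite (bigD1 (Ordinal jlt))//= big1 ?addr0 => [|i ne]; last first.
  have ne' : (j == i.+1) = false.
    by apply/eqP => jE; move/eqP: ne; apply; apply/val_inj; rewrite /= jE.
  rewrite !(row_neq (i := j)) ?mul0r ?addr0// /shift eqxx ne'; case: e; lia.
have jS : j.-1.+1 = j by move: jn; rewrite /in_row; lia.
rewrite jS; case: e.
  rewrite (row_neq (i := j)) ?mul0r ?add0r ?asboolT ?mul1r// /shift eqxx; lia.
rewrite addrC (row_neq (i := j)) ?mul0r ?add0r ?asboolT ?mul1r// /shift eqxx; lia.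
Qed.

Local Open Scope ereal_scope.

(** Sorts a sum over patterns by their last row. *)
Lemma esum_select (A : choiceType) (I : set A) (n : nat) (f : row -> R) (x : row)
    (g : A -> R) (r : A -> row) :
  (forall a, 0 <= g a)%R -> (forall z, 0 <= f z)%R ->
  \esum_(a in I) (g a * select n f x (r a))%:E =
  (f x)%:E * (\esum_(a in I) (g a * (`[< r a = x >])%:R)%:E) +
  \sum_(j < n) ((f (shift x j.+1 (-1)%R))%:E *
                  (\esum_(a in I) (g a * (`[< r a = shift x j.+1 (-1)%R >])%:R)%:E) +
                (f (shift x j.+1 1%R))%:E *
                  (\esum_(a in I) (g a * (`[< r a = shift x j.+1 1%R >])%:R)%:E)).
Proof.
move=> g0 f0.
have term z : ((f z)%:E * (\esum_(a in I) (g a * (`[< r a = z >])%:R)%:E) =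
    \esum_(a in I) (g a * ((`[< r a = z >])%:R * f z))%:E)%E.
  rewrite -esumZl//; last by move=> a _; rewrite lee_fin mulr_ge0.
  by apply: eq_esum => a _; rewrite -EFinM; congr (_%:E); ring.
have pos_term z a : 0 <= (g a * ((`[< r a = z >])%:R * f z))%:E.
  by rewrite lee_fin !mulr_ge0.
rewrite term; under eq_bigr do rewrite !term -esumD//.
rewrite -esum_sum; last by move=> a j _ _; rewrite adde_ge0.
rewrite -esumD//; last by move=> a _; apply: sume_ge0 => j _; rewrite adde_ge0.
apply: eq_esum => a _; rewrite /select mulrDr EFinD; congr (_ + _).
rewrite mulr_sumr -sumEFin; apply: eq_bigr => j _.
by rewrite mulrDr EFinD.
Qed.

(** The induction step, for a fixed row [z] at the top. The jumps of the lower
    rows are summed by the induction hypothesis, applied to the function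
    [carried]; the jumps of the top row leave the lower rows at [y'], so that
    the two contributions can be added by the identity for two rows. *)
Lemma esum_top_row k (z z' : row) (y' : pattern k) (w : nat) :
  (forall f : row -> R, (forall x, 0 <= f x)%R ->
    \esum_(y in @nonneg_patterns k) ((mass y * jumps y y')%:R * f (pos y k))%:E =
    ((mass y')%:R * arrivalsR k f (pos y' k))%:E) ->
  row_of_length (rowlen k.+1) z -> row_of_length (rowlen k.+1) z' ->
  chamber z -> nonneg_pattern (add_row z' y') ->
  (arrivals k (carried k (pos y' k) z z') (pos y' k) +
   `[< interl (rowlen k) (pos y' k) z >] * sign_weight k (pos y' k) *
     row_moves k (pos y' k) z z' = sign_weight k (pos y' k) * w)%N ->
  \esum_(y in @nonneg_patterns k.+1)
     ((mass y * jumps y (add_row z' y'))%:R * (`[< pos y k.+1 = z >])%:R : R)%:E =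
  ((mass (add_row z' y') * w)%:R : R)%:E.
Proof.
move=> IH zn zn' cz py' local.
have [y'0 _ _] := (nonneg_add_row y' zn').1 py'.
pose I0 := [set y : pattern k | nonneg_pattern y /\ interl (rowlen k) (pos y k) z].
have -> : \esum_(y in @nonneg_patterns k.+1)
     ((mass y * jumps y (add_row z' y'))%:R * (`[< pos y k.+1 = z >])%:R : R)%:E =
   \esum_(y in I0) ((mass (add_row z y) * jumps (add_row z y) (add_row z' y'))%:R : R)%:E.
  rewrite -(esum_image I0 (add_row z) (fun y => ((mass y * jumps y (add_row z' y'))%:R : R)%:E)); last first.
    by move=> y1 y2 _ _ e; rewrite -(add_rowK z y1) e add_rowK.
  rewrite esum_mkcond [RHS]esum_mkcond; apply: eq_esum => y _.
  case: ifPn => [/set_mem py|npy].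
    have [e|ne] := pselect (pos y k.+1 = z).
      rewrite asboolT// mulr1 ifT//; apply/mem_set; exists (drop_row y); last by rewrite -e drop_rowK.
      have : nonneg_pattern (add_row z (drop_row y)) by rewrite -e drop_rowK.
      by move=> /(nonneg_add_row _ zn)[].
    rewrite asboolF// mulr0 ifF//; apply/negP => /set_mem[y0 _ yE]; apply: ne.
    by rewrite -yE pos_add_row_top.
  rewrite ifF//; apply/negP => /set_mem[y0 [py0 il] yE]; move/negP: npy; apply; apply/mem_set.
  by rewrite -yE; apply/(nonneg_add_row _ zn); split=> // j; have [] := cz j.
transitivity (\esum_(y in @nonneg_patterns k)
   (((mass y * jumps y y')%:R * (carried k (pos y' k) z z' (pos y k))%:R : R)%:E +
    (((y == y') * (mass y * (`[< interl (rowlen k) (pos y k) z >] * sign_weight k (pos y k) *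
       row_moves k (pos y k) z z')))%N%:R : R)%:E)).
  rewrite esum_mkcond [RHS]esum_mkcond; apply: eq_esum => y _.
  case: ifPn => [/set_mem[py il]|nI].
    rewrite ifT; last exact/mem_set.
    have pz : nonneg_pattern (add_row z y).
      by apply/(nonneg_add_row _ zn); split=> // j; have [] := cz j.
    rewrite -EFinD mass_add_row jumps_add_row// -natrM -natrD /carried (asboolT il) !mul1n.
    by congr (_%:R%:E); ring.
  case: ifPn => // /set_mem py.
  have nil : ~ interl (rowlen k) (pos y k) z.
    by move=> il; move/negP: nI; apply; apply/mem_set.
  by rewrite /carried asboolF// !(mul0n, muln0) mulr0 -EFinD addr0.
rewrite esumD//.
rewrite (IH (fun x => (carried k (pos y' k) z z' x)%:R))// arrivalsR_nat.
rewrite (esum_pick (y := y'))//; last by move=> y _ /negbTE ->; rewrite mul0n.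
rewrite eqxx mul1n -natrM -EFinD -natrD -mulnDr local mass_add_row.
by congr (_%:R%:E); ring.
Qed.

(** The weighted number of one-step transitions into [y'], for weights that
    depend on the last row only: the sum over all the rows of the pattern
    collapses to the possible moves of its last row. *)
Theorem esum_jumps k (y' : pattern k) (f : row -> R) : nonneg_pattern y' ->
  (forall x, 0 <= f x)%R ->
  \esum_(y in @nonneg_patterns k) ((mass y * jumps y y')%:R * f (pos y k))%:E =
  ((mass y')%:R * arrivalsR k f (pos y' k))%:E.
Proof.
elim: k y' f => [|k IH] y' f py' f0.
  rewrite esum1 => [|y _]; last by rewrite /jumps big_ord1 /moves big_ord0 muln0 mul0r.
  by rewrite /arrivalsR big_ord0 /hold /= mul0r addr0 mulr0.
set z' := pos y' k.+1; have zn' : row_of_length (rowlen k.+1) z' by exact: pos_row_of_length.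
set y0 := drop_row y'; have yE : y' = add_row z' y0 by rewrite /z' /y0 drop_rowK.
have py0' : nonneg_pattern (add_row z' y0) by rewrite -yE.
have [py0 z0 il] := (nonneg_add_row y0 zn').1 py0'.
have cz' : chamber z' by exact: chamber_row.
have cx : chamber (pos y0 k) by exact: chamber_row.
have xm : row_of_length (rowlen k) (pos y0 k) by exact: pos_row_of_length.
have top z w : row_of_length (rowlen k.+1) z -> chamber z ->
  (arrivals k (carried k (pos y0 k) z z') (pos y0 k) +
   `[< interl (rowlen k) (pos y0 k) z >] * sign_weight k (pos y0 k) *
     row_moves k (pos y0 k) z z' = sign_weight k (pos y0 k) * w)%N ->
  \esum_(y in @nonneg_patterns k.+1)
     ((mass y * jumps y y')%:R * (`[< pos y k.+1 = z >])%:R : R)%:E = ((mass y' * w)%:R : R)%:E.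
  move=> zn cz local; rewrite yE; apply: esum_top_row => //.
  by move=> g g0; exact: IH.
have none z : ~ chamber z -> \esum_(y in @nonneg_patterns k.+1)
     ((mass y * jumps y y')%:R * (`[< pos y k.+1 = z >])%:R : R)%:E = 0 :> \bar R.
  move=> ncz; apply: esum1 => y py; rewrite asboolF ?mulr0// => e.
  by apply: ncz; rewrite -e; exact: chamber_row.
transitivity (\esum_(y in @nonneg_patterns k.+1)
    ((mass y * jumps y y')%:R * select (rowlen k.+1) f z' (pos y k.+1))%:E).
  apply: eq_esum => y py; have [->|j0] := eqVneq (jumps y y') 0%N; first by rewrite muln0 !mul0r.
  congr (_ * _)%R%:E.
  have [c cE] : exists c : clock k.+1, jump c y = y'.
    apply: contrapT => nc; move/eqP: j0; apply; rewrite jumpsE big1// => c _.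
    by case: eqP => // cE; exfalso; apply: nc; exists c.
  have := jump_row c y k.+1; rewrite cE -/z'.
  move=> [->|[j jn [e ze]]]; first by rewrite select_id.
  have -> : pos y k.+1 = shift z' j (if ~~ e then 1 else -1)%R.
    by rewrite ze; apply/funext => i; rewrite /shift; case: (e); case: eqP => _ /=; lia.
  by rewrite select_shift.
rewrite (@esum_select _ _ (rowlen k.+1) f z' (fun y => (mass y * jumps y y')%:R) (fun y => pos y k.+1))//.
rewrite /arrivalsR mulrDr EFinD; congr (_ + _).
  rewrite (top z' (hold k.+1 z'))//; last by rewrite -arrivals_hold// asboolT// mul1n.
  by rewrite -EFinM natrM; congr (_%:E); ring.
rewrite mulr_sumr -sumEFin; apply: eq_bigr => j _.
have jn : in_row (rowlen k.+1) j.+1 by rewrite /in_row /= ltn_ord.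
rewrite mulrDr EFinD; congr (_ + _).
  have [cz|ncz] := pselect (chamber (shift z' j.+1 (-1)%R)); last first.
    by rewrite none// mule0 /down asboolF// mul0n mul0r mulr0.
  rewrite (top _ (down k.+1 z' j.+1))//; [|exact: shift_length|exact: arrivals_from_left].
  by rewrite -EFinM natrM; congr (_%:E); ring.
have [cz|ncz] := pselect (chamber (shift z' j.+1 1%R)); last first.
  by rewrite none// mule0 /up asboolF// mul0r mulr0.
rewrite (top _ (up z' j.+1))//; [|exact: shift_length|].
  by rewrite -EFinM natrM; congr (_%:E); ring.
by rewrite arrivals_from_right// /up asboolT// muln1.
Qed.

End Arrivals.

(** * Rows as vectors, and the number of patterns with a given last row *)

(** Entries are numbered from 1 and extended by 0. *)
Definition row_of (n : nat) (l : 'rV[int]_n) : row :=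
  fun j => if j is j'.+1 then oapp (fun i => l 0 i) 0 (insub j') else 0.

Definition vec_of (n : nat) (x : row) : 'rV[int]_n := \row_j x j.+1.

Section RowVectors.
Variable n : nat.
Implicit Types (l b : 'rV[int]_n) (x : row).

Lemma row_ofE l (i : 'I_n) : row_of l i.+1 = l 0 i.
Proof. by rewrite /row_of insubT //= => h; congr (l 0 _); apply: val_inj. Qed.

Lemma row_of_out l : row_of_length n (row_of l).
Proof. by move=> [|j] //= nj; rewrite insubN. Qed.

Lemma row_of_entry l j : in_row n j -> entry l j = row_of l j.
Proof. by case: j. Qed.

Lemma row_ofK l : vec_of n (row_of l) = l.
Proof. by apply/rowP => i; rewrite mxE row_ofE. Qed.

Lemma vec_ofK x : row_of_length n x -> row_of (vec_of n x) = x.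
Proof.
move=> xn; apply/funext => -[|j]; first by rewrite xn.
have [jn|jn] := ltnP j n; last by rewrite row_of_out ?xn // /in_row /= -ltnNge.
by rewrite -[j]/(nat_of_ord (Ordinal jn)) row_ofE mxE.
Qed.

Lemma row_of_inj l b : row_of l = row_of b -> l = b.
Proof. by move=> e; rewrite -(row_ofK l) e row_ofK. Qed.

Lemma row_of_shift l (j : 'I_n) (e : bool) :
  row_of (if e then l + delta_mx 0 j else l - delta_mx 0 j) =
  shift (row_of l) j.+1 (if e then 1 else -1).
Proof.
apply/funext => i; rewrite /shift.
have [/andP[i0 iN]|iN] := boolP (in_row n i); last first.
  rewrite !row_of_out//; case: eqP => // ij.
  by move: iN; rewrite ij /in_row /= ltn_ord.
have iE : i = (Ordinal (n := n) (m := i.-1) (ltac:(lia))).+1 :> nat by rewrite /= prednK.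
rewrite {1 2}iE !row_ofE; set i' := Ordinal _ in iE *.
have -> : (i == j.+1) = (i' == j) by rewrite iE eqSS.
by case: e; rewrite !mxE eqxx /=; case: (i' == j).
Qed.

End RowVectors.

Lemma prow_vecE k (y : pattern k) (l : 'rV[int]_(k.+1)./2) :
  prow_vec y k = l <-> pos y k = row_of l.
Proof.
have yk : row_of_length (k.+1)./2 (pos y k) by exact: pos_row_of_length.
split=> [<-|e]; first by rewrite -[LHS](vec_ofK yk).
by rewrite -(row_ofK l) -e.
Qed.

Lemma weylE k (l : 'rV[int]_(k.+1)./2) : weyl l <-> chamber (row_of l).
Proof.
split=> [[l0 dl] [|j]|cl]; first by split.
  have [jn|jn] := ltnP j (k.+1)./2; last first.
    have out i : (j < i)%N -> row_of l i = 0.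
      by move=> ji; rewrite row_of_out// /in_row; lia.
    by split=> [|_]; rewrite !out.
  rewrite -[j]/(nat_of_ord (Ordinal jn)) row_ofE; split=> // _.
  have [jn'|jn'] := ltnP j.+1 (k.+1)./2; last first.
    by rewrite [leLHS]row_of_out//= /in_row; lia.
  rewrite -[X in row_of l X.+1]/(nat_of_ord (Ordinal jn')) row_ofE.
  by apply: dl => /=.
split=> [j|i j ij]; first by rewrite -row_ofE; case: (cl j.+1).
rewrite -!row_ofE -(subnKC ij).
elim: (j - i)%N => [|e ih]; first by rewrite addn0.
rewrite addnS; apply: le_trans ih.
by have [_] := cl (i + e).+1; apply.
Qed.

Definition abs_pattern k (x : pattern k) : pattern k :=
  pattern_of k (fun i j => `|pos x i j|).

Lemma pos_abs k (x : pattern k) i j : pos (abs_pattern x) i j = `|pos x i j|.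
Proof.
rewrite pos_pattern_of; case: ifP => // /negbT/pos_out ->.
by rewrite normr0.
Qed.

Lemma GT_abs k (x : pattern k) :
  GT x <-> (forall p, ~~ wall (prow p) (pcol p) -> 0 <= x p) /\
           nonneg_pattern (abs_pattern x).
Proof.
split=> [[x0 _ xi]|[x0 xa]].
  split=> //; split=> [i j|[|i] ik j /andP[j0 jr]]; first by rewrite pos_abs.
    by move: j0 jr; rewrite /rowlen; lia.
  rewrite !pos_abs; have i2 : (2 <= i.+2 <= k)%N by [].
  have jr1 : (j.-1 < (i.+2)./2)%N by move: jr; rewrite /rowlen; lia.
  have jr2 : (j.-1 < (i.+3)./2)%N by move: jr; rewrite /rowlen; lia.
  have := (xi _ i2 (Ordinal jr1) (Ordinal jr2)).1 erefl.
  rewrite !mxE /= prednK// => ->; split=> //.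
  have [jr3|jr3] := ltnP j (i.+3)./2; last first.
    by rewrite [X in `|X| <= _]pos_out ?normr0// /in_triangle /rowlen; lia.
  have e : j = (j.-1).+1 :> nat by rewrite prednK.
  have := (xi _ i2 (Ordinal jr1) (Ordinal jr3)).2 e.
  by rewrite !mxE /= prednK.
split=> //.
  move=> i ik a b ab; rewrite !mxE -!pos_abs.
  have cr := chamber_row i xa.
  rewrite -(subnKC ab); elim: (b - a)%N => [|e ih]; first by rewrite addn0.
  rewrite addnS; apply: le_trans ih.
  by have [_] := cr (a + e).+1; apply.
move=> i /andP[i2 ik] a b; rewrite !mxE -!pos_abs.
have [_ hx] := xa.
have i1k : (i.-1 < k)%N by lia.
have ar : (0 < a.+1 <= rowlen i.-1)%N by rewrite /= ltn_ord.
have hxi : interl (rowlen i.-1) (pos (abs_pattern x) i.-1) (pos (abs_pattern x) i).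
  by have := hx _ i1k; rewrite (ltn_predK i2).
have [h1 h2] := hxi _ ar.
by split=> ->.
Qed.

Lemma GT_nonneg k (x : pattern k) :
  (GT x /\ forall p, 0 <= x p) <-> nonneg_pattern x.
Proof.
have absE : (forall p, 0 <= x p) -> abs_pattern x = x.
  move=> x0; apply: pos_inj => i j /in_triangleP[p [<- <-]].
  by rewrite pos_abs pos_particle ger0_norm.
split=> [[/GT_abs[_ xa] x0]|px]; first by rewrite -(absE x0).
have x0 p : 0 <= x p by rewrite -pos_particle; case: px.
by split=> //; apply/GT_abs; rewrite absE.
Qed.

(** ** Signs *)

Section Signs.
Variable k : nat.
Implicit Types (y : pattern k) (s : {ffun 'I_k -> bool}).

Definition with_signs y s : pattern k :=
  pattern_of k (fun i j =>
    if wall i j && oapp s false (insub i) then - pos y i j else pos y i j).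

Definition admissible_signs y (i : 'I_k) : pred bool :=
  fun b => b ==> (odd i && (pos y i (rowlen i) != 0)).

Lemma pos_with_signs y s i j : pos (with_signs y s) i j =
  if wall i j && oapp s false (insub i) then - pos y i j else pos y i j.
Proof.
rewrite pos_pattern_of; case: ifP => // /negbT/pos_out ->.
by rewrite oppr0 if_same.
Qed.

Lemma card_admissible_signs y : #|family (admissible_signs y)| = mass y.
Proof.
rewrite card_family /mass foldrE big_map enumT; apply: eq_bigr => i _.
rewrite /sign_weight; case: ifP => h.
  transitivity #|predT : pred bool|; last exact: card_bool.
  by apply: eq_card => b; rewrite unfold_in /admissible_signs h implybT.
transitivity #|pred1 false|; last exact: card1.
by apply: eq_card => b; rewrite unfold_in /admissible_signs h implybF; case: b.
Qed.

Lemma abs_with_signs y s : (forall i j, 0 <= pos y i j) ->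
  abs_pattern (with_signs y s) = y.
Proof.
move=> y0; apply: pos_inj => i j _; rewrite pos_abs pos_with_signs.
by case: ifP; rewrite ?normrN ger0_norm.
Qed.

Lemma with_signs_inj y s s' : s \in family (admissible_signs y) ->
  s' \in family (admissible_signs y) -> with_signs y s = with_signs y s' -> s = s'.
Proof.
move=> /familyP sa /familyP sa' e; apply/ffunP => i.
have /implyP ai := sa i; have /implyP ai' := sa' i.
have := congr1 (fun x => pos x i (rowlen i)) e.
rewrite !pos_with_signs !valK /= wallE eqxx andbT.
move: ai ai'; case: (s i); case: (s' i) => //=.
- by move=> /(_ isT)/andP[-> ne] _ /= h; move: ne; lia.
- by move=> _ /(_ isT)/andP[-> ne] /= h; move: ne; lia.
Qed.

Lemma with_signs_GT y s : nonneg_pattern y -> GT (with_signs y s) /\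
  pos (with_signs y s) k = pos y k.
Proof.
move=> py; have [y0 _] := py; split; last first.
  by apply/funext => j; rewrite pos_with_signs insubN ?ltnn// andbF.
apply/GT_abs; rewrite abs_with_signs//; split=> // p nw.
by rewrite -pos_particle pos_with_signs (negbTE nw) /=; exact: y0.
Qed.

Lemma GT_with_signs (x : pattern k) : GT x -> (forall j, 0 <= pos x k j) ->
  exists2 s, s \in family (admissible_signs (abs_pattern x)) &
    with_signs (abs_pattern x) s = x.
Proof.
move=> /GT_abs[x0 _] xk.
exists [ffun i : 'I_k => odd i && (pos x i (rowlen i) < 0)].
  apply/familyP => i; rewrite ffunE unfold_in; apply/implyP => /andP[-> lt0] /=.
  by rewrite pos_abs normr_eq0 lt_eqF.
apply: pos_inj => i j tij; rewrite pos_with_signs pos_abs.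
have [ik|ki] := ltnP i k; last first.
  rewrite insubN -?leqNgt// andbF ger0_norm//.
  by have -> : i = k by apply/eqP; rewrite eqn_leq ki andbT; case/andP: tij.
rewrite insubT //= ffunE /=; case w : (wall i j) => /=; last first.
  have [p [pi pj]] := in_triangleP tij.
  by rewrite ger0_norm// -pi -pj pos_particle x0// pi pj w.
move: w; rewrite wallE => /andP[-> /eqP ->] /=.
by case: ltrP => h; [rewrite ltr0_norm// opprK|rewrite ger0_norm].
Qed.

End Signs.

Definition patterns_above k (l : 'rV[int]_(k.+1)./2) : set (pattern k) :=
  [set y | nonneg_pattern y /\ pos y k = row_of l].

Lemma patterns_above_finite k (l : 'rV[int]_(k.+1)./2) : finite_set (patterns_above l).
Proof.
have [B hB] : exists B : nat, forall j, row_of l j <= B%:Z.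
  exists (\sum_(i < (k.+1)./2) `|l 0%R i|)%N => j.
  have [/andP[j0 jr]|nj] := boolP (in_row (k.+1)./2 j); last by rewrite row_of_out.
  have jr' : (j.-1 < (k.+1)./2)%N by lia.
  rewrite -(prednK j0) -[j.-1]/(nat_of_ord (Ordinal jr')) row_ofE.
  rewrite (bigD1 (Ordinal jr')) //= PoszD; move: (bigop _ _ _) => r; lia.
pose dec (f : {ffun particle k -> 'I_B.+1}) : pattern k := [ffun p => (f p : nat)%:Z].
apply: (@sub_finite_set _ _ (dec @` setT)); last first.
  by apply: finite_image; exact: finite_finset.
move=> y [py yl]; have [y0 _] := py.
exists [ffun p => inord `|y p|] => //; apply/ffunP => p; rewrite !ffunE.
have yp : 0 <= y p by rewrite -pos_particle.
have pk : (prow p <= k)%N by case/andP: (particle_in_triangle p).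
have yB : y p <= B%:Z.
  rewrite -pos_particle; apply: le_trans (hB (pcol p)); rewrite -yl.
  have pr : (0 < pcol p <= rowlen (prow p))%N by case/andP: (particle_in_triangle p).
  by have := pos_col_le (m := k - prow p) py pr; rewrite subnKC//; apply.
by rewrite inordK ?gez0_abs// ltnS -lez_nat gez0_abs.
Qed.

(** A Gelfand-Tsetlin pattern is given by its absolute values and the signs of
    the entries at the wall. *)
Lemma GT_countE (R : realType) k (l : 'rV[int]_(k.+1)./2) : weyl l ->
  (\esum_(y in patterns_above l) ((mass y)%:R : R)%:E = (GT_count l)%:R%:E)%E.
Proof.
move=> /weylE cl.
pose pairs : set (pattern k * {ffun 'I_k -> bool}) :=
  [set ys | patterns_above l ys.1 /\ ys.2 \in family (admissible_signs ys.1)].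
pose A := [set x : pattern k | GT x /\ prow_vec x k = l].
have AE : A = (fun ys : pattern k * {ffun 'I_k -> bool} => with_signs ys.1 ys.2) @` pairs.
  apply/seteqP; split=> [x [gx /prow_vecE xl]|_ [[y s] [[py yl] sa] <-]] /=.
    have xk j : 0 <= pos x k j by rewrite xl; have [] := cl j.
    have [s sa sx] := GT_with_signs gx xk.
    exists (abs_pattern x, s) => //=; split=> //=; split; first by case/GT_abs: gx.
    by apply/funext => j; rewrite pos_abs ger0_norm// xl.
  by have [g e] := with_signs_GT s py; split=> //; apply/prow_vecE; rewrite e.
have finP : finite_set pairs.
  apply: (@sub_finite_set _ _ (patterns_above l `*` setT)); first by move=> [y s] [].
  by apply: finite_setX; [exact: patterns_above_finite|exact: finite_finset].
have finA : finite_set A by rewrite AE; exact: finite_image.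
have injP : set_inj pairs (fun ys : pattern k * {ffun 'I_k -> bool} => with_signs ys.1 ys.2).
  move=> [y s] [y' s'] /set_mem[/= [py _] sa] /set_mem[/= [py' _] sa'] /= e.
  have yy : y = y'.
    by rewrite -(abs_with_signs s py.1) e abs_with_signs//; case: py'.
  by rewrite -yy in sa' e *; rewrite (with_signs_inj sa sa' e).
have esum1c (V : choiceType) (B : set V) : finite_set B ->
    (\esum_(x in B) (1 : R)%:E = (#|` fset_set B|%fset)%:R%:E)%E.
  move=> finB; rewrite esum_fset// fsbig_finite//= sumEFin.
  by rewrite big_const_seq count_predT iter_addr_0 cardfE.
rewrite -[RHS]esum1c// -/A AE esum_image//.
rewrite (_ : pairs = patterns_above l `*`` (fun y => [set s | s \in family (admissible_signs y)]))//.
rewrite -(@esum_esum _ _ _ (patterns_above l)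
  (fun y => [set s | s \in family (admissible_signs y)]) (fun _ _ => (1 : R)%:E))//.
apply: eq_esum => y _; rewrite [RHS]esum_fset; [|exact: finite_finset|by []].
rewrite -(@bigfs _ _ _ _ (index_enum {ffun 'I_k -> bool})) ?index_enum_uniq//; last first.
  by move=> s _; rewrite mem_index_enum.
by rewrite -card_admissible_signs -sum1_card natr_sum -sumEFin.
Qed.

(** * The jump rates of the last row *)

Section Rates.
Context {R : realType} (k : nat).
Local Notation n := (k.+1)./2.
Local Notation vec := 'rV[int]_n.
Implicit Types (l b : vec) (o : 'I_n * bool).

Definition neighbor l o : vec := if o.2 then l + delta_mx 0 o.1 else l - delta_mx 0 o.1.

Definition opposite o : 'I_n * bool := (o.1, ~~ o.2).

(** The weight of the arrivals at [b] from its neighbor [o]. *)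
Definition into b o : nat :=
  if o.2 then up (row_of b) o.1.+1 else down k (row_of b) o.1.+1.

Lemma row_of_neighbor l o :
  row_of (neighbor l o) = shift (row_of l) o.1.+1 (if o.2 then 1 else -1).
Proof. exact: row_of_shift. Qed.

Lemma neighbor_opposite l o : neighbor (neighbor l o) (opposite o) = l.
Proof. by case: o => j [] /=; rewrite /neighbor /= ?addrK ?subrK. Qed.

Lemma opposite_inv o : opposite (opposite o) = o.
Proof. by case: o => j []. Qed.

Lemma neighbor_sym l b o : (neighbor b o = l) <-> (b = neighbor l (opposite o)).
Proof.
split=> [<-|->]; first by rewrite neighbor_opposite.
by rewrite -{2}(opposite_inv o) neighbor_opposite.
Qed.

Lemma neighbor_neq l o : neighbor l o != l.
Proof.
apply/eqP => /(congr1 (fun x => row_of x o.1.+1)); rewrite row_of_neighbor /shift eqxx.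
by case: o.2; lia.
Qed.

Lemma neighbor_inj l : injective (neighbor l).
Proof.
move=> [j e] [j' e'] /(congr1 (fun x => row_of x)); rewrite !row_of_neighbor /= => h.
have hj := congr1 (fun x => x j.+1) h; move: hj; rewrite /= /shift eqxx.
case: eqP => [[/ord_inj ->]|_]; last by case: (e); lia.
by case: (e); case: (e') => //; lia.
Qed.

Lemma adjacentE l b : Defs.adjacent l b = [exists o, b == neighbor l o].
Proof.
apply/fintype.existsP/fintype.existsP => [[j /orP[h|h]]|[[j []] h]].
- by exists (j, true).
- by exists (j, false).
- by exists j; rewrite h.
- by exists j; rewrite [X in _ || X]h orbT.
Qed.

Lemma row_vec_of_pattern (y : pattern k) : row_of (prow_vec y k) = pos y k.
Proof. by apply/esym/prow_vecE. Qed.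

Lemma weyl_row (y : pattern k) : nonneg_pattern y -> weyl (prow_vec y k).
Proof. by move=> py; apply/weylE; rewrite row_vec_of_pattern; exact: chamber_row. Qed.

(** The pattern all of whose columns are constant has last row [l]. *)
Lemma GT_count_gt0 l : weyl l -> (0 < GT_count l)%N.
Proof.
move=> wl; have cl := (weylE l).1 wl.
pose y : pattern k := pattern_of k (fun _ j => row_of l j).
have yE i j : pos y i j = if in_triangle k i j then row_of l j else 0.
  by rewrite pos_pattern_of.
have py : nonneg_pattern y.
  split=> [i j|i ik j jr]; first by rewrite yE; case: ifP => // _; case: (cl j).
  rewrite !yE; have [l0 dl] := cl j; have [l1 _] := cl j.+1.
  have t1 : in_triangle k i j by rewrite /in_triangle (ltnW ik).
  have t2 : in_triangle k i.+1 j.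
    by rewrite /in_triangle ik; move: jr (rowlenS i); lia.
  rewrite t1 t2; split=> //; case: ifP => // _; apply: dl.
  by case/andP: jr.
have yl : pos y k = row_of l.
  apply/funext => j; rewrite yE /in_triangle leqnn /=.
  by case: ifP => // /negbT nj; rewrite row_of_out.
have := @esum_term_le R _ (patterns_above l) y (fun y => (mass y)%:R%:E).
rewrite (GT_countE R wl) lee_fin ler_nat => h.
apply: leq_trans (mass_gt0 y) (h _ _) => //.
Qed.

Let s l : R := (GT_count l)%:R.

Let s_gt0 l : weyl l -> 0 < s l.
Proof. by move=> /GT_count_gt0 h; rewrite ltr0n. Qed.

Lemma rate_ge0 l b : 0 <= rate R l b.
Proof.
rewrite /rate; case: ifP => // _; rewrite !mulr_ge0//.
by case: ifP.
Qed.

Lemma rate_nweyl l b : ~ weyl b -> rate R l b = 0.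
Proof. by move=> nb; rewrite /rate; case: ifP => // _; rewrite indicE memNset// mulr0. Qed.

Lemma rate_nadjacent l b : (forall o, b <> neighbor l o) -> rate R l b = 0.
Proof.
move=> nb; rewrite /rate adjacentE; case: fintype.existsP => // -[a /eqP ba].
by have := nb a ba.
Qed.

Lemma into_nweyl b o : weyl b -> ~ weyl (neighbor b o) -> into b o = 0%N.
Proof.
move=> wb nw; have nc : ~ chamber (shift (row_of b) o.1.+1 (if o.2 then 1 else -1)).
  by rewrite -row_of_neighbor => /weylE.
by rewrite /into; case: o.2 nc => nc; rewrite /up /down asboolF.
Qed.

(** The factor 2 at the wall is the one of the arrivals from the left. *)
Lemma rate_neighbor b o : (0 < k)%N -> weyl b -> weyl (neighbor b o) ->
  rate R (neighbor b o) b = (into b o)%:R * (s b / s (neighbor b o)).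
Proof.
move=> k0 wb wn; rewrite /rate indicE mem_set// mulr1.
rewrite ifT; last first.
  by rewrite adjacentE; apply/fintype.existsP; exists (opposite o); rewrite neighbor_opposite.
congr (_ * _).
have cn : chamber (shift (row_of b) o.1.+1 (if o.2 then 1 else -1)).
  by rewrite -row_of_neighbor; apply/weylE.
have n_in : in_row n (k.+1)./2 by rewrite /in_row leqnn andbT; lia.
rewrite !row_of_entry// row_of_neighbor /into.
have [bj _] := (weylE b).1 wb o.1.+1.
move: (row_of b) o.2 (o.1.+1) cn bj => x e j cn bj.
case: e cn => cn.
  rewrite /up asboolT// ifF//; apply/negP => /and3P[_ /eqP h1 /eqP h2].
  by move: h1; rewrite /shift; case: eqP => [jE|_]; [rewrite -jE in bj|]; lia.
rewrite /down asboolT// mul1n -/(rowlen k) /shift.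
have -> : (j == rowlen k) && (x j == 1) = (rowlen k == j) && (x (rowlen k) == 1).
  by case: eqP => [->|ne]; rewrite ?eqxx//= eq_sym; move/eqP/negbTE: ne => ->.
have -> : (x (rowlen k) + (if rowlen k == j then -1 else 0) == 0) && (x (rowlen k) == 1) =
    (rowlen k == j) && (x (rowlen k) == 1) by case: ifP; lia.
by case: ifP.
Qed.

Lemma arrivalsR_vec (f : row -> R) b :
  arrivalsR k f (row_of b) = (hold k (row_of b))%:R * f (row_of b) +
    \sum_o (into b o)%:R * f (row_of (neighbor b o)).
Proof.
rewrite /arrivalsR; congr (_ + _).
rewrite [RHS](eq_bigr (fun o : 'I_n * bool => (into b (o.1, o.2))%:R * f (row_of (neighbor b (o.1, o.2))))); last by case.
rewrite -(pair_bigA _ (fun j e => (into b (j, e))%:R * f (row_of (neighbor b (j, e)))))/=.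
by apply: eq_bigr => j _; rewrite big_bool /= !row_of_neighbor addrC.
Qed.

Lemma esum_above l (g : pattern k -> R) (c : R) : 0 <= c ->
  (forall y, nonneg_pattern y -> prow_vec y k = l -> g y = c) ->
  (forall y, nonneg_pattern y -> prow_vec y k <> l -> g y = 0) ->
  (\esum_(y in @nonneg_patterns k) ((mass y)%:R * g y)%:E =
   ((`[< weyl l >])%:R * (s l * c))%:E)%E.
Proof.
move=> c0 gc g0; have [wl|nwl] := pselect (weyl l); last first.
  rewrite asboolF// mul0r; apply: esum1 => y py; rewrite g0 ?mulr0// => yl.
  by apply: nwl; rewrite -yl; exact: weyl_row.
rewrite asboolT// mul1r [RHS]EFinM /s -GT_countE// -esumZr//.
rewrite esum_mkcond [RHS]esum_mkcond; apply: eq_esum => y _.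
case: ifPn => [/set_mem py|npy]; last first.
  by rewrite ifF//; apply/negP => /set_mem[py _]; move/negP: npy; apply; apply/mem_set.
have [yl|nyl] := pselect (prow_vec y k = l).
  by rewrite (gc _ py yl) ifT//; apply/mem_set; split=> //; apply/prow_vecE.
rewrite (g0 _ py nyl) mulr0 ifF//; apply/negP => /set_mem[_ /prow_vecE].
exact: nyl.
Qed.

Let nclocks : R := #|{: clock k}|%:R.

Lemma esum_jumps_out y : nonneg_pattern y ->
  (\esum_(y' in @nonneg_patterns k) ((jumps y y')%:R : R)%:E = nclocks%:E)%E.
Proof.
move=> py; transitivity (\esum_(y' in @nonneg_patterns k)
    \sum_(c : clock k) ((jump c y == y')%:R : R)%:E)%E.
  by apply: eq_esum => y' _; rewrite jumpsE natr_sum -sumEFin.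
rewrite esum_sum//; transitivity (\sum_(c : clock k) (1 : R)%:E)%E; last first.
  by rewrite sumEFin /nclocks -sum1_card natr_sum.
apply: eq_bigr => c _; rewrite (esum_pick (y := jump c y)) ?eqxx//.
  by move=> y' _; rewrite eq_sym => /negbTE ->.
exact: jump_nonneg.
Qed.

Hypothesis k_gt0 : (0 < k)%N.

(** The jumps out of the patterns above [l], with their weights, are counted in
    two ways: every pattern has one jump for each clock, and the arrivals at a
    given pattern depend on its last row only. *)
Lemma sum_rate l : weyl l ->
  nclocks = (hold k (row_of l))%:R + \sum_o rate R l (neighbor l o).
Proof.
move=> wl; have sl0 := s_gt0 wl.
pose f (x : row) : R := (`[< x = row_of l >])%:R.
have f0 x : 0 <= f x by [].
have lhs : (\esum_(y' in @nonneg_patterns k) \esum_(y in @nonneg_patterns k)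
    ((mass y * jumps y y')%:R * f (pos y k))%:E = (s l * nclocks)%:E)%E.
  rewrite esum_exchange; last by move=> y' y _ _; rewrite lee_fin mulr_ge0.
  transitivity (\esum_(y in @nonneg_patterns k) ((mass y)%:R * (f (pos y k) * nclocks))%:E)%E.
    apply: eq_esum => y py; rewrite mulrA EFinM -(esum_jumps_out py) -esumZl//.
      by apply: eq_esum => y' _; rewrite -EFinM natrM; congr (_%:E); ring.
    by rewrite mulr_ge0.
  rewrite (@esum_above l _ nclocks) ?asboolT ?mul1r//.
  - by move=> y _ /prow_vecE ->; rewrite /f asboolT// mul1r.
  - by move=> y _ nyl; rewrite /f asboolF ?mul0r// => /prow_vecE.
have rhs : (\esum_(y' in @nonneg_patterns k) \esum_(y in @nonneg_patterns k)
    ((mass y * jumps y y')%:R * f (pos y k))%:E =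
    (s l * ((hold k (row_of l))%:R + \sum_o rate R l (neighbor l o)))%:E)%E.
  transitivity (\esum_(y in @nonneg_patterns k)
     (((mass y)%:R * ((hold k (pos y k))%:R * f (pos y k)))%:E +
      \sum_o ((mass y)%:R * ((into (prow_vec y k) o)%:R * f (row_of (neighbor (prow_vec y k) o))))%:E))%E.
    apply: eq_esum => y py; rewrite esum_jumps// -{1}row_vec_of_pattern arrivalsR_vec.
    by rewrite row_vec_of_pattern mulrDr EFinD sumEFin mulr_sumr.
  rewrite esumD//; last 2 first.
  - by move=> y _; rewrite lee_fin !mulr_ge0.
  - by move=> y _; apply: sume_ge0 => o _; rewrite lee_fin !mulr_ge0.
  rewrite esum_sum; last by move=> y o _ _; rewrite lee_fin !mulr_ge0.
  rewrite (@esum_above l _ (hold k (row_of l))%:R)//; last 2 first.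
  - by move=> y _ /prow_vecE ->; rewrite /f asboolT// mulr1.
  - by move=> y _ nyl; rewrite /f asboolF ?mulr0// => /prow_vecE.
  rewrite asboolT// mul1r mulrDr EFinD; congr (_ + _)%E.
  rewrite mulr_sumr -sumEFin (reindex_inj (can_inj opposite_inv)) /=; apply: eq_bigr => o _.
  rewrite (@esum_above (neighbor l o) _ (into (neighbor l o) (opposite o))%:R)//; last 2 first.
  - by move=> y _ ->; rewrite neighbor_opposite /f asboolT// mulr1.
  - move=> y _ nyl; rewrite /f asboolF ?mulr0// => /row_of_inj /neighbor_sym.
    by rewrite opposite_inv.
  have [wo|nwo] := pselect (weyl (neighbor l o)); last first.
    by rewrite asboolF// mul0r rate_nweyl// mulr0.
  rewrite asboolT// mul1r; congr (_%:E).
  have := @rate_neighbor (neighbor l o) (opposite o) k_gt0 wo.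
  rewrite neighbor_opposite => -> //; have so0 := s_gt0 wo.
  by rewrite -/(s l); field; rewrite gt_eqF.
move: lhs; rewrite rhs => -[] /mulfI -> //; exact: lt0r_neq0.
Qed.

(** The generator plus the total rate of the clocks, see [gen_kernel]. *)
Definition kernel l b : R :=
  if `[< weyl l /\ weyl b >] then
    (if b == l then (hold k (row_of l))%:R else rate R l b)
  else 0.

Lemma kernel_ge0 l b : 0 <= kernel l b.
Proof. by rewrite /kernel; case: ifP => // _; case: ifP => // _; exact: rate_ge0. Qed.

Let around l (o : option ('I_n * bool)) : vec := if o is Some a then neighbor l a else l.

Let around_inj l : injective (around l).
Proof.
move=> [a|] [a'|] //=; first by move/neighbor_inj ->.
  by move/eqP; rewrite (negbTE (neighbor_neq _ _)).
by move/esym/eqP; rewrite (negbTE (neighbor_neq _ _)).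
Qed.

Lemma esum_around l (g : vec -> R) : weyl l -> (forall b, 0 <= g b) ->
  (forall b, b <> l -> (forall o, b <> neighbor l o) -> g b = 0) ->
  (\esum_(b in @weyl k) (g b)%:E =
   (g l + \sum_o (`[< weyl (neighbor l o) >])%:R * g (neighbor l o))%:E)%E.
Proof.
move=> wl g0 gN; rewrite (esum_finite_support (f := around l)) //; first last.
- move=> b _ nb; rewrite gN//; first exact: (nb None).
  by move=> a; exact: (nb (Some a)).
rewrite (bigD1 None)//= mem_set// EFinD; congr (_ + _)%E.
rewrite (reindex_omap Some id) /=; last by case.
rewrite -sumEFin; apply: eq_big => [a|a _]; first by rewrite eqxx.
have [w|nw] := pselect (weyl (neighbor l a)); first by rewrite asboolT// mul1r mem_set.
by rewrite asboolF// mul0r memNset.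
Qed.

Lemma kernel_sum l : weyl l -> (\esum_(b in @weyl k) (kernel l b)%:E = nclocks%:E)%E.
Proof.
move=> wl; rewrite (esum_around wl (kernel_ge0 l)); last first.
  move=> b bl bN; rewrite /kernel; case: ifP => // _.
  by rewrite (introF eqP bl) rate_nadjacent.
congr (_%:E); rewrite (sum_rate wl) /kernel asboolT// eqxx; congr (_ + _).
apply: eq_bigr => o _; have [w|nw] := pselect (weyl (neighbor l o)); last first.
  by rewrite asboolF// mul0r rate_nweyl.
by rewrite !asboolT// mul1r (negbTE (neighbor_neq _ _)).
Qed.

Lemma gen_kernel l b : weyl l -> weyl b ->
  gen R l b = kernel l b - nclocks * (l == b)%:R.
Proof.
move=> wl wb; rewrite /gen /kernel asboolT// (eq_sym l).
case: eqP => _; last by rewrite mulr0 subr0.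
rewrite mulr1 (sum_rate wl) opprD addNKr; congr (- _).
rewrite (fsbigE [seq neighbor l o | o <- index_enum ('I_n * bool)%type]) /=.
- rewrite big_map; apply: eq_bigl => o.
  by rewrite mem_set//= => /eqP; rewrite (negbTE (neighbor_neq _ _)).
- by rewrite map_inj_uniq ?index_enum_uniq//; exact: neighbor_inj.
- by move=> c /mapP[a _ ->] /= /eqP; rewrite (negbTE (neighbor_neq _ _)).
- move=> c _ nb; apply: rate_nadjacent => o bo; move/negP: nb; apply.
  by apply/mapP; exists o => //; rewrite mem_index_enum.
Qed.

(** The intertwining behind the Markov property of the last row: if the pattern
    is distributed according to [mass] above each last row, a jump preserves
    this and changes the distribution [g] of the last row by [kernel]. *)
Lemma esum_kernel (g : vec -> R) (y' : pattern k) : (forall l, 0 <= g l) ->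
  nonneg_pattern y' ->
  (\esum_(y in @nonneg_patterns k)
     ((jumps y y')%:R * ((mass y)%:R / s (prow_vec y k) * g (prow_vec y k)))%:E =
   ((mass y')%:R / s (prow_vec y' k))%:E *
     \esum_(l in @weyl k) (g l * kernel l (prow_vec y' k))%:E)%E.
Proof.
move=> g0 py'; set b := prow_vec y' k; have wb : weyl b by exact: weyl_row.
pose f (x : row) := g (vec_of n x) / s (vec_of n x).
have fE l : f (row_of l) = g l / s l by rewrite /f row_ofK.
have f0 x : 0 <= f x by rewrite mulr_ge0 ?invr_ge0.
transitivity (\esum_(y in @nonneg_patterns k) ((mass y * jumps y y')%:R * f (pos y k))%:E)%E.
  apply: eq_esum => y py; rewrite -row_vec_of_pattern fE natrM; congr (_%:E).
  by rewrite !mulrA; ring.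
rewrite esum_jumps// -row_vec_of_pattern -/b arrivalsR_vec fE.
rewrite (esum_around (l := b) (g := fun l => g l * kernel l b))//; last 2 first.
- by move=> l; rewrite mulr_ge0 ?kernel_ge0.
- move=> l lb lN; rewrite /kernel; case: ifP => [_|_]; last by rewrite mulr0.
  rewrite (introF eqP (fun e => lb (esym e))) rate_nadjacent ?mulr0// => o /esym/neighbor_sym.
  exact: lN.
rewrite -EFinM; congr (_%:E); have sb0 := s_gt0 wb.
rewrite -mulrA; congr (_ * _); rewrite mulrDr mulr_sumr; congr (_ + _).
  rewrite /kernel asboolT// eqxx; ring.
apply: eq_bigr => o _; rewrite fE.
have [wo|nwo] := pselect (weyl (neighbor b o)); last by rewrite into_nweyl// asboolF// !mul0r mulr0.
rewrite !asboolT// mul1r /kernel asboolT// eq_sym (negbTE (neighbor_neq _ _)).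
rewrite rate_neighbor// /s; have so0 := s_gt0 wo.
by field; rewrite !gt_eqF.
Qed.

Lemma esum_preimage_jumps (v : pattern k -> \bar R) y' : (forall y, 0 <= v y)%E ->
  (\esum_(cy in [set cy : clock k * pattern k | jump cy.1 cy.2 = y']) v cy.2 =
   \esum_(y in setT) (jumps y y')%:R%:E * v y)%E.
Proof.
move=> v0.
transitivity (\esum_(y in [set: pattern k]) \esum_(c in [set c : clock k | jump c y = y']) v y)%E.
  rewrite (@esum_esum _ _ _ setT (fun y => [set c : clock k | jump c y = y']) (fun y _ => v y))//.
  apply: (reindex_esum _ _ (fun x : pattern k * clock k => (x.2, x.1))); split=> /=.
  - by move=> [y c] [].
  - by move=> [y1 c1] [y2 c2] /= _ _ [] -> ->.
  - by move=> [c y] /= cy; exists (y, c).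
apply: eq_esum => y _; rewrite esum_mkcond esum_fset; last 2 first.
- exact: finite_finset.
- by move=> c _; case: ifP.
rewrite (@fsbigE _ _ _ _ _ (index_enum (clock k)))//=; last 2 first.
- exact: index_enum_uniq.
- by move=> c _; rewrite mem_index_enum.
rewrite jumpsE natr_sum -sumEFin ge0_sume_distrl; last by move=> c _; rewrite lee_fin.
apply: eq_big => [c|c _]; first by rewrite mem_set.
case: eqP => [cy|ncy]; first by rewrite mem_set ?mul1e.
by rewrite memNset// mul0e.
Qed.

End Rates.

(** * Many short steps approximate the semigroup *)

Section ManySteps.
Context {R : realType}.
Implicit Types (c : nat -> R) (e T : R).

(** The last of [m + 1] steps is a jump or not. *)
Lemma pascal_sum_le c e m M : 0 <= e -> (forall j, 0 <= c j) ->
  \sum_(j < M) ('C(m.+1, j))%:R * e ^+ j * c j <=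
  \sum_(j < M) ('C(m, j))%:R * e ^+ j * c j +
  e * \sum_(j < M) ('C(m, j))%:R * e ^+ j * c j.+1.
Proof.
move=> e0 c0; case: M => [|M]; first by rewrite !big_ord0 mulr0 addr0.
rewrite big_ord_recl [X in _ <= X + _]big_ord_recl [X in _ <= _ + _ * X]big_ord_recr /=.
rewrite !bin0 -addrA lerD2l mulrDr addrA -[leLHS]addr0 lerD//; last by rewrite !mulr_ge0 ?exprn_ge0.
rewrite mulr_sumr -big_split /=; apply: ler_sum => j _.
by rewrite /bump /= add1n binS natrD exprS; lra.
Qed.

Lemma bernoulli_ge (x : R) j : 0 <= x <= 1 -> 1 - j%:R * x <= (1 - x) ^+ j.
Proof.
move=> /andP[x0 x1]; elim: j => [|j ih]; first by rewrite expr0 mul0r subr0.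
rewrite exprS; apply: le_trans (ler_wpM2l _ ih); last by rewrite subr_ge0.
have j0 : 0 <= j%:R * x * x by rewrite !mulr_ge0.
by rewrite -natr1; lra.
Qed.

(** The binomial weights of [n = M + m + 1] steps of length [T / n] dominate the
    Poisson weights up to a factor close to 1. *)
Lemma binomial_poisson_ge T M m j : 0 <= T -> (j <= M)%N ->
  (1 - M%:R * ((M%:R + T) / m.+1%:R)) * (T ^+ j / j`!%:R) <=
  ('C(M + m.+1, j))%:R * (1 - expR (- (T / (M + m.+1)%:R))) ^+ j.
Proof.
move=> T0 jM; set n := (M + m.+1)%N.
have n0 : 0 < n%:R :> R by rewrite ltr0n /n addnS.
have m0 : 0 < m.+1%:R :> R by rewrite ltr0n.
have nT : 0 < n%:R + T by rewrite ltr_wpDr.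
have f0 : 0 < j`!%:R :> R by rewrite ltr0n fact_gt0.
set x := (M%:R + T) / (n%:R + T).
have xE : 1 - x = m.+1%:R / (n%:R + T).
  rewrite /x -[X in X - _](divff (lt0r_neq0 nT)) -mulrBl; congr (_ / _).
  by rewrite /n natrD; ring.
have x01 : 0 <= x <= 1.
  apply/andP; split; first by rewrite divr_ge0 ?addr_ge0// ltW.
  by rewrite -subr_ge0 xE divr_ge0// ltW.
have step_ge : T / (n%:R + T) <= 1 - expR (- (T / n%:R)).
  have h : expR (- (T / n%:R)) <= n%:R / (n%:R + T).
    rewrite expRN -[leRHS]invf_div lef_pV2 ?posrE ?expR_gt0 ?divr_gt0//.
    by apply: le_trans (expR_ge1Dx _); rewrite mulrDl divff ?gt_eqF.
  have -> : T / (n%:R + T) = 1 - n%:R / (n%:R + T) by field; rewrite gt_eqF.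
  lra.
apply: (@le_trans _ _ ((1 - x) ^+ j * (T ^+ j / j`!%:R))).
  rewrite ler_wpM2r ?divr_ge0 ?exprn_ge0//.
  apply: le_trans (bernoulli_ge _ x01); rewrite lerD2l lerN2.
  have /andP[x0 _] := x01.
  rewrite ler_pM ?ler_nat// /x ler_wpM2l ?addr_ge0// lef_pV2 ?posrE//.
  by rewrite /n natrD; have := ler0n R M; lra.
rewrite xE -ffactnn.
have -> : (m.+1%:R / (n%:R + T)) ^+ j * (T ^+ j / (j ^_ j)%:R) =
    (m.+1%:R ^+ j / (j ^_ j)%:R) * (T / (n%:R + T)) ^+ j.
  by rewrite !exprMn; ring.
apply: ler_pM.
- by rewrite divr_ge0 ?exprn_ge0.
- by rewrite exprn_ge0// divr_ge0// ltW.
- rewrite ffactnn ler_pdivrMr// -natrX -natrM ler_nat bin_ffact ffact_prod.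
  rewrite -[X in (_ ^ X)%N]card_ord -prod_nat_const; apply: leq_prod => i _.
  by have := ltn_ord i; rewrite /n; lia.
- have t0 : 0 <= T / (n%:R + T) by apply: divr_ge0 => //; exact: ltW.
  by rewrite lerXn2r ?nnegrE//; exact: le_trans step_ge.
Qed.

Lemma le_of_defect (c C : R) (x : \bar R) : 0 <= c -> 0 <= C ->
  (forall m, ((1 - C / m.+1%:R) * c)%:E <= x)%E -> (c%:E <= x)%E.
Proof.
move=> c0 C0 h; apply/lee_subgt0Pr => e e0.
pose m := Num.truncn (C * c / e).
apply: le_trans (h m); rewrite lee_fin.
have m0 : 0 < m.+1%:R :> R by rewrite ltr0n.
have : C * c / e < m.+1%:R by rewrite /m truncnS_gt.
rewrite ltr_pdivrMr// => hm.
have : C / m.+1%:R * c <= e by rewrite mulrAC ler_pdivrMr// [e * _]mulrC ltW.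
by rewrite mulrBl mul1r lerD2l lerN2.
Qed.

End ManySteps.

(** All the terms but one are cancelled from the two totals; they have a finite
    sum. *)
Lemma esum_le_eq (R : realType) (A : choiceType) (I : set A) (f g : A -> \bar R) (r : R) :
  (forall a, I a -> 0 <= f a)%E -> (forall a, I a -> f a <= g a)%E ->
  (\esum_(a in I) f a = r%:E)%E -> (\esum_(a in I) g a <= r%:E)%E ->
  forall a, I a -> f a = g a.
Proof.
move=> f0 fg fr gr a Ia; apply/eqP; rewrite eq_le fg//=.
have g0 b : I b -> (0 <= g b)%E by move=> Ib; exact: le_trans (f0 b Ib) (fg b Ib).
have split_sum (h : A -> \bar R) : (forall b, I b -> 0 <= h b)%E ->
    (\esum_(b in I) h b = h a + \esum_(b in I `&` ~` [set a]) h b)%E.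
  move=> h0; rewrite (esumID [set a])//; congr (_ + _)%E.
  rewrite (_ : _ `&` _ = [set a]); last by apply/seteqP; split=> [b []|b ->].
  by rewrite esum_set1// h0.
move: gr; rewrite -fr (split_sum f f0) (split_sum g g0) => gr.
set F := (\esum_(b in _) f b)%E in gr fr *.
have F0 : (0 <= F)%E by apply: esum_ge0 => b [Ib _]; exact: f0.
have Ffin : F \is a fin_num.
  rewrite ge0_fin_numE//; apply: (@le_lt_trans _ _ r%:E); last exact: ltry.
  by rewrite -fr (split_sum f f0) leeDr// f0.
rewrite -(leeD2rE _ _ Ffin); apply: le_trans gr; rewrite leeD2l//.
by apply: le_esum => b [Ib _]; exact: fg.
Qed.

(** * The law of the last row *)

Section LastRow.
Context {R : realType} d (T : measurableType d) (P : probability T R) (k : nat).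
Hypothesis k_gt0 : (0 < k)%N.
Context (tau : clock k -> nat -> {RV P >-> R}) (Y : R -> T -> pattern k).
Hypothesis X_indep : mutually_independent (fun cm : clock k * nat => tau cm.1 cm.2).
Hypothesis X_exp : forall c m B, measurable B ->
  distribution P (tau c m) B = exponential_prob 1 B.
Variable good : set T.
Hypothesis good_measurable : measurable good.
Hypothesis good_null : P (~` good) = 0%E.
Hypothesis good_rules : forall w, good w ->
  follows_rules (fun c n => \sum_(m < n.+1) tau c m w) (Y^~ w).
Hypothesis good_pos : forall w, good w -> forall c m, 0 < tau c m w.
Local Notation vec := 'rV[int]_(k.+1)./2.
Local Notation E := (@weyl k).
Local Notation feasible := (feasible tau Y good).
Local Notation K := (@kernel R k).
Local Notation N := (#|{: clock k}|%:R : R).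
Local Notation kpow := (kpow E K).
Local Notation trans := (ptrans E K N).
Local Notation row_at y := (prow_vec y k).
Implicit Types (l x : vec) (y : pattern k) (a u h t : R) (H : set T).

Let K_sum l : E l -> (\esum_(b in E) (K l b)%:E = N%:E)%E := kernel_sum k_gt0 (l := l).
Let K_ge0 := @kernel_ge0 R k.
Let N_ge0 : 0 <= N := ler0n _ _.

(** The law of the absolute values of a uniform Gelfand-Tsetlin pattern with a
    given last row. *)
Definition uniform_above y : R :=
  (`[< nonneg_pattern y >])%:R * ((mass y)%:R / (GT_count (row_at y))%:R).

Lemma uniform_above_ge0 y : 0 <= uniform_above y.
Proof. by rewrite mulr_ge0// divr_ge0. Qed.
Hint Resolve uniform_above_ge0 : core.

Lemma esum_uniform_above l : E l ->
  (\esum_(y in [set y | row_at y = l]) (uniform_above y)%:E = 1)%E.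
Proof.
move=> El; have s0 : 0 < (GT_count l)%:R :> R by rewrite ltr0n GT_count_gt0.
transitivity (\esum_(y in patterns_above l) ((mass y)%:R%:E * ((GT_count l)%:R^-1)%:E) : \bar R)%E.
  rewrite esum_mkcond [RHS]esum_mkcond; apply: eq_esum => y _.
  have [yl|nyl] := pselect (row_at y = l); last first.
    by rewrite memNset// memNset// => -[_ /prow_vecE].
  rewrite mem_set// /uniform_above yl.
  have [py|npy] := pselect (nonneg_pattern y).
    by rewrite asboolT// mul1r mem_set//; split=> //; apply/prow_vecE.
  by rewrite asboolF// mul0r memNset// => -[].
rewrite esumZr ?invr_ge0//.
by rewrite GT_countE// -EFinM divff// gt_eqF.
Qed.

Lemma uniform_above_le1 y : uniform_above y <= 1.
Proof.
have [py|npy] := pselect (nonneg_pattern y); last by rewrite /uniform_above asboolF// mul0r.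
rewrite -lee_fin -(esum_uniform_above (weyl_row py)).
by apply: (esum_term_le (a := fun y => (uniform_above y)%:E)) => // z _; rewrite lee_fin.
Qed.

Lemma uniform_above_jumps (g : vec -> R) y : (forall l, 0 <= g l) -> nonneg_pattern y ->
  (\esum_(cy in [set cy : clock k * pattern k | jump cy.1 cy.2 = y])
     (uniform_above cy.2 * g (row_at cy.2))%:E =
   (uniform_above y)%:E * \esum_(l in E) (g l * K l (row_at y))%:E)%E.
Proof.
move=> g0 py.
rewrite (esum_preimage_jumps (v := fun y => (uniform_above y * g (row_at y))%:E)); last first.
  by move=> z; rewrite lee_fin mulr_ge0.
rewrite [X in (X%:E * _)%E]/uniform_above asboolT// mul1r -esum_kernel//.
rewrite esum_mkcond [RHS]esum_mkcond; apply: eq_esum => z _.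
rewrite in_setT -EFinM /uniform_above; case: ifPn => [/set_mem pz|npz].
  by rewrite asboolT// mul1r.
by rewrite asboolF ?mul0r ?mulr0// => pz; move/negP: npz; apply; apply/mem_set.
Qed.

(** ** A step, many steps, a time interval *)

Section Interval.
Variables (H : set T) (a u : R) (x0 : vec).
Hypotheses (a0 : 0 <= a) (u0 : 0 <= u) (Ex0 : E x0).
Hypothesis start : feasible u H
  (fun y => (a * uniform_above y * (row_at y == x0)%:R)%:E).

(** In each of [m] steps of length [h] the pattern either stays or jumps, which
    gives binomial weights to the powers of the kernel. *)
Lemma feasible_many_steps h m M : 0 <= h -> feasible (u + m%:R * h) H (fun y =>
  (uniform_above y * (a * expR (- (N * (m%:R * h))) *
     \sum_(j < M) ('C(m, j))%:R * (1 - expR (- h)) ^+ j * kpow j x0 (row_at y)))%:E).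
Proof.
move=> h0; set e := 1 - expR (- h).
have e0 : 0 <= e by rewrite subr_ge0 expR_le1 oppr_le0.
have kp0 j l : 0 <= kpow j x0 l by exact: kpow_ge0.
elim: m => [|m ih].
  rewrite mul0r addr0 mulr0 oppr0 expR0 mulr1.
  apply: feasible_le start => y; rewrite lee_fin mulrCA -mulrA ler_wpM2l// ler_wpM2l//.
  case: M => [|M]; first by rewrite big_ord0.
  rewrite big_ord_recl big1 => [|j _]; last by rewrite bin0n !mul0r.
  by rewrite bin0 expr0 !mul1r addr0 /= eq_sym.
have [g gE] : exists g : vec -> R, forall l, g l = a * expR (- (N * (m%:R * h))) *
    \sum_(j < M) ('C(m, j))%:R * e ^+ j * kpow j x0 l by eexists.
have g0 l : 0 <= g l.
  by rewrite gE !mulr_ge0 ?expR_ge0//; apply: sumr_ge0 => j _; rewrite !mulr_ge0 ?exprn_ge0.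
have {}ih : feasible (u + m%:R * h) H (fun y => (uniform_above y * g (row_at y))%:E).
  by apply: feasible_le ih => y; rewrite gE.
have := feasible_step X_indep X_exp good_measurable good_null good_rules good_pos
  (u := u + m%:R * h) (h := h) _ h0 _ ih.
rewrite -addrA -[X in _ + (_ + X)]mul1r -mulrDl natr1 => /(_ _ _)/feasible_le; apply; last 2 first.
- by rewrite addr_ge0// mulr_ge0.
- by move=> y; rewrite lee_fin mulr_ge0// g0.
move=> y; have [py|npy] := pselect (nonneg_pattern y); last first.
  rewrite {1}/uniform_above asboolF// !mul0r mule_ge0 ?lee_fin ?expR_ge0//.
  rewrite adde_ge0 ?lee_fin ?mulr_ge0//.
  by apply: mule_ge0; [|apply: esum_ge0 => cy _]; rewrite lee_fin// mulr_ge0.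
rewrite (uniform_above_jumps g0 py).
have Ey := weyl_row py.
have -> : (\esum_(l in E) (g l * K l (row_at y))%:E = (a * expR (- (N * (m%:R * h))) *
    \sum_(j < M) ('C(m, j))%:R * e ^+ j * kpow j.+1 x0 (row_at y))%:E)%E.
  rewrite EFinM -sumEFin.
  transitivity ((a * expR (- (N * (m%:R * h))))%:E * \sum_(j < M) \esum_(l in E)
      ('C(m, j)%:R * e ^+ j * (kpow j x0 l * K l (row_at y)))%:E)%E.
    rewrite -esum_sum; last by move=> l j _ _; rewrite lee_fin !mulr_ge0 ?exprn_ge0.
    rewrite -esumZl; last 2 first.
    - by rewrite mulr_ge0 ?expR_ge0.
    - by move=> l _; apply: sume_ge0 => j _; rewrite lee_fin !mulr_ge0 ?exprn_ge0.
    apply: eq_esum => l _; rewrite sumEFin -EFinM gE -mulrA mulr_suml.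
    by congr ((_ * _)%:E); apply: eq_bigr => j _; rewrite mulrA.
  congr (_ * _)%E; apply: eq_bigr => j _.
  rewrite EFinM (kpowS K_ge0 N_ge0 K_sum)// -esumZl ?mulr_ge0 ?exprn_ge0//.
  by move=> l _; rewrite lee_fin mulr_ge0.
rewrite gE -!EFinM lee_fin -/e.
have -> : - (N * (m.+1%:R * h)) = - (N * h) + - (N * (m%:R * h)) by rewrite -natr1; ring.
rewrite expRD.
have := @pascal_sum_le R (fun j => kpow j x0 (row_at y)) e m M e0 (fun j => kp0 j _).
set S1 := (X in X <= _); set S2 := (X in _ <= X + _); set S3 := (X in _ <= _ + e * X) => le_S.
have w0 : 0 <= uniform_above y * (a * (expR (- (N * h)) * expR (- (N * (m%:R * h))))).
  by rewrite !mulr_ge0 ?expR_ge0.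
rewrite [leLHS]mulrA; apply: le_trans (ler_wpM2l w0 le_S) _.
by rewrite le_eqVlt; apply/orP; left; apply/eqP; rewrite /S2 /S3; ring.
Qed.

(** The steps become shorter while the number of jumps is truncated at [M];
    then [M] goes to infinity. *)
Lemma feasible_interval t : 0 <= t -> feasible (u + t) H (fun y =>
  (a * uniform_above y * trans t x0 (row_at y))%:E).
Proof.
move=> t0.
have kp0 j l : 0 <= kpow j x0 l by exact: kpow_ge0.
pose c M y := a * uniform_above y * \sum_(j < M) poisson_wt N t j * kpow j x0 (row_at y).
have c0 M y : 0 <= c M y.
  by rewrite !mulr_ge0//; apply: sumr_ge0 => j _; rewrite mulr_ge0// poisson_wt_ge0.
have truncated M : feasible (u + t) H (fun y => (c M y)%:E).
  pose C : R := M%:R * (M%:R + t).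
  have C0 : 0 <= C by rewrite mulr_ge0// addr_ge0.
  have approx m : feasible (u + t) H (fun y => ((1 - C / m.+1%:R) * c M y)%:E).
    have n0 : (M + m.+1)%:R != 0 :> R by rewrite pnatr_eq0 addnS.
    have h0 : 0 <= t / (M + m.+1)%:R by rewrite divr_ge0.
    have := feasible_many_steps (M + m.+1) M h0; rewrite mulrCA divff// mulr1.
    apply: feasible_le => y; rewrite lee_fin /c.
    rewrite mulrCA.
    have -> w z (b : R) : w * (a * z * b) = a * w * (z * b) by ring.
    rewrite ler_wpM2l ?mulr_ge0//.
    rewrite !mulr_sumr; apply: ler_sum => j _.
    have jM : (j <= M)%N by exact: ltnW.
    have := binomial_poisson_ge m t0 jM.
    rewrite /poisson_wt => h; rewrite !mulrA ler_wpM2r//.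
    by rewrite -!mulrA mulrCA ler_wpM2l ?expR_ge0.
  apply: feasible_le (feasible_sup approx) => y.
  apply: (le_of_defect (c0 M y) C0) => m; apply: ereal_sup_ubound.
  by exists m.
apply: feasible_le (feasible_sup truncated) => y.
have [py|npy] := pselect (nonneg_pattern y); last first.
  rewrite /uniform_above asboolF// mul0r mulr0 mul0r.
  by apply: le_trans (_ : (c 0%N y)%:E <= _)%E; [rewrite lee_fin|apply: ereal_sup_ubound; exists 0%N].
rewrite EFinM (ptransE K_ge0 N_ge0 K_sum t0 Ex0 (weyl_row py)).
have pk0 j : (0 <= (poisson_wt N t j * kpow j x0 (row_at y))%:E)%E.
  by rewrite lee_fin mulr_ge0// poisson_wt_ge0.
have term0 j : (0 <= (a * uniform_above y)%:E *
    (poisson_wt N t j * kpow j x0 (row_at y))%:E)%E.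
  by apply: mule_ge0 => //; rewrite lee_fin mulr_ge0.
rewrite -esumZl ?mulr_ge0// -nneseries_esumT//.
apply: lime_le; first exact: is_cvg_nneseries.
apply: nearW => M; apply: le_trans (_ : _ <= (c M y)%:E)%E _; last first.
  by apply: ereal_sup_ubound; exists M.
by rewrite big_mkord /c mulr_sumr -sumEFin; under eq_bigr do rewrite -EFinM.
Qed.

End Interval.

(** ** Exact probabilities *)

(** Conditionally on the event [H], of probability [a], the process has last row
    [x0] at time [u] and the pattern follows [uniform_above]. *)
Definition located u H a x0 : Prop :=
  [/\ measurable H, P H = a%:E, 0 <= a & feasible u H
   (fun y => (a * uniform_above y * (row_at y == x0)%:R)%:E)].

Hypothesis row_measurable : forall t l, 0 <= t -> measurable [set w | row_at (Y t w) = l].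

(** The lower bounds for the possible new rows add up to the probability of [H],
    hence all of them are equalities. *)
Lemma located_step u v H a x0 : 0 <= u -> u <= v -> E x0 -> located u H a x0 ->
  forall l, E l -> located v (H `&` [set w | row_at (Y v w) = l])
    (a * trans (v - u) x0 l) l.
Proof.
move=> u0 uv Ex0 [mH PH a0 fH].
have uv0 : 0 <= v - u by rewrite subr_ge0.
have := feasible_interval a0 u0 Ex0 fH uv0; rewrite subrKC => fv.
have tr0 l : 0 <= trans (v - u) x0 l by exact: ptrans_ge0.
have mG l : measurable (H `&` [set w | row_at (Y v w) = l]).
  by apply: measurableI => //; apply: row_measurable; exact: le_trans uv.
have lower l : E l -> ((a * trans (v - u) x0 l)%:E <=
    P (H `&` [set w | row_at (Y v w) = l]))%E.
  move=> El; have := feasible_measure (A := [set y | row_at y = l]) good_measurable good_null fv (mG l).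
  move=> /(_ (fun w _ Hw Yw => conj Hw Yw))h; apply: le_trans h.
  rewrite -[leLHS]mule1 -(esum_uniform_above El) -esumZl ?mulr_ge0//; last by move=> y _; rewrite lee_fin.
  by apply: le_esum => y <-; rewrite -EFinM lee_fin mulrAC.
have total : (\esum_(l in E) (a * trans (v - u) x0 l)%:E = a%:E)%E.
  transitivity (a%:E * \esum_(l in E) (trans (v - u) x0 l)%:E)%E.
    by rewrite -esumZl// => l _; rewrite lee_fin.
  by rewrite (ptrans_sum1 K_ge0 N_ge0 K_sum)// mule1.
have exact := esum_le_eq _ lower total _.
move=> l El; split=> //.
- rewrite exact//; first by move=> b _; rewrite lee_fin mulr_ge0.
  rewrite -PH; apply: (esum_measure_le good_measurable good_null) => //.
  + by move=> b b' w _ _ _ [_ <-] [_ <-].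
  + by move=> b w _ _ [].
- by rewrite mulr_ge0.
- apply: (@feasible_sub _ _ _ _ _ _ _ _ v H _ [set y | row_at y = l]); last 2 first.
  + by move=> w _ Hw Yw.
  + by move=> y /= nl; rewrite lee_fin (introF eqP nl) mulr0.
  apply: feasible_le fv => y; rewrite lee_fin; case: eqP => [->|_].
    by rewrite mulr1 mulrAC.
  by rewrite mulr0 !mulr_ge0.
Qed.

(** Only the zero pattern has last row 0. *)
Lemma located_start : located 0 setT 1 0.
Proof.
split=> //; first exact: probability_setT.
apply: feasible_le (feasible_start X_exp good_rules) => y.
rewrite mul1r; case: eqP => [h|nh]; case: eqP => [y0|ny0]; rewrite ?mulr0 ?mulr1//.
  by rewrite lee_fin uniform_above_le1.
rewrite lee_fin /uniform_above.
have [py|npy] := pselect (nonneg_pattern y); last by rewrite asboolF// mul0r.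
exfalso; apply: ny0; apply: pos_inj => i j tij; have [yp _] := py.
have [p [pi pj]] := in_triangleP tij.
rewrite -[in RHS]pi -[in RHS]pj pos_particle ffunE.
apply/eqP; rewrite eq_le yp andbT; have /andP[ik jr] := tij.
have := pos_col_le (m := k - i) py jr; rewrite subnKC// => /(_ (leqnn _)).
rewrite ((prow_vecE _ _).1 h); suff -> : row_of (0 : vec) j = 0 by [].
by case: (j) => //= j'; case: insub => //= v; rewrite mxE.
Qed.

Lemma history_located (n : nat) (t : nat -> R) (x : nat -> vec) : 0 <= t 0%N ->
  (forall i, (i < n)%N -> t i <= t i.+1) -> (forall i, (i <= n)%N -> E (x i)) ->
  exists a, located (t n) [set w | forall i, (i <= n)%N -> row_at (Y (t i) w) = x i] a (x n).
Proof.
move=> t0; elim: n => [|n ih] tS Ex.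
  have E0 : E 0 by split=> [j|i j _]; rewrite !mxE.
  have := located_step (lexx 0) t0 E0 located_start (Ex 0%N (leqnn _)).
  rewrite setTI subr0 mul1r => h; exists (trans (t 0%N) 0 (x 0%N)).
  rewrite (_ : [set w | _] = [set w | row_at (Y (t 0%N) w) = x 0%N])//.
  by apply/seteqP; split=> w /= hw; [exact: hw|move=> i; rewrite leqn0 => /eqP ->].
have [a la] := ih (fun i ni => tS i (ltnW ni)) (fun i ni => Ex i (leqW ni)).
have tn0 m : (m <= n)%N -> 0 <= t m.
  elim: m => // m ihm mn; apply: le_trans (ihm (ltnW mn)) _.
  by apply: tS; exact: leqW.
have := located_step (tn0 n (leqnn _)) (tS n (leqnn _)) (Ex n (leqnSn _)) la (Ex n.+1 (leqnn _)).
set H := [set w | _] `&` _ => h; exists (a * trans (t n.+1 - t n) (x n) (x n.+1)).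
rewrite (_ : [set w | _] = H)//; apply/seteqP; split=> [w hw|w [hw hn] i].
  by split=> [i ni|]; apply: hw => //; exact: leqW.
by rewrite leq_eqVlt => /orP[/eqP ->//|]; exact: hw.
Qed.

Lemma row_markov_property (n : nat) (t : nat -> R) (x : nat -> vec) :
  0 <= t 0%N -> (forall i, (i <= n)%N -> t i <= t i.+1) ->
  (forall i, (i <= n.+1)%N -> E (x i)) ->
  P [set w | forall i, (i <= n.+1)%N -> row_at (Y (t i) w) = x i] =
  (P [set w | forall i, (i <= n)%N -> row_at (Y (t i) w) = x i] *
   (trans (t n.+1 - t n)%R (x n) (x n.+1))%:E)%E.
Proof.
move=> t0 tS Ex.
have [a la] := history_located t0 (fun i ni => tS i (ltnW ni)) (fun i ni => Ex i (leqW ni)).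
have tn0 m : (m <= n)%N -> 0 <= t m.
  elim: m => // m ihm mn; apply: le_trans (ihm (ltnW mn)) _.
  by apply: tS; exact: ltnW.
have := located_step (tn0 n (leqnn _)) (tS n (leqnn _)) (Ex n (leqnSn _)) la (Ex n.+1 (leqnn _)).
case: la => _ -> _ _ [_ + _ _]; rewrite -EFinM => <-; congr (P _).
apply/seteqP; split=> [w hw|w [hw hn] i].
  by split=> [i ni|]; apply: hw => //; exact: leqW.
by rewrite leq_eqVlt => /orP[/eqP ->//|]; exact: hw.
Qed.

End LastRow.

(** * The theorem *)

Theorem corollary7p2 (R : realType) (d : measure_display)
    (T : measurableType d) (P : probability T R) (k : nat) (k_ge1 : (1 <= k)%N)
    (tau : clock k -> nat -> {RV P >-> R}) (Y : R -> T -> pattern k)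
    (hY : particle_process tau Y) :
  markov_process P (@weyl k) (fun t w => prow_vec (Y t w) k) (@gen R k).
Proof.
have [X_exp X_indep Y_meas rules] := hY.
have row_meas t l : 0 <= t -> measurable [set w | prow_vec (Y t w) k = l].
  move=> t0; rewrite (_ : [set w | _] =
    \bigcup_(y in [set y | prow_vec y k = l]) [set w | Y t w = y]); last first.
    by apply/seteqP; split=> [w yl|w [y yl /= ->]] //=; exists (Y t w).
  rewrite bigcup_mkcond; apply: bigcup_measurable_countType => y.
  by case: ifP => _; [exact: Y_meas|exact: measurable0].
(* the path follows the rules and all waiting times are positive outside [B] *)
have [B [mB PB HB]] := negligibleU rules (wait_pos_ae X_exp).
pose good := ~` B.
have mgood : measurable good by exact: measurableC.
have goodN : P (~` good) = 0%E by rewrite setCK.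
have good_rules w : good w -> follows_rules (fun c n => \sum_(m < n.+1) tau c m w) (Y^~ w).
  by move=> gw; apply: contrapT => nw; apply: gw; apply: HB; left.
have good_pos w : good w -> forall c m, 0 < tau c m w.
  by move=> gw c m; apply: contrapT => nw; apply: gw; apply: HB; right => h; apply: nw; apply: h.
have K_ge0 := @kernel_ge0 R k.
have N_ge0 : 0 <= #|{: clock k}|%:R :> R by [].
have K_sum := @kernel_sum R k k_ge1.
exists (ptrans (@weyl k) (@kernel R k) #|{: clock k}|%:R); split.
- exact: ptrans_transition.
- move=> l b El Eb; rewrite gen_kernel//.
  exact: (ptrans_generator K_ge0 N_ge0 K_sum El Eb).
- split=> //.
  + exists B; split=> // w nw; apply: contrapT => gw; apply: nw => t t0.
    by have [st _ _ _] := good_rules w gw; apply: weyl_row; apply/GT_nonneg/st.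
  + move=> n t x t0 tS Ex.
    exact: (row_markov_property k_ge1 X_indep X_exp mgood goodN good_rules good_pos row_meas t0 tS Ex).
Qed.
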